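(* There is an algorithm that, given a head-cycle-free program $\Pi$ and a tree decomposition $\mathcal T=(T,\chi)$ of the primal graph $G_\Pi$ of width $k$ with $g$ nodes, decides whether $\Pi$ has an answer set in time $\mathcal O(3^{k}\cdot k!\cdot g)=\mathcal O(2^{k\log k}\cdot g)$.
   Context: A program $\Pi$ is a finite set of rules $a_1\vee\cdots\vee a_\ell \leftarrow a_{\ell+1},\ldots,a_m,\neg a_{m+1},\ldots,\neg a_n$; $H_r$, $B^+_r$, $B^-_r$ denote head, positive body, negative body of rule $r$. $I$ satisfies $r$ if $(H_r\cup B^-_r)\cap I\neq\emptyset$ or $B^+_r\setminus I\neq\emptyset$. The reduct $\Pi^I$ deletes rules with $B^-_r\cap I\ne\emptyset$ and then all negative literals; $I$ is an answer set if it is a minimal model of $\Pi^I$. The positive dependency digraph $D_\Pi$ has an edge $(a,b)$ whenever $a\in B^+_r$, $b\in H_r$ for a rule $r$; $\Pi$ is head-cycle-free if $D_\Pi$ has no directed cycle containing two distinct atoms of the same head $H_r$. It is assumed that every atom of $\Pi$ occurs in the head of some rule. The primal graph $G_\Pi$ has the atoms as vertices and an edge between two atoms occurring together in some rule. A tree decomposition of a graph $G=(V,E)$ is a rooted tree $T$ with bags $\chi(t)\subseteq V$ such that every vertex and every edge is contained in some bag, and for every vertex the nodes whose bags contain it form a connected subtree; its width is the maximum bag size minus one.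
   Formalization: The equality O(3^k·k!·g) = O(2^{k log k}·g) is false as written (log base 2: 3^k·k!/k^k ~ (3/e)^k·√(2πk) is unbounded); instead, the running time of one algorithm is shown to satisfy both upper bounds separately. *)

(* Defs.v *)
From Stdlib Require Import Reals List.
From mathcomp Require Import all_boot.

Set Implicit Arguments.
Unset Strict Implicit.
Unset Printing Implicit Defensive.

(* MathComp already uses the key %R for ring_scope. *)
Delimit Scope R_scope with Re.

Section Programs.

Variable A : finType.

(* A rule is the triple (H_r, B^+_r, B^-_r). *)
Definition rule : finType := ({set A} * {set A} * {set A})%type.
Definition rhead (r : rule) : {set A} := r.1.1.
Definition rpos (r : rule) : {set A} := r.1.2.
Definition rneg (r : rule) : {set A} := r.2.

Definition program : finType := {set rule}.

Implicit Types (P : program) (r : rule) (I J : {set A}).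

Definition rule_atoms r : {set A} := rhead r :|: rpos r :|: rneg r.
Definition atoms P : {set A} := \bigcup_(r in P) rule_atoms r.

Definition sat_rule I r : bool :=
  ((rhead r :|: rneg r) :&: I != set0) || (rpos r :\: I != set0).
Definition model P I : bool := [forall r in P, sat_rule I r].

Definition reduct P I : program :=
  [set (rhead r, rpos r, set0) | r in P & rneg r :&: I == set0].

(* [minset p I] : I satisfies p and no proper subset of I does. *)
Definition answer_set P I : bool := minset (model (reduct P I)) I.
Definition has_answer_set P : bool := [exists I, answer_set P I].

Definition dep_edge P : rel A :=
  [rel a b | [exists r in P, (a \in rpos r) && (b \in rhead r)]].

(* A directed cycle is a closed walk, as in [path.cycle]: it may visit a vertex
   several times, so that two atoms lie on a common cycle iff they belong to the
   same strongly connected component. *)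
Definition head_cycle_free P : Prop :=
  forall r a b (p : seq A), r \in P -> a \in rhead r -> b \in rhead r -> a != b ->
    cycle (dep_edge P) p -> ~ ((a \in p) && (b \in p)).

Definition atoms_in_heads P : Prop :=
  forall a, a \in atoms P -> exists2 r, r \in P & a \in rhead r.

Definition primal_edge P : rel A :=
  [rel a b | (a != b) &&
    [exists r in P, (a \in rule_atoms r) && (b \in rule_atoms r)]].

End Programs.

Section TreeDecompositions.

Variables (V N : finType).

(* A rooted tree on the node set N is given by its root and its parent map; the
   root is its own parent.  [fconnect par t root] : some iterate of par maps t
   to root. *)
Definition rooted_tree (root : N) (par : N -> N) : Prop :=
  par root = root /\ forall t, fconnect par t root.

Definition tree_edge (par : N -> N) : rel N :=
  [rel s t | (s != t) && ((par s == t) || (par t == s))].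

Definition tree_decomposition (X : {set V}) (E : rel V)
    (root : N) (par : N -> N) (chi : N -> {set V}) : Prop :=
  [/\ rooted_tree root par,
      forall t, chi t \subset X,
      forall v, v \in X -> exists t, v \in chi t,
      forall u v, u \in X -> v \in X -> E u v ->
        exists t, (u \in chi t) && (v \in chi t)
    & forall v s t, v \in chi s -> v \in chi t ->
        connect [rel x y | [&& tree_edge par x y, v \in chi x & v \in chi y]]
          s t].

(* If all bags are empty, this is 0 rather than -1. *)
Definition width (chi : N -> {set V}) : nat := (\max_(t : N) #|chi t|).-1.

End TreeDecompositions.

(* The model of computation is the unit-cost random access machine whose only
   arithmetic operations are addition and truncated subtraction, presented as a
   structured language: a RAM program uses finitely many registers and finitely many
   arrays of unbounded length, all holding natural numbers.  Every operation
   (constant, register access, indirect array access, +, -, assignment, store,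
   test) costs one step. *)
Inductive expr : Type :=
| Const of nat
| Reg of nat
| Get of nat & expr               (* [Get a e] : cell e of array a *)
| Plus of expr & expr
| Minus of expr & expr.

Inductive cmd : Type :=
| Skip
| Assign of nat & expr
| Put of nat & expr & expr        (* [Put a e1 e2] : cell e1 of a := e2 *)
| Seq of cmd & cmd
| If of expr & cmd & cmd          (* nonzero means true *)
| While of expr & cmd.

Record store : Type := Store { reg : nat -> nat; arr : nat -> nat -> nat }.

Definition set_reg (s : store) (x v : nat) : store :=
  Store (fun y => if y == x then v else reg s y) (arr s).

Definition set_arr (s : store) (a i v : nat) : store :=
  Store (reg s)
    (fun b j => if (b == a) && (j == i) then v else arr s b j).

Fixpoint eval (s : store) (e : expr) : nat :=
  match e with
  | Const m => m
  | Reg x => reg s x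
  | Get a e1 => arr s a (eval s e1)
  | Plus e1 e2 => eval s e1 + eval s e2
  | Minus e1 e2 => eval s e1 - eval s e2
  end.

Fixpoint cost (e : expr) : nat :=
  match e with
  | Const _ | Reg _ => 1
  | Get _ e1 => (cost e1).+1
  | Plus e1 e2 | Minus e1 e2 => (cost e1 + cost e2).+1
  end.

(* [exec c s t s'] : started in s, c halts in s' after exactly t steps. *)
Inductive exec : cmd -> store -> nat -> store -> Prop :=
| exec_skip s : exec Skip s 1 s
| exec_assign x e s :
    exec (Assign x e) s (cost e).+1 (set_reg s x (eval s e))
| exec_put a e1 e2 s :
    exec (Put a e1 e2) s (cost e1 + cost e2).+1
      (set_arr s a (eval s e1) (eval s e2))
| exec_seq c1 c2 s s1 s2 t1 t2 :
    exec c1 s t1 s1 -> exec c2 s1 t2 s2 -> exec (Seq c1 c2) s (t1 + t2) s2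
| exec_if_true e c1 c2 s s1 t :
    eval s e != 0 -> exec c1 s t s1 -> exec (If e c1 c2) s (cost e + t).+1 s1
| exec_if_false e c1 c2 s s1 t :
    eval s e == 0 -> exec c2 s t s1 -> exec (If e c1 c2) s (cost e + t).+1 s1
| exec_while_false e c s :
    eval s e == 0 -> exec (While e c) s (cost e).+1 s
| exec_while_true e c s s1 s2 t1 t2 :
    eval s e != 0 -> exec c s t1 s1 -> exec (While e c) s1 t2 s2 ->
    exec (While e c) s (cost e + t1 + t2).+1 s2.

Lemma exec_det c s t1 s1 t2 s2 :
  exec c s t1 s1 -> exec c s t2 s2 -> t1 = t2 /\ s1 = s2.
Proof.
move=> E; elim: E t2 s2 => {c s t1 s1}
  [s|x e s|a e1 e2 s|c1 c2 s s1 s2 t1 t2 _ IH1 _ IH2|e c1 c2 s s1 t He _ IH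
  |e c1 c2 s s1 t He _ IH|e c s He|e c s s1 s2 t1 t2 He _ IH1 _ IH2] t' s' E';
  inversion E'; subst => //;
  repeat match goal with
  | IH : forall _ _, exec ?c ?s _ _ -> _, H : exec ?c ?s _ _ |- _ =>
      case: (IH _ _ H) => ? ?; subst; clear IH
  | H1 : is_true (?x != 0), H2 : is_true (?x == 0) |- _ => by rewrite H2 in H1
  end; done.
Qed.

(* The input word is in array 0, everything else is 0; the answer is returned
   in register 0. *)
Definition init_store (w : seq nat) : store :=
  Store (fun _ => 0) (fun a i => if a == 0 then nth 0 w i else 0).
Definition output (s : store) : nat := reg s 0.

(* Input format.  A finite set is written as its cardinality followed by its
   elements, in an arbitrary order and without repetitions.  The codes are
   relations because no order of enumeration is prescribed. *)
Definition set_code n (X : {set 'I_n}) (w : seq nat) : Prop :=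
  exists2 s : seq 'I_n, perm_eq s (enum X) & w = size s :: map val s.

Definition rule_code n (r : rule 'I_n) (w : seq nat) : Prop :=
  exists wh wp wn, [/\ set_code (rhead r) wh, set_code (rpos r) wp,
    set_code (rneg r) wn & w = wh ++ wp ++ wn].

Definition program_code n (P : program 'I_n) (w : seq nat) : Prop :=
  exists (rs : seq (rule 'I_n)) (ws : seq (seq nat)),
    [/\ perm_eq rs (enum P), List.Forall2 (@rule_code n) rs ws
      & w = size rs :: flatten ws].

(* Number of nodes, root, parents of the nodes 0, ..., g - 1, and their bags. *)
Definition decomposition_code n g (root : 'I_g) (par : 'I_g -> 'I_g)
    (chi : 'I_g -> {set 'I_n}) (w : seq nat) : Prop :=
  exists2 ws : seq (seq nat),
    List.Forall2 (@set_code n) [seq chi t | t <- enum 'I_g] ws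
  & w = [:: g, val root & [seq val (par t) | t <- enum 'I_g] ++ flatten ws].

Definition instance_code n g (P : program 'I_n) (root : 'I_g)
    (par : 'I_g -> 'I_g) (chi : 'I_g -> {set 'I_n}) (w : seq nat) : Prop :=
  exists wP wT, [/\ program_code P wP, decomposition_code root par chi wT
    & w = wP ++ wT].

Definition log2 (x : R) : R := (ln x / ln 2)%Re.

(* Main.v *)
(* A head-cycle-free program has an answer set iff it has a founded order: a duplicate-free list s
   of atoms such that s satisfies all rules and every x in s is the only true head atom of some
   rule whose negative body is false and whose positive body precedes x in s.

   Put K = k + 1 and colour the atoms with K colours so that each bag is rainbow.  The nodes are
   numbered in breadth-first order, and each rule is attached to a single bag containing its atoms.
   A state of a bag is the order induced by s on the colours of its true atoms, together with the
   set of those atoms that are justified so far; there are at most 2 * 2^K * K! states, the same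
   for every bag.  They are the nodes of a trie, which also stores the effect of deleting a
   colour or of clearing its justified bit.  By amalgamation of linear orders along the tree, a
   founded order exists iff the bags have states that are locally valid, pairwise compatible along
   the edges, and such that each true atom is justified in some bag.

   The tables of admissible states are joined bottom-up.  Combining the justified sets of a child
   and its parent is a union product, computed by zeta and Moebius transforms within
   O(K * 2^K * K!) steps instead of 3^K * K!.  This polynomial overhead is absorbed both by
   3^k * k! and by k^k = 2^(k log k), since (1 + 1/k)^k > 2 eventually.  There are at most
   g * 8^K rules; each is tested on the 4^K labellings of the colours, written in base 4, at a cost
   64^K * g that is also negligible. *)

Require Import Defs.
From Stdlib Require Import Reals List.
From Stdlib Require Import FunctionalExtensionality Lra.
From mathcomp Require Import all_boot.
From mathcomp Require Import zify.

Set Implicit Arguments.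
Unset Strict Implicit.
Unset Printing Implicit Defensive.

(** * Program logic *)

(** The shift from [k] to bags of [K = k + 1] atoms shapes the algorithm. Running, for each order,
    through all pairs of justified sets would cost 3^K K!, which exceeds 3^k k! by the unbounded
    factor 3 (k + 1). Moreover k! is about (k/e)^k and 3 > e, so not even 3^k k! is O(k^k). With
    base 2 there is exponential room on both sides, because 2 < e < 3, and polynomial factors do no
    harm.

    Neither the length of the input nor the number of atoms may enter the bound. The rules form a
    set and each one fits into a bag, so counting triples of subsets of bags bounds their number.
    Arrays indexed by atoms rely on being zero initially and are never scanned.

    The union product counts pairs of justified sets instead of merely detecting them, since only
    counts can be inverted. The zeta transforms are at most 2^K, so that a multiplication table
    suffices, and each Moebius pass undoes exactly one zeta pass, so that truncated subtraction
    loses nothing. *)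

Fixpoint csize (c : cmd) : nat :=
  match c with
  | Skip => 1
  | Assign _ e => (cost e).+1
  | Put _ e1 e2 => (cost e1 + cost e2).+1
  | Seq c1 c2 => csize c1 + csize c2
  | If e c1 c2 => (cost e + csize c1 + csize c2).+1
  | While e c => (cost e + csize c).+1
  end.

(* The budget b only counts loop iterations: the time per iteration is bounded by the size of c. *)
Definition wp (c : cmd) (b : nat) (s : store) (Q : store -> Prop) : Prop :=
  exists t i s', [/\ exec c s t s', t <= csize c * i.+1, i <= b & Q s'].

Fixpoint wregs (c : cmd) : seq nat :=
  match c with
  | Assign x _ => [:: x]
  | Seq c1 c2 | If _ c1 c2 => wregs c1 ++ wregs c2
  | While _ c => wregs c
  | _ => [::]
  end.

Fixpoint warrs (c : cmd) : seq nat :=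
  match c with
  | Put a _ _ => [:: a]
  | Seq c1 c2 | If _ c1 c2 => warrs c1 ++ warrs c2
  | While _ c => warrs c
  | _ => [::]
  end.

(** The write sets are computed from the syntax, so whether a cell is untouched is decided by
    reduction: [fr] and [frs] merely supply [isT]. *)
Definition frame (c : cmd) (s s' : store) : Prop :=
  (forall x, x \notin wregs c -> reg s' x = reg s x) /\
  (forall a, a \notin warrs c -> arr s' a = arr s a).

Lemma frame_trans c s1 s2 s3 : frame c s1 s2 -> frame c s2 s3 -> frame c s1 s3.
Proof. by move=> [r1 a1] [r2 a2]; split=> x hx; rewrite ?r2 ?r1 ?a2 ?a1. Qed.

Lemma frame_sub c c' s s' :
  {subset wregs c <= wregs c'} -> {subset warrs c <= warrs c'} ->
  frame c s s' -> frame c' s s'.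
Proof.
by move=> hr ha [fr fa]; split=> x hx; [apply: fr|apply: fa]; apply: contra hx; auto.
Qed.

Lemma exec_frame c s t s' : exec c s t s' -> frame c s s'.
Proof.
elim=> {c s t s'} //.
- by move=> x e s; split=> // y; rewrite inE /= => /negPf->.
- move=> a e1 e2 s; split=> // b; rewrite inE /= => /negPf hb.
  by apply: functional_extensionality => j; rewrite hb.
- move=> c1 c2 s s1 s2 _ _ _ [r1 a1] _ [r2 a2].
  by split=> x; rewrite mem_cat negb_or => /andP[h1 h2]; rewrite ?r2 ?r1 ?a2 ?a1.
- move=> e c1 c2 s s1 _ _ _ [r1 a1].
  by split=> x; rewrite mem_cat negb_or => /andP[h1 h2]; rewrite ?r1 ?a1.
- move=> e c1 c2 s s1 _ _ _ [r1 a1].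
  by split=> x; rewrite mem_cat negb_or => /andP[h1 h2]; rewrite ?r1 ?a1.
- by move=> e c s s1 s2 _ _ _ _ [r1 a1] _ [r2 a2]; split=> x h; rewrite ?r2 ?r1 ?a2 ?a1.
Qed.

Lemma wp_frame c b s Q : wp c b s Q -> wp c b s (fun s' => frame c s s' /\ Q s').
Proof.
by move=> [t [i [s' [e ht hi hQ]]]]; exists t, i, s'; split=> //; split=> //; apply: exec_frame e.
Qed.

Lemma wp_conseq c b1 b s (Q1 Q : store -> Prop) :
  wp c b1 s Q1 -> b1 <= b -> (forall s', frame c s s' -> Q1 s' -> Q s') -> wp c b s Q.
Proof.
move=> /wp_frame[t [i [s' [e ht hi [hF hQ]]]]] hb h; exists t, i, s'.
by split; [| | exact: leq_trans hi hb | exact: h].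
Qed.

Lemma wp_skip b s (Q : store -> Prop) : Q s -> wp Skip b s Q.
Proof. by exists 1, 0, s; split=> //; constructor. Qed.

Lemma wp_assign x e b s (Q : store -> Prop) :
  Q (set_reg s x (eval s e)) -> wp (Assign x e) b s Q.
Proof. by move=> h; do 3!eexists; split; [constructor| |exact: leq0n|exact: h]; rewrite /= muln1. Qed.

Lemma wp_put a e1 e2 b s (Q : store -> Prop) :
  Q (set_arr s a (eval s e1) (eval s e2)) -> wp (Put a e1 e2) b s Q.
Proof. by move=> h; do 3!eexists; split; [constructor| |exact: leq0n|exact: h]; rewrite /= muln1. Qed.

Lemma wp_seq b1 b2 c1 c2 b s (Q : store -> Prop) :
  b1 + b2 <= b ->
  wp c1 b1 s (fun s' => frame c1 s s' -> wp c2 b2 s' Q) -> wp (Seq c1 c2) b s Q.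
Proof.
move=> hb /wp_frame [t1 [i1 [s1 [e1 ht1 hi1 [hF h]]]]].
have [t2 [i2 [s2 [e2 ht2 hi2 hQ]]]] := h hF.
exists (t1 + t2), (i1 + i2), s2; split=> //; [exact: exec_seq e1 e2| | ]; last by lia.
rewrite /=; nia.
Qed.

Lemma wp_seq0 c1 c2 b s (Q : store -> Prop) :
  wp c1 0 s (fun s' => wp c2 b s' Q) -> wp (Seq c1 c2) b s Q.
Proof.
move=> h; apply: (@wp_seq 0 b); first by [].
by apply: wp_conseq h _ _ => // s' _ h _.
Qed.

Lemma wp_if e c1 c2 b s (Q : store -> Prop) :
  (eval s e != 0 -> wp c1 b s Q) -> (eval s e = 0 -> wp c2 b s Q) -> wp (If e c1 c2) b s Q.
Proof.
move=> h1 h2; case: (eqVneq (eval s e) 0) => [he|he].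
  have [t [i [s' [ex ht hi hQ]]]] := h2 he.
  exists (cost e + t).+1, i, s'; split=> //=; first by apply: exec_if_false => //; rewrite he.
  nia.
have [t [i [s' [ex ht hi hQ]]]] := h1 he.
exists (cost e + t).+1, i, s'; split=> //=; first by apply: exec_if_true.
nia.
Qed.

(** [k] is a variant. Each iteration pays its inner budget [b] plus one for itself, and [csize] of
    the loop covers both test and body. Both premises supply a frame from the initial store, so an
    invariant need only mention what the loop writes. *)
Lemma wp_while (Inv : nat -> store -> Prop) b k e c s (Q : store -> Prop) B :
  Inv k s ->
  (forall k s1, frame c s s1 -> Inv k s1 -> eval s1 e != 0 ->
     wp c b s1 (fun s2 => exists2 k', k' < k & Inv k' s2)) ->
  (forall k s1, frame c s s1 -> Inv k s1 -> eval s1 e = 0 -> Q s1) ->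
  k * b.+1 <= B ->
  wp (While e c) B s Q.
Proof.
move=> hI hb hQ hB; apply: (@wp_conseq _ (k * b.+1) _ _ Q) => // {B hB}.
suff gen k1 s1 : Inv k1 s1 -> frame c s s1 -> wp (While e c) (k1 * b.+1) s1 Q by exact: gen.
elim/ltn_ind: k1 s1 => {hI}k IH s1 hI hF.
case: (eqVneq (eval s1 e) 0) => [he|he].
  exists (cost e).+1, 0, s1; split=> //=; last exact: hQ hF hI he.
    by apply: exec_while_false; rewrite he.
  by lia.
have /wp_frame [t1 [i1 [s2 [e1 ht1 hi1 [hF2 [k' hk hI2]]]]]] := hb _ _ hF hI he.
have [t2 [i2 [s3 [e2 ht2 hi2 hQ3]]]] := IH _ hk _ hI2 (frame_trans hF hF2).
exists (cost e + t1 + t2).+1, (i1 + i2).+1, s3; split=> //.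
- exact: exec_while_true e1 e2.
- by move: ht1 ht2 => /=; nia.
- have : k' * b.+1 + b.+1 <= k * b.+1 by rewrite -mulSnr leq_mul2r hk orbT.
  by move: hi1 hi2; lia.
Qed.

Definition For (x N : nat) (body : cmd) : cmd :=
  Seq (Assign x (Const 0))
      (While (Minus (Reg N) (Reg x)) (Seq body (Assign x (Plus (Reg x) (Const 1))))).

(** The body is checked against [Inv j.+1] in a store whose counter is already advanced, because the
    increment follows the body. *)
Lemma wp_for (Inv : nat -> store -> Prop) b n x N body s (Q : store -> Prop) B :
  x \notin wregs body -> N \notin x :: wregs body ->
  reg s N = n ->
  Inv 0 (set_reg s x 0) ->
  (forall j s1, frame (For x N body) s s1 -> j < n -> reg s1 x = j -> Inv j s1 ->
     wp body b s1 (fun s2 => Inv j.+1 (set_reg s2 x j.+1))) ->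
  (forall s1, frame (For x N body) s s1 -> reg s1 x = n -> Inv n s1 -> Q s1) ->
  n * b.+1 <= B ->
  wp (For x N body) B s Q.
Proof.
move=> hx; rewrite inE negb_or => /andP[hNx hN] hn hI0 hb hQ hB.
apply: wp_seq0; apply: wp_assign => /=.
have F0 : frame (For x N body) s (set_reg s x 0).
  by split=> // y /=; rewrite inE negb_or => /andP[/negPf-> _].
have Fb s1 s2 : frame (Seq body (Assign x (Plus (Reg x) (Const 1)))) s1 s2 -> frame (For x N body) s1 s2.
  by apply: frame_sub => // y; rewrite /= ?inE => h; rewrite h orbT.
pose J k s1 := [/\ reg s1 x <= n, k = n - reg s1 x & Inv (reg s1 x) s1].
apply: (@wp_while J b n) => //.
- by split=> //=; rewrite ?eqxx ?subn0.
- move=> k s1 F [le1 hk hI] /= hne.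
  have FF := frame_trans F0 (Fb _ _ F).
  have hNn : reg s1 N = n.
    by rewrite (proj1 F) /= ?mem_cat ?negb_or ?hN ?inE ?hNx // (negPf hNx).
  have lt1 : reg s1 x < n by rewrite hNn -lt0n subn_gt0 in hne.
  apply: (@wp_seq b 0); first by rewrite addn0.
  apply: wp_conseq (hb _ _ FF lt1 erefl hI) _ _ => // s2 F2 I2 _.
  apply: wp_assign => /=; exists (n - (reg s1 x).+1); first by rewrite hk; lia.
  have -> : reg s2 x = reg s1 x by rewrite (proj1 F2).
  by split=> /=; rewrite eqxx addn1.
- move=> k s1 F [le1 hk hI] /= h0.
  have FF := frame_trans F0 (Fb _ _ F).
  have hNn : reg s1 N = n.
    by rewrite (proj1 F) /= ?mem_cat ?negb_or ?hN ?inE ?hNx // (negPf hNx).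
  have hxn : reg s1 x = n by apply/eqP; rewrite eqn_leq le1 /= -subn_eq0 -hNn h0.
  by apply: hQ => //; rewrite -hxn.
Qed.

(** * The program *)

Declare Scope ram_scope.
Delimit Scope ram_scope with ram.
Bind Scope ram_scope with expr.
Bind Scope ram_scope with cmd.
Notation "$ x" := (Reg x%N) (at level 1, x at level 0, format "$ x") : ram_scope.
Notation "# x" := (Const x%N) (at level 1, x at level 0, format "# x") : ram_scope.
Notation "a .[ e ]" := (Get a%N e) (at level 1, left associativity) : ram_scope.
Notation "e1 + e2" := (Plus e1 e2) : ram_scope.
Notation "e1 - e2" := (Minus e1 e2) : ram_scope.
Notation "x <~ e" := (Assign x%N e) (at level 90, no associativity) : ram_scope.
Notation "a ^^ i <~ e" := (Put a%N i e) (at level 90, i at level 89, no associativity) : ram_scope.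
Notation "c1 ;; c2" := (Seq c1 c2) (at level 92, right associativity) : ram_scope.

Notation rOut := 0. Notation rNr := 1. Notation rPtr := 2. Notation rPb := 3. Notation rG := 4.
Notation rRoot := 5. Notation rK := 6. Notation rG1 := 7. Notation rTail := 8. Notation rM := 9.
Notation rQ := 10. Notation rW1 := 11. Notation rG2 := 12.
Notation rI := 13. Notation rJ := 14. Notation rC := 15. Notation rV := 16. Notation rT := 17.
Notation rA := 18. Notation rB := 19. Notation rX := 20. Notation rY := 21. Notation rZ := 22.
Notation rU := 23. Notation rP := 24. Notation rN := 25. Notation rOk := 26. Notation rE := 27.
Notation rD := 28. Notation rF := 29. Notation rBad := 30. Notation rL := 31.
Notation aIn := 0. Notation aBst := 1. Notation aFc := 2. Notation aNx := 3. Notation aOrd := 4.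
Notation aPi := 5. Notation aCol := 6. Notation aIntro := 7. Notation aColat := 8. Notation aRk := 9.
Notation aP4 := 10. Notation aPar := 11. Notation aVc := 12. Notation aVb := 13. Notation aStat := 14.
Notation aCh := 15. Notation aDel := 16. Notation aFlip := 17. Notation aKey := 18. Notation aRow := 19.
Notation aProd := 20. Notation aHd := 21. Notation aPs := 22. Notation aNg := 23. Notation aTb := 24.
Notation aFb := 25. Notation aFire := 26. Notation aT := 27. Notation aS := 28. Notation aSh := 29.
Notation aRv := 30.

(* Node 0 is an additional root with an empty bag; the root of the tree decomposition is node 1.
   aOrd i, aPi i: the tree node numbered i, and the number of its parent.
   aCol a: the colour of atom a plus one; aIntro a: the first bag containing a.
   aColat (i K + c): the atom with colour c in bag i plus one, 0 if there is none.
   aStat (j K + c): 0, 1, 2 if colour c is false, unjustified, justified in state j.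
   aPar, aVc, aVb: the parent of a state in the trie, and its last entry; aCh: the children.
   aDel, aFlip (j K + c): the state j without colour c, or with c unjustified.
   aFire (i 4^K + key): does a rule of bag i fire under the labelling key?
   aT (i M + j): is state j in the table of bag i?
   aRk, aTb, aFb, aRv, aRow hold row offsets and aProd a multiplication table, as the machine
   does not multiply. *)

Local Open Scope ram_scope.

(** The rules come first in the input but can be interpreted only when colours and first bags are
    known; this pass just finds where the tree begins. *)
Definition skip_rules : cmd :=
  rNr <~ aIn.[#0] ;; rPtr <~ #1 ;;
  For rI rNr
    (rPtr <~ $rPtr + aIn.[$rPtr] + #1 ;;
     rPtr <~ $rPtr + aIn.[$rPtr] + #1 ;;
     rPtr <~ $rPtr + aIn.[$rPtr] + #1).

Definition read_tree : cmd :=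
  rG <~ aIn.[$rPtr] ;; rRoot <~ aIn.[$rPtr + #1] ;; rPb <~ $rPtr + #2 ;;
  rPtr <~ $rPb + $rG ;; rK <~ #0 ;; rG1 <~ $rG + #1 ;; rG2 <~ $rG + #2 ;;
  For rI rG
    (aBst ^^ $rI <~ $rPtr ;;
     rC <~ aIn.[$rPtr] ;;
     If ($rC - $rK) (rK <~ $rC) Skip ;;
     rPtr <~ $rPtr + $rC + #1).

(** The machine has no equality test: the sum of the two truncated differences is nonzero iff the
    values differ. *)
Definition children : cmd :=
  For rI rG
    (If (($rI - $rRoot) + ($rRoot - $rI))
       (rA <~ aIn.[$rPb + $rI] ;;
        aNx ^^ $rI <~ aFc.[$rA] ;;
        aFc ^^ $rA <~ $rI + #1)
       Skip).

(** [aOrd] doubles as the queue, with head [rI] and end [rTail]; [rC] is the unread rest of the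
    child list of the head. The entry of [aPi] at 1 keeps its initial value 0, which is the extra
    root. *)
Definition bfs : cmd :=
  aOrd ^^ #1 <~ $rRoot ;; rTail <~ #2 ;; rI <~ #1 ;; rC <~ aFc.[$rRoot] ;;
  While ($rTail - $rI)
    (If $rC
       (aOrd ^^ $rTail <~ $rC - #1 ;; aPi ^^ $rTail <~ $rI ;;
        rTail <~ $rTail + #1 ;; rC <~ aNx.[$rC - #1])
       (rI <~ $rI + #1 ;; rC <~ aFc.[aOrd.[$rI]])).

Definition node_rows : cmd :=
  rX <~ #0 ;; For rI rG2 (aRk ^^ $rI <~ $rX ;; rX <~ $rX + $rK).

Definition old_colours : cmd :=
  For rJ rN
    (rA <~ aIn.[$rB + $rJ] ;;
     If aCol.[$rA] (aColat ^^ (($rX + aCol.[$rA]) - #1) <~ $rA + #1) Skip).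

Definition free_colour : cmd :=
  rC <~ #0 ;; While aColat.[$rX + $rC] (rC <~ $rC + #1).

Definition new_colours : cmd :=
  For rJ rN
    (rA <~ aIn.[$rB + $rJ] ;;
     If aCol.[$rA] Skip
       (free_colour ;;
        aColat ^^ ($rX + $rC) <~ $rA + #1 ;;
        aCol ^^ $rA <~ $rC + #1 ;;
        aIntro ^^ $rA <~ $rI)).

Definition colouring : cmd :=
  For rY rG
    (rI <~ $rY + #1 ;;
     rB <~ aBst.[aOrd.[$rI]] ;; rN <~ aIn.[$rB] ;; rB <~ $rB + #1 ;; rX <~ aRk.[$rI] ;;
     old_colours ;; new_colours).

Definition powers : cmd :=
  rP <~ #1 ;;
  For rC rK (aP4 ^^ $rC <~ $rP ;; rP <~ ($rP + $rP) + ($rP + $rP)) ;;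
  rQ <~ $rP ;;
  rW1 <~ #1 ;;
  For rC rK (rW1 <~ $rW1 + $rW1) ;;
  rW1 <~ $rW1 + #1.

(** The side [rW1] is 2^K + 1 because the factors are zeta transforms of 0/1 tables, with values
    from 0 to 2^K ([zeta_bound]). *)
Definition products : cmd :=
  rX <~ #0 ;;
  For rA rW1
    (aRow ^^ $rA <~ $rX ;; rZ <~ #0 ;;
     For rB rW1 (aProd ^^ $rX <~ $rZ ;; rZ <~ $rZ + $rA ;; rX <~ $rX + #1)).

(* Here rX = rI * K + rC and rL = rTail * K. *)
Definition add_child (b : nat) : cmd :=
  aPar ^^ $rTail <~ $rI ;; aVc ^^ $rTail <~ $rC ;; aVb ^^ $rTail <~ #b ;;
  aCh ^^ (($rX + $rX) + #b) <~ $rTail ;;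
  aKey ^^ $rTail <~ aKey.[$rI] + (aP4.[$rC] + aP4.[$rC]) ;;
  aRv ^^ $rTail <~ $rL ;;
  For rE rK (aStat ^^ ($rL + $rE) <~ aStat.[$rY + $rE]) ;;
  aStat ^^ ($rL + $rC) <~ #b + #1 ;;
  rL <~ $rL + $rK ;;
  rTail <~ $rTail + #1.

Definition trie : cmd :=
  rTail <~ #1 ;; rI <~ #0 ;; rL <~ $rK ;;
  While ($rTail - $rI)
    (rY <~ aRv.[$rI] ;;
     For rC rK
       (rX <~ $rY + $rC ;;
        If aStat.[$rX] Skip (add_child 0 ;; add_child 1)) ;;
     rI <~ $rI + #1) ;;
  rM <~ $rTail.

(** A parent in the trie has a smaller number, so its entries are known. Deleting or clearing a
    colour other than the last one is done in the parent, and the last entry is then appended again.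
    For the last colour, deletion gives the parent itself and clearing gives its child with bit 0.
    The root keeps the initial value 0, its own number. *)
Definition trie_maps : cmd :=
  For rI rM
    (If $rI
      (rU <~ aPar.[$rI] ;; rY <~ aVc.[$rI] ;; rB <~ aVb.[$rI] ;;
       For rC rK
         (rX <~ aRv.[$rI] + $rC ;; rZ <~ aRv.[$rU] + $rC ;;
          If (($rC - $rY) + ($rY - $rC))
            (rD <~ aRv.[aDel.[$rZ]] + $rY ;; aDel ^^ $rX <~ aCh.[($rD + $rD) + $rB] ;;
             rD <~ aRv.[aFlip.[$rZ]] + $rY ;; aFlip ^^ $rX <~ aCh.[($rD + $rD) + $rB])
            (aDel ^^ $rX <~ $rU ;;
             rD <~ aRv.[$rU] + $rY ;; aFlip ^^ $rX <~ aCh.[$rD + $rD])))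
      Skip).

Definition table_rows : cmd :=
  rX <~ #0 ;; rZ <~ #0 ;;
  For rI rG2 (aTb ^^ $rI <~ $rX ;; rX <~ $rX + $rM ;; aFb ^^ $rI <~ $rZ ;; rZ <~ $rZ + $rQ).

Definition clear_rule : cmd :=
  For rC rK (aHd ^^ $rC <~ #0 ;; aPs ^^ $rC <~ #0 ;; aNg ^^ $rC <~ #0).

Definition read_set (a : nat) : cmd :=
  rN <~ aIn.[$rPtr] ;; rPtr <~ $rPtr + #1 ;;
  For rJ rN
    (rA <~ aIn.[$rPtr + $rJ] ;;
     a ^^ (aCol.[$rA] - #1) <~ #1 ;;
     If (aIntro.[$rA] - $rX) (rX <~ aIntro.[$rA]) Skip) ;;
  rPtr <~ $rPtr + $rN.

Definition next_digit : cmd :=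
  If (($rZ + #1) - $rP) (rZ <~ $rZ - $rP ;; rD <~ $rD + #1) Skip.

Definition check_digit : cmd :=
  If aHd.[$rC]
    (If $rD (If ($rD - #2) Skip (rOk <~ #0)) Skip)
    (If ($rD - #2) (rOk <~ #0) Skip) ;;
  If aPs.[$rC] (If (($rD - #2) + (#2 - $rD)) (rOk <~ #0) Skip) Skip ;;
  If aNg.[$rC] (If $rD (rOk <~ #0) Skip) Skip.

Definition check_key : cmd :=
  rZ <~ $rY ;; rOk <~ #1 ;;
  For rE rK
    (rC <~ ($rK - $rE) - #1 ;; rP <~ aP4.[$rC] ;; rD <~ #0 ;;
     next_digit ;; next_digit ;; next_digit ;; check_digit).

Definition rules : cmd :=
  rPtr <~ #1 ;;
  For rI rNr
    (clear_rule ;; rX <~ #0 ;;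
     read_set aHd ;; read_set aPs ;; read_set aNg ;;
     rF <~ aFb.[$rX] ;;
     For rY rQ (check_key ;; If $rOk (aFire ^^ ($rF + $rY) <~ #1) Skip)).

(** The walk to the root of the trie peels off the latest atom first: [aKey] of the parent provides
    the digits 2 of the earlier atoms, while [rA] collects the digits 1 of the later ones. *)
Definition init_state : cmd :=
  rOk <~ #1 ;;
  If aFire.[$rF + aKey.[$rV]] (rOk <~ #0) Skip ;;
  rA <~ #0 ;; rX <~ $rV ;;
  While $rX
    (rC <~ aVc.[$rX] ;; rU <~ aPar.[$rX] ;; rP <~ aP4.[$rC] ;;
     If aColat.[$rB + $rC] Skip (rOk <~ #0) ;;
     If aVb.[$rX]
       (If aFire.[$rF + (aKey.[$rU] + ($rP + ($rP + ($rP + $rA))))] Skip (rOk <~ #0)) Skip ;;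
     rA <~ $rA + $rP ;; rX <~ $rU).

Definition init_tables : cmd :=
  For rI rG1
    (rF <~ aFb.[$rI] ;; rB <~ aRk.[$rI] ;; rT <~ aTb.[$rI] ;;
     For rV rM (init_state ;; aT ^^ ($rT + $rV) <~ $rOk)).

Definition shared : cmd :=
  For rC rK
    (rX <~ aColat.[aRk.[$rI] + $rC] ;; rY <~ aColat.[aRk.[$rP] + $rC] ;;
     If (($rX - $rY) + ($rY - $rX)) (aSh ^^ $rC <~ #0) (aSh ^^ $rC <~ #1)).

(** [rBad] is the status refused for unshared colours: 1 in a child, where an atom about to be
    forgotten must be justified, and 2 in the parent, whose unshared atoms can receive no
    justification from the child. *)
Definition project : cmd :=
  rU <~ $rV ;; rOk <~ #1 ;; rX <~ aRv.[$rV] ;;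
  For rC rK
    (If aSh.[$rC] Skip
       (rY <~ aStat.[$rX + $rC] ;;
        If (($rY - $rBad) + ($rBad - $rY)) Skip (rOk <~ #0) ;;
        rU <~ aDel.[aRv.[$rU] + $rC])).

Definition project_child : cmd :=
  For rV rM (aS ^^ $rV <~ #0) ;;
  rBad <~ #1 ;;
  For rV rM (If aT.[$rA + $rV] (project ;; If $rOk (aS ^^ $rU <~ #1) Skip) Skip).

Definition extend_parent : cmd :=
  rBad <~ #2 ;;
  For rV rM
    (project ;; If $rOk (aT ^^ ($rB + $rV) <~ aS.[$rU]) (aT ^^ ($rB + $rV) <~ #0)).

Definition zeta (r : nat) : cmd :=
  For rC rK
    (For rV rM
       (rX <~ aRv.[$rV] + $rC ;;
        If (aStat.[$rX] - #1)
          (aT ^^ ($r + $rV) <~ aT.[$r + $rV] + aT.[$r + aFlip.[$rX]]) Skip)).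

Definition moebius (r : nat) : cmd :=
  For rE rK
    (rC <~ ($rK - $rE) - #1 ;;
     For rV rM
       (rX <~ aRv.[$rV] + $rC ;;
        If (aStat.[$rX] - #1)
          (aT ^^ ($r + $rV) <~ aT.[$r + $rV] - aT.[$r + aFlip.[$rX]]) Skip)).

Definition multiply : cmd :=
  For rV rM (aT ^^ ($rT + $rV) <~ aProd.[aRow.[aT.[$rT + $rV]] + aT.[$rB + $rV]]).

Definition normalise : cmd :=
  For rV rM (If aT.[$rT + $rV] (aT ^^ ($rT + $rV) <~ #1) Skip).

(** Numbers decrease, so a table has absorbed all its children before it is passed on to its parent.
    Row [g + 1] lies behind all tables and is scratch space for the contribution of the child. *)
Definition joins : cmd :=
  rB <~ aTb.[$rG1] ;;
  For rZ rG
    (rI <~ $rG - $rZ ;; rP <~ aPi.[$rI] ;; rA <~ aTb.[$rI] ;; rT <~ aTb.[$rP] ;;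
     shared ;; project_child ;; extend_parent ;;
     zeta rB ;; zeta rT ;; multiply ;; moebius rT ;; normalise).

Definition answer_program : cmd :=
  skip_rules ;; read_tree ;; children ;; bfs ;; node_rows ;; colouring ;;
  powers ;; products ;; trie ;; trie_maps ;; table_rows ;; rules ;;
  init_tables ;; joins ;; rOut <~ aT.[#0].

Local Close Scope ram_scope.

(** * Reading the input *)

Ltac wstep :=
  lazymatch goal with
  | |- wp (Seq ?c _) _ _ _ =>
      lazymatch c with
      | Assign _ _ => apply: wp_seq0
      | Put _ _ _ => apply: wp_seq0
      | Skip => apply: wp_seq0
      end
  | |- wp (Assign _ _) _ _ _ => apply: wp_assign
  | |- wp (Put _ _ _) _ _ _ => apply: wp_put
  | |- wp Skip _ _ _ => apply: wp_skip
  end.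
Ltac wrun := repeat (wstep; rewrite /=).

Ltac fr F := repeat
  match goal with
  | |- context [reg ?s ?k] =>
      lazymatch type of F with frame _ _ s => rewrite (proj1 F k isT) end
  | |- context [arr ?s ?k] =>
      lazymatch type of F with frame _ _ s => rewrite (proj2 F k isT) end
  end.

(* lia does not identify the convertible types nat and Equality.sort nat. *)
Ltac slia :=
  repeat match goal with
  | H : context [@size (Equality.sort ?T) ?s] |- _ =>
      change (@size (Equality.sort T) s) with (@size nat s) in H
  | |- context [@size (Equality.sort ?T) ?s] =>
      change (@size (Equality.sort T) s) with (@size nat s)
  end; lia.

Lemma row_col_inj p i j x y : x < p -> y < p -> i * p + x = j * p + y -> i = j /\ x = y.
Proof.
move=> hx hy e; have hp : 0 < p by apply: leq_ltn_trans hx.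
have ei : i = j.
  by move/(congr1 (divn^~ p)): e; rewrite !divnMDl // !divn_small // !addn0.
by split=> //; move: e; rewrite ei => /addnI.
Qed.

Definition word_at (f : nat -> nat) (p : nat) (u : seq nat) : Prop :=
  forall i, i < size u -> f (p + i) = nth 0 u i.

Lemma word_at_catl f p u v : word_at f p (u ++ v) -> word_at f p u.
Proof. by move=> h i hi; rewrite h ?nth_cat ?hi // size_cat ltn_addr. Qed.

Lemma word_at_catr f p u v : word_at f p (u ++ v) -> word_at f (p + size u) v.
Proof.
move=> h i hi; rewrite -addnA h ?size_cat ?ltn_add2l // nth_cat ltnNge leq_addr /=.
by rewrite addKn.
Qed.

Lemma word_at_head f p x u : word_at f p (x :: u) -> f p = x.
Proof. by move=> h; rewrite -[p]addn0 h. Qed.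

Lemma word_at_tail f p x u : word_at f p (x :: u) -> word_at f p.+1 u.
Proof. by move=> h i hi; rewrite addSnnS h. Qed.

Lemma word_at_flatten f p ws j : word_at f p (flatten ws) ->
  word_at f (p + size (flatten (take j ws))) (nth [::] ws j).
Proof.
move=> h; case: (ltnP j (size ws)) => hj; last by rewrite nth_default.
move: h; rewrite -{1}(cat_take_drop j ws) flatten_cat => /word_at_catr.
by rewrite (drop_nth [::] hj) /= => /word_at_catl.
Qed.

Lemma Forall2_nth (T1 T2 : Type) (R : T1 -> T2 -> Prop) x0 y0 s1 s2 :
  List.Forall2 R s1 s2 ->
  size s1 = size s2 /\ forall j, j < size s1 -> R (nth x0 s1 j) (nth y0 s2 j).
Proof.
elim=> [|x y l l' h _ [hs IH]] //=.
by split; [rewrite hs | case].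
Qed.

Definition scard {n} (X : {set 'I_n}) : nat := #|X|.

Section Parsing.

Variables (n g : nat) (P : program 'I_n) (root : 'I_g) (par : 'I_g -> 'I_g)
  (chi : 'I_g -> {set 'I_n}).

Definition rule0 : rule 'I_n := (set0, set0, set0).

Definition set_at (f : nat -> nat) (p : nat) (X : {set 'I_n}) : Prop :=
  exists s : seq 'I_n, perm_eq s (enum X) /\ word_at f p (size s :: map val s).

Definition rule_at (f : nat -> nat) (p : nat) (r : rule 'I_n) : Prop :=
  [/\ set_at f p (rhead r), set_at f (p + (scard (rhead r)).+1) (rpos r)
    & set_at f (p + (scard (rhead r)).+1 + (scard (rpos r)).+1) (rneg r)].

Definition rule_len (r : rule 'I_n) := (scard (rhead r)).+1 + (scard (rpos r)).+1 + (scard (rneg r)).+1.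

Lemma set_codeE (X : {set 'I_n}) w : set_code X w ->
  size w = (scard X).+1 /\ forall f p, word_at f p w -> set_at f p X.
Proof.
move=> [s hs ->]; split; first by rewrite /= size_map (perm_size hs) /scard cardE.
by move=> f p h; exists s.
Qed.

Lemma set_at_card f p X : set_at f p X -> f p = scard X.
Proof. by move=> [s [hs /word_at_head ->]]; rewrite (perm_size hs) -cardE. Qed.

Lemma rule_codeE r w : rule_code r w ->
  size w = rule_len r /\ forall f p, word_at f p w -> rule_at f p r.
Proof.
move=> [wh [wp [wn [/set_codeE[sh h1] /set_codeE[sp h2] /set_codeE[sn h3] ->]]]].
split; first by rewrite !size_cat sh sp sn addnA.
move=> f p h; split; first exact: h1 (word_at_catl h).
  by apply: h2; move/word_at_catr/word_at_catl: h; rewrite sh.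
by apply: h3; move/word_at_catr/word_at_catr: h; rewrite sh sp.
Qed.

Definition rule_pos (rs : seq (rule 'I_n)) j := (sumn (map rule_len (take j rs))).+1.

Lemma program_codeE w : program_code P w ->
  exists rs, [/\ perm_eq rs (enum P), size w = rule_pos rs (size rs) &
    forall f, word_at f 0 w -> f 0 = size rs /\
      forall j r0, j < size rs -> rule_at f (rule_pos rs j) (nth r0 rs j)].
Proof.
move=> [rs [ws [hp hF ->]]]; exists rs.
have hs := proj1 (Forall2_nth rule0 [::] hF).
have hpos j : j <= size rs -> size (flatten (take j ws)) = sumn (map rule_len (take j rs)).
  elim: hF j {hs hp} => [|r u l l' hr _ IH] //= [|j] //= /IH <-.
  by rewrite size_cat (proj1 (rule_codeE hr)).
split=> //.
  by rewrite /rule_pos /= -hpos // hs take_size.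
move=> f hf; split; first exact: word_at_head hf.
move=> j r0 hj.
have hr := proj2 (Forall2_nth r0 [::] hF) j hj.
apply: (proj2 (rule_codeE hr)); rewrite /rule_pos -hpos 1?ltnW //.
by have := @word_at_flatten _ _ _ j (word_at_tail hf); rewrite add1n.
Qed.

Definition bag_len (t : 'I_g) := (scard (chi t)).+1.
Definition bag_pos (b j : nat) := b + sumn (map bag_len (take j (enum 'I_g))).

Lemma decomposition_codeE w : decomposition_code root par chi w ->
  forall f p, word_at f p w ->
  [/\ f p = g, f p.+1 = root,
      forall t : 'I_g, f (p + 2 + t) = par t &
      forall t : 'I_g, set_at f (bag_pos (p + 2 + g) t) (chi t)].
Proof.
move=> [ws hF ->] f p h.
have [hs hn] := Forall2_nth set0 [::] hF; rewrite size_map size_enum_ord in hs hn.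
have hpos j : size (flatten (take j ws)) = sumn (map bag_len (take j (enum 'I_g))).
  elim: (enum 'I_g) ws hF j {hs hn h} => [|t l IH] ws hF; inversion hF; subst=> //= -[|j] //=.
  by rewrite size_cat (proj1 (set_codeE H1)) (IH _ H3).
have h2 : word_at f (p + 2) ([seq val (par t) | t <- enum 'I_g] ++ flatten ws).
  by move/word_at_tail/word_at_tail: h; rewrite addnC.
split.
- exact: word_at_head h.
- exact: word_at_head (word_at_tail h).
- move=> t; move/word_at_catl: h2 => ->; last by rewrite size_map size_enum_ord.
  by rewrite (nth_map t) ?size_enum_ord // nth_ord_enum.
- move=> t; move/word_at_catr: h2; rewrite size_map size_enum_ord => /(@word_at_flatten _ _ _ t).
  rewrite hpos => h3.
  have:= hn t (ltn_ord t); rewrite (nth_map t) ?size_enum_ord // nth_ord_enum => /set_codeE[_].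
  exact.
Qed.

Lemma skip_rules_spec s (rs : seq (rule 'I_n)) :
  arr s aIn 0 = size rs ->
  (forall j r0, j < size rs -> rule_at (arr s aIn) (rule_pos rs j) (nth r0 rs j)) ->
  wp skip_rules (size rs) s (fun s' => reg s' rNr = size rs /\ reg s' rPtr = rule_pos rs (size rs)).
Proof.
move=> h0 hr; rewrite /skip_rules; wrun.
apply: (@wp_for (fun j s1 => reg s1 rPtr = rule_pos rs j) 0 (size rs)) => //=.
- by rewrite /rule_pos take0.
- move=> j s1 F hj hJ hptr; wrun; fr F; rewrite /= hptr.
  have [ha hb hc] := hr j rule0 hj.
  have e a b : a + b + 1 = a + b.+1 by rewrite addn1 addnS.
  rewrite (set_at_card ha) !e (set_at_card hb) (set_at_card hc).
  rewrite /rule_pos (take_nth rule0 hj) map_rcons sumn_rcons /rule_len; lia.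
- by move=> s1 F _ ->; fr F; rewrite /= h0.
- by rewrite muln1.
Qed.

Lemma read_tree_spec s p :
  reg s rPtr = p ->
  arr s aIn p = g -> arr s aIn p.+1 = root ->
  (forall t : 'I_g, set_at (arr s aIn) (bag_pos (p + 2 + g) t) (chi t)) ->
  wp read_tree g s (fun s' =>
    [/\ [/\ reg s' rG = g, reg s' rG1 = g + 1 & reg s' rG2 = g + 2], reg s' rRoot = root, reg s' rPb = p + 2,
      reg s' rK = \max_(t : 'I_g) scard (chi t)
    & forall t : 'I_g, arr s' aBst t = bag_pos (p + 2 + g) t]).
Proof.
move=> hp hg hroot hb; rewrite /read_tree; wrun.
apply: (@wp_for (fun j s1 => [/\ reg s1 rPtr = bag_pos (p + 2 + g) j,
   reg s1 rK = \max_(t : 'I_g | t < j) scard (chi t) &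
   forall t : 'I_g, t < j -> arr s1 aBst t = bag_pos (p + 2 + g) t]) 0 g) => //=.
- by rewrite hp hg.
- rewrite big_pred0 // hp hg; split=> //.
  by rewrite /bag_pos take0 /= addn0.
- move=> j s1 F hj hJ [hptr hK hB].
  have hset := hb (Ordinal hj); rewrite /= in hset.
  have hmax : \max_(t : 'I_g | t < j.+1) scard (chi t) = maxn (scard (chi (Ordinal hj))) (reg s1 rK).
    rewrite hK (bigD1 (Ordinal hj)) //=; congr maxn; apply: eq_bigl => t.
    by rewrite ltnS ltn_neqAle andbC.
  have hpos : bag_pos (p + 2 + g) j.+1 = bag_pos (p + 2 + g) j + (scard (chi (Ordinal hj))).+1.
    rewrite /bag_pos (take_nth (Ordinal hj)) ?size_enum_ord // map_rcons sumn_rcons.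
    by rewrite (nth_ord_enum _ (Ordinal hj)) addnA.
  have hc : arr s1 aIn (reg s1 rPtr) = scard (chi (Ordinal hj)) by fr F; rewrite hptr (set_at_card hset).
  wrun; apply: wp_seq0; rewrite hc hJ; apply: wp_if => /= hif; wrun; (split;
    [ by rewrite hptr hpos; lia
    | rewrite hmax; lia
    | move=> t; rewrite ltnS leq_eqVlt => /orP[/eqP->|lt]; rewrite ?eqxx ?(ltn_eqF lt) //; exact: hB]).
- move=> s1 F _ [h1 h2 h3]; fr F; rewrite /= hp hg (addn1 p) hroot; split=> //.
  + by rewrite h2; apply: eq_bigl => t; rewrite ltn_ord.
  + by move=> t; apply: h3.
- by rewrite muln1.
Qed.

End Parsing.

(** * Numbering the nodes *)

(* The linked list starting at the cell value c, where values are shifted by one and 0 ends the list. *)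
Fixpoint chain (nx : nat -> nat) (c : nat) (l : seq nat) : Prop :=
  if l is x :: l' then c = x.+1 /\ chain nx (nx x) l' else c = 0.

Lemma eq_chain nx nx' c l : {in l, nx =1 nx'} -> chain nx c l -> chain nx' c l.
Proof.
elim: l c => [|x l IH] c //= h [-> hc]; split=> //.
by rewrite -h ?mem_head //; apply: IH => // y hy; apply: h; rewrite inE hy orbT.
Qed.

Section Order.

Variables (g root : nat) (pf : nat -> nat).
Hypothesis (hroot : root < g) (hpf : forall t, t < g -> pf t < g).

Definition child_lists (nx fc : nat -> nat) (j : nat) : Prop :=
  forall u, exists l, [/\ chain nx (fc u) l, uniq l &
    forall t, (t \in l) = [&& t < j, t != root & pf t == u]].

Lemma children_spec s pb :
  reg s rG = g -> reg s rRoot = root -> reg s rPb = pb ->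
  (forall t, t < g -> arr s aIn (pb + t) = pf t) ->
  arr s aFc = (fun _ => 0) ->
  wp children g s (fun s' => child_lists (arr s' aNx) (arr s' aFc) g).
Proof.
move=> hg hr hpb hin hfc; rewrite /children.
apply: (@wp_for (fun j s1 => child_lists (arr s1 aNx) (arr s1 aFc) j) 0 g) => //=.
- by move=> u; exists [::]; split=> //=; rewrite hfc.
- move=> j s1 F hj hJ hI; apply: wp_if => /= hif; wrun.
    have {}hif : j != root by move: hif; fr F; rewrite hJ hr; slia.
    fr F; rewrite hJ hpb hin // => u.
    case: (hI u) => l [hc hu hl].
    have hjl : j \notin l by rewrite hl ltnn.
    case: (eqVneq u (pf j)) => [eu|nu].
      exists (j :: l); split=> /=.
      + split; rewrite ?addn1 // eqxx -eu.
        by apply: eq_chain hc => x hx /=; case: eqP => // ex; rewrite -ex hx in hjl.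
      + by rewrite hjl.
      + move=> t; rewrite inE hl ltnS [t <= j]leq_eqVlt; case: (eqVneq t j) => [->|] //=.
        by rewrite hif eu eqxx.
    exists l; split=> //.
    + by apply: eq_chain hc => x hx /=; case: eqP => // ex; rewrite -ex hx in hjl.
    + move=> t; rewrite hl ltnS [t <= j]leq_eqVlt; case: (eqVneq t j) => [->|] //=.
      by rewrite ltnn /= [pf j == u]eq_sym (negPf nu) andbF.
  have {}hif : j = root by move: hif; fr F; rewrite hJ hr; slia.
  move=> u; case: (hI u) => l [hc hu hl]; exists l; split=> //.
  move=> t; rewrite hl ltnS [t <= j]leq_eqVlt; case: (eqVneq t j) => [->|] //=.
  by rewrite ltnn hif eqxx.
- by rewrite muln1.
Qed.

(* The nodes are renumbered 1, ..., g in such a way that parents come first; node 0 is an extra root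
   with an empty bag. *)
Definition numbering (od pi : nat -> nat) : Prop :=
  [/\ od 1 = root /\ pi 1 = 0,
      forall i, 0 < i <= g -> od i < g,
      forall i j, 0 < i <= g -> 0 < j <= g -> od i = od j -> i = j,
      forall t, t < g -> exists2 i, 0 < i <= g & od i = t
    & forall i, 1 < i <= g -> [/\ 0 < pi i < i, od i != root & pf (od i) = od (pi i)]].

(** [os] and [ps] list the queued nodes and the numbers of their parents; position j holds number j
    + 1. Nodes numbered below [i] have all their children queued, and the list starting at [c]
    consists of the children of node [i] that are still to be queued. *)
Definition bfs_inv (od pi nx : nat -> nat) (i tail c : nat) : Prop :=
  exists os ps : seq nat,
  [/\ [/\ tail = (size os).+1, size ps = size os, 0 < size os & 0 < i <= tail],
      forall j, j < size os -> od j.+1 = nth 0 os j /\ pi j.+1 = nth 0 ps j,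
      [/\ uniq os, all (fun t => t < g) os, nth 0 os 0 = root & nth 0 ps 0 = 0],
      forall j, 0 < j < size os -> [/\ 0 < nth 0 ps j <= j, nth 0 ps j <= i,
        nth 0 os j != root & pf (nth 0 os j) = nth 0 os (nth 0 ps j).-1]
    & (forall j t, j < i.-1 -> t < g -> t != root -> pf t = nth 0 os j -> t \in os)
      /\ (i < tail -> exists l, [/\ chain nx c l, uniq l,
           forall t, t \in l -> [/\ t < g, t != root, pf t = nth 0 os i.-1 & t \notin os]
         & forall t, t < g -> t != root -> pf t = nth 0 os i.-1 -> (t \in l) || (t \in os)])].

Lemma uniq_bound (os : seq nat) : uniq os -> all (fun t => t < g) os -> size os <= g.
Proof.
move=> hu ha; rewrite -(size_iota 0 g); apply: uniq_leq_size => // t ht.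
by rewrite mem_iota add0n (allP ha).
Qed.

Lemma bfs_inv_bound od pi nx i tail c : bfs_inv od pi nx i tail c -> tail <= g.+1.
Proof. by move=> [os [ps [[-> _ _ _] _ [hu ha _ _] _ _]]]; rewrite ltnS uniq_bound. Qed.

Lemma bfs_next od pi nx fc i tail :
  child_lists nx fc g ->
  bfs_inv od pi nx i tail 0 -> i < tail -> bfs_inv od pi nx i.+1 tail (fc (od i.+1)).
Proof.
move=> hfc [os [ps [[htl hsz h0 hi] hod [hu ha hr hp] hps [hcl hl]]]] lt.
have {}hl : forall t, t < g -> t != root -> pf t = nth 0 os i.-1 -> t \in os.
  case: (hl lt) => -[|x l] [hc _ _ h] t h1 h2 h3; last by case: hc.
  exact: h.
exists os, ps; split=> //.
- by move=> j hj; have [h1 h2 h3 h4] := hps j hj; split=> //; apply: leqW.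
split.
  move=> j t; case: (eqVneq j i.-1) => [->|hne] hj; first by move=> *; apply: hl.
  by apply: hcl; case/andP: hi hj hne => /=; slia.
move=> lt2; have [l [hc hul hml]] := hfc (od i.+1).
have hin : i < size os by slia.
have hodi : od i.+1 = nth 0 os i by case: (hod i hin).
exists l; split=> //.
  move=> t; rewrite hml => /and3P[h1 h2 /eqP h3]; split=> //; first by rewrite h3.
  (* A queued node other than the root was found from a node numbered at most [i], so it cannot be a
     child of node [i + 1]. *)
  apply/negP => /(nthP 0) [j hj et]; rewrite -et hodi in h3 h2.
  case: j hj et h2 h3 => [|j] hj et h2 h3; first by rewrite hr eqxx in h2.
  have [hA hB hC hD] := hps j.+1 hj.
  move: h3; rewrite hD => /eqP; rewrite nth_uniq //; last by slia.
  by move: hA hB; slia.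
move=> t h1 h2 h3; rewrite hml h1 h2 /=.
by rewrite h3 hodi eqxx.
Qed.

Lemma bfs_push od pi nx i tail c :
  bfs_inv od pi nx i tail c.+1 -> i < tail ->
  bfs_inv (fun j => if j == tail then c else od j) (fun j => if j == tail then i else pi j)
    nx i tail.+1 (nx c).
Proof.
move=> [os [ps [[htl hsz h0 hi] hod [hu ha hr hp] hps [hcl hl]]]] lt.
have [l [hl1 hl2 hl3 hl4]] := hl lt.
case: l hl1 hl2 hl3 hl4 => [//|x l /= [[<-] hc]] {x} /andP[hcl2 hul] hl3 hl4.
have [hcg hcr hcp hco] := hl3 c (mem_head _ _).
have hi1 : i.-1 < size os by slia.
exists (rcons os c), (rcons ps i); split.
- by rewrite !size_rcons hsz; split=> //; slia.
- move=> j; rewrite size_rcons ltnS leq_eqVlt !nth_rcons hsz htl eqSS.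
  case: (eqVneq j (size os)) => [->|hne] //= hj; first by rewrite ltnn.
  by rewrite hj; apply: hod.
- split; last by rewrite nth_rcons hsz h0.
  + by rewrite rcons_uniq hco.
  + by rewrite all_rcons hcg.
  + by rewrite nth_rcons h0.
- move=> j; rewrite size_rcons ltnS [j <= _]leq_eqVlt => /andP[hj0] /orP[/eqP->|hj].
    rewrite !nth_rcons hsz ltnn eqxx hi1; split=> //; slia.
  have hjj : 0 < j < size os by rewrite hj0 hj.
  have [h1 h2 h3 h4] := hps j hjj.
  have h5 : (nth 0 ps j).-1 < size os by slia.
  by rewrite !nth_rcons hsz hj h5; split=> //; slia.
split.
  move=> j t hj; rewrite mem_rcons inE nth_rcons.
  have -> : j < size os by slia.
  by move=> h1 h2 h3; rewrite (hcl j) ?orbT.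
move=> _; exists l; rewrite nth_rcons hi1; split=> //.
  move=> t ht; have htl2 : t \in c :: l by rewrite inE ht orbT.
  have [h1 h2 h3 h4] := hl3 t htl2.
  split=> //; rewrite mem_rcons inE negb_or h4 andbT.
  by apply: contraNneq hcl2 => <-.
move=> t h1 h2 h3; move: (hl4 t h1 h2 h3); rewrite mem_rcons !inE.
by case: eqP => //= _; rewrite orbC.
Qed.

Hypothesis hreach : forall t, t < g -> exists k, iter k pf t = root.

Lemma bfs_final od pi nx i tail c :
  bfs_inv od pi nx i tail c -> tail <= i -> numbering od pi.
Proof.
move=> [os [ps [[htl hsz h0 hi] hod [hu ha hr hp] hps [hcl _]]]] le.
have hclosed t : t < g -> t != root -> pf t \in os -> t \in os.
  move=> h1 h2 /(nthP 0) [j hj e]; apply: (hcl j t _ h1 h2 (esym e)); slia.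
(* Induction on the distance to the root: the queue contains the root and is closed under
   children. *)
have hall t : t < g -> t \in os.
  move=> ht; have [k hk] := hreach ht; elim: k t ht hk => [|k IH] t ht.
    by move=> /= ->; rewrite -hr mem_nth.
  rewrite iterSr => hk; case: (eqVneq t root) => [->|hne]; first by rewrite -hr mem_nth.
  by apply: hclosed => //; apply: IH => //; apply: hpf.
have hsg : size os = g.
  apply/eqP; rewrite eqn_leq uniq_bound // -{1}(size_iota 0 g).
  by apply: uniq_leq_size (iota_uniq _ _) _ => t; rewrite mem_iota add0n; apply: hall.
have hod1 i1 : 0 < i1 <= g -> od i1 = nth 0 os i1.-1 /\ pi i1 = nth 0 ps i1.-1.
  by case: i1 => // i1 /= h; apply: hod; rewrite hsg.
split.
- have h1 : 0 < 1 <= g by slia.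
  by have [-> ->] := hod1 1 h1; rewrite /= ?hr ?hp.
- by move=> i1 h; have [-> _] := hod1 _ h; apply: (allP ha); apply: mem_nth; slia.
- move=> i1 j1 h1 h2; have [-> _] := hod1 _ h1; have [-> _] := hod1 _ h2.
  move/eqP; rewrite nth_uniq //; slia.
- move=> t /hall /(nthP 0) [j hj e]; have h1 : 0 < j.+1 <= g by slia.
  by exists j.+1 => //; have [-> _] := hod1 _ h1.
- move=> i1 h1; have h1' : 0 < i1 <= g by slia.
  have [-> ->] := hod1 _ h1'.
  have h2 : 0 < i1.-1 < size os by slia.
  have [hA hB hC hD] := hps _ h2.
  have h3 : 0 < nth 0 ps i1.-1 <= g by slia.
  rewrite hD; split=> //; first by slia.
  by have [-> _] := hod1 _ h3.
Qed.

Lemma bfs_spec s :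
  reg s rRoot = root -> arr s aPi 1 = 0 ->
  child_lists (arr s aNx) (arr s aFc) g ->
  wp bfs (2 * g + 2) s (fun s' => numbering (arr s' aOrd) (arr s' aPi)).
Proof.
move=> hr hpi hcl; rewrite /bfs; wrun; rewrite hr.
(* Each iteration advances either the head or the end of the queue, and both stay at most g + 1;
   hence their sum gives a variant. *)
apply: (@wp_while (fun k s1 => 0 < reg s1 rI <= reg s1 rTail /\ k = g.+2 + g.+1 - reg s1 rI - reg s1 rTail /\
  bfs_inv (arr s1 aOrd) (arr s1 aPi) (arr s1 aNx) (reg s1 rI) (reg s1 rTail) (reg s1 rC)) 0
  (g.+2 + g.+1 - 1 - 2)) => /=.
- split=> //; split=> //; exists [:: root], [:: 0]; split=> //.
  + by case.
  + by rewrite /= hroot.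
  + by case.
  split=> [j t|_]; first by rewrite ltn0.
  have [l [h1 h2 h3]] := hcl root; exists l; split=> //.
    move=> t; rewrite h3 => /and3P[-> h /eqP ->]; split=> //.
    by rewrite inE.
  by move=> t ht h /= e; rewrite h3 ht h e eqxx.
- move=> k s1 F [hi [-> hI]] hne; have lt : reg s1 rI < reg s1 rTail by slia.
  have hb := bfs_inv_bound hI.
  apply: wp_if => /= hif; wrun.
    rewrite !addn1 !subn1; case: (reg s1 rC) hif hI => // c _ hI.
    have h2 := bfs_push hI lt; have hb2 := bfs_inv_bound h2.
    exists (g.+2 + g.+1 - reg s1 rI - (reg s1 rTail).+1); first by slia.
    by split; [slia|].
  exists (g.+2 + g.+1 - (reg s1 rI).+1 - reg s1 rTail); first by slia.
  rewrite !addn1; split; first by slia.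
  split=> //; rewrite hif in hI.
  have -> : arr s1 aFc = arr s aFc by fr F.
  apply: bfs_next => //.
  suff -> : arr s1 aNx = arr s aNx by [].
  by fr F.
- by move=> k s1 F [hi [_ hI]] h0; apply: bfs_final hI _; slia.
- slia.
Qed.

End Order.

(** * Colouring the bags *)

Lemma rows_spec s N K :
  reg s rG2 = N -> reg s rK = K ->
  wp node_rows N s (fun s' => forall i, i < N -> arr s' aRk i = i * K).
Proof.
move=> hN hK; rewrite /node_rows; wrun.
apply: (@wp_for (fun j s1 => reg s1 rX = j * K /\ forall i, i < j -> arr s1 aRk i = i * K) 0 N) => //=.
- move=> j s1 F hj hJ [hx hi]; wrun; split; first by rewrite hx mulSn addnC; fr F; rewrite /= hK.
  move=> i; rewrite ltnS leq_eqVlt => /orP[/eqP->|lt]; first by rewrite hJ eqxx hx.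
  by rewrite hJ (ltn_eqF lt); apply: hi.
- by move=> s1 F _ [].
- by rewrite muln1.
Qed.

Section Colouring.

Variables (n K : nat).
Implicit Types (a : 'I_n) (e S : seq 'I_n).

Definition cells (col : nat -> nat) S (f : nat -> nat) : Prop :=
  forall c, c < K ->
    (f c = 0 /\ forall a, a \in S -> col a != c.+1) \/
    (exists2 a, a \in S & f c = a.+1 /\ col a = c.+1).

Lemma eq_cells (col col' : nat -> nat) S S' (f f' : nat -> nat) :
  {in S, forall a, col a = col' a} -> S =i S' -> (forall c, c < K -> f c = f' c) ->
  cells col S f -> cells col' S' f'.
Proof.
move=> hc hS hf h c hcK; case: (h c hcK) => [[h1 h2]|[a h1 [h2 h3]]]; [left|right].
  by rewrite -hf //; split=> // a; rewrite -hS => ha; rewrite -hc // h2.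
by exists a; rewrite -?hS // -hf // -hc.
Qed.

Lemma cells_add (col : nat -> nat) S (f : nat -> nat) a c : 
  (forall a', a' \in S -> col a' = c.+1 -> a' = a) ->
  col a = c.+1 -> cells col S f ->
  cells col (a :: S) (fun c' => if c' == c then a.+1 else f c').
Proof.
move=> hS ha h c' hc'; case: eqP => [->|ne].
  by right; exists a => //; rewrite mem_head.
case: (h c' hc') => [[h1 h2]|[a' h1 [h2 h3]]]; [left|right].
  split=> // a'; rewrite inE => /orP[/eqP->|]; last exact: h2.
  by rewrite ha eqSS; apply/eqP=> e; case: ne.
by exists a' => //; rewrite inE h1 orbT.
Qed.

Lemma old_colours_spec s rk e :
  reg s rX = rk -> reg s rN = size e ->
  (forall j a0, j < size e -> arr s aIn (reg s rB + j) = nth a0 e j) ->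
  (forall a, a \in e -> arr s aCol a <= K) ->
  (forall a a', a \in e -> a' \in e -> arr s aCol a != 0 -> arr s aCol a = arr s aCol a' -> a = a') ->
  (forall c, c < K -> arr s aColat (rk + c) = 0) ->
  wp old_colours (size e) s (fun s' =>
    cells (arr s aCol) [seq a : 'I_n <- e | arr s aCol a != 0] (fun c => arr s' aColat (rk + c)) /\
    forall x, (x < rk) || (rk + K <= x) -> arr s' aColat x = arr s aColat x).
Proof.
move=> hX hN hin hK hinj h0; rewrite /old_colours.
apply: (@wp_for (fun j s1 =>
  cells (arr s aCol) [seq a : 'I_n <- take j e | arr s aCol a != 0] (fun c => arr s1 aColat (rk + c)) /\
    forall x, (x < rk) || (rk + K <= x) -> arr s1 aColat x = arr s aColat x) 0 (size e)) => //=.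
- rewrite take0; split=> // c hc; left; split; [exact: h0 | by []].
- move=> j s1 F hj hJ [hI1 hI2]; wrun; fr F; rewrite hJ /=.
  have a0 : 'I_n by case: e hj {hN hin hK hinj hI1 F} => [|a0 l].
  rewrite (hin _ a0) //; set a := nth a0 e j.
  have hae : a \in e by apply: mem_nth.
  rewrite (take_nth a0) // -/a filter_rcons.
  apply: wp_if => /=; fr F => hc; wrun; fr F.
    have hc1 := hK a hae; rewrite hX hc; split; last first.
      move=> x hx; case: eqP => ex; last exact: hI2.
      by move: hx ex hc1; case: (arr s aCol a) hc => // c _; lia.
    apply: (@eq_cells (arr s aCol) _ (a :: [seq a1 : 'I_n <- take j e | arr s aCol a1 != 0]) _
       (fun c' => if c' == (arr s aCol a).-1 then a.+1 else arr s1 aColat (rk + c'))) => //.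
    + by move=> a'; rewrite mem_rcons.
    + move=> c hcK; rewrite addn1; have -> // : (rk + c == rk + arr s aCol a - 1) = (c == (arr s aCol a).-1).
      by apply/eqP/eqP; lia.
    + apply: cells_add => //; last by case: (arr s aCol a) hc.
      move=> a'; rewrite mem_filter => /andP[h1 /mem_take h2] h3.
      by apply: hinj => //; rewrite h3; case: (arr s aCol a) hc.
  by rewrite hc.
- by move=> s1 F _; rewrite take_size.
- by rewrite muln1.
Qed.

(** Pigeonhole: if all K cells were occupied, the coloured atoms of [e] would have K different
    colours, and together with the uncoloured [a] the bag would exceed K atoms. *)
Lemma free_cell (col f : nat -> nat) e a :
  size e <= K -> a \in e -> col a = 0 ->
  cells col [seq a : 'I_n <- e | col a != 0] f -> exists2 c, c < K & f c = 0.
Proof.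
move=> hs ha hca hc.
case: (boolP (has (fun c => f c == 0) (iota 0 K))) => [/hasP[c]|/hasPn hn].
  by rewrite mem_iota => /andP[_ h] /eqP; exists c.
suff : K <= size [seq col a | a : 'I_n <- [seq a : 'I_n <- e | col a != 0]].
  have : 0 < count (predC (fun a : 'I_n => col a != 0)) e.
    by rewrite -has_count; apply/hasP; exists a => //=; rewrite hca.
  have := count_predC (fun a : 'I_n => col a != 0) e.
  by rewrite size_map size_filter; slia.
rewrite -{1}(size_iota 1 K); apply: uniq_leq_size (iota_uniq _ _) _ => c.
rewrite mem_iota => /andP[h1 h2].
case: (hc c.-1); first by lia.
  by case=> h3; have := hn c.-1; rewrite mem_iota h3 /=; lia.
move=> [a' h3 [h4 h5]]; apply/mapP; exists a' => //; lia.
Qed.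

Lemma free_colour_spec s rk :
  reg s rX = rk -> (exists2 c, c < K & arr s aColat (rk + c) = 0) ->
  wp free_colour K s (fun s' => reg s' rC < K /\ arr s' aColat (rk + reg s' rC) = 0).
Proof.
move=> hX [c0 hc0 h0]; rewrite /free_colour; wrun.
apply: (@wp_while (fun k s1 => reg s1 rC <= c0 /\ k = c0 - reg s1 rC) 0 c0) => /=.
- by split=> //; rewrite subn0.
- move=> k s1 F [h1 ->] hne; wrun; fr F.
  have ne : reg s1 rC != c0.
    by move: hne; fr F; rewrite /= hX; apply: contraNneq => ->; rewrite h0.
  exists (c0 - (reg s1 rC).+1); first by lia.
  by rewrite addn1; split=> //; lia.
- by move=> k s1 F [h1 _]; fr F; rewrite /= hX => ->; split=> //; lia.
- lia.
Qed.

Definition coloured_bag (col : nat -> nat) e : Prop :=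
  forall a a', a \in e -> a' \in e -> col a != 0 -> col a = col a' -> a = a'.

Lemma new_colours_spec s i rk e :
  reg s rI = i -> reg s rX = rk -> reg s rN = size e ->
  (forall j a0, j < size e -> arr s aIn (reg s rB + j) = nth a0 e j) ->
  uniq e -> size e <= K ->
  (forall a, arr s aCol a <= K) ->
  coloured_bag (arr s aCol) e ->
  cells (arr s aCol) [seq a : 'I_n <- e | arr s aCol a != 0] (fun c => arr s aColat (rk + c)) ->
  wp new_colours (size e * K.+1) s (fun s' =>
    [/\ forall a, arr s aCol a != 0 \/ a \notin e ->
          arr s' aCol a = arr s aCol a /\ arr s' aIntro a = arr s aIntro a,
        forall a, a \in e -> 0 < arr s' aCol a <= K /\ (arr s aCol a = 0 -> arr s' aIntro a = i),
        coloured_bag (arr s' aCol) e,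
        cells (arr s' aCol) e (fun c => arr s' aColat (rk + c)) &
        forall x, (x < rk) || (rk + K <= x) -> arr s' aColat x = arr s aColat x]).
Proof.
move=> hI hX hN hin hu hsz hK hinj hcl; rewrite /new_colours.
apply: (@wp_for (fun j s1 =>
    [/\ forall a, arr s aCol a != 0 \/ a \notin take j e ->
          arr s1 aCol a = arr s aCol a /\ arr s1 aIntro a = arr s aIntro a,
        forall a, a \in take j e -> 0 < arr s1 aCol a <= K /\ (arr s aCol a = 0 -> arr s1 aIntro a = i),
        coloured_bag (arr s1 aCol) e,
        cells (arr s1 aCol) [seq a : 'I_n <- e | arr s1 aCol a != 0] (fun c => arr s1 aColat (rk + c)) &
        forall x, (x < rk) || (rk + K <= x) -> arr s1 aColat x = arr s aColat x]) K (size e)) => //=.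
- by split=> //; rewrite take0.
- move=> j s1 F hj hJ [h1 h2 h3 h4 h5].
  wrun; fr F; rewrite hJ.
  have a0 : 'I_n by case: e hj {hN hin hu hsz hinj hcl h1 h2 h3 h4 F} => [|a0 l].
  rewrite (hin _ a0) //; set a := nth a0 e j.
  have hae : a \in e by apply: mem_nth.
  have ht a' : (a' \in take j.+1 e) = (a' == a) || (a' \in take j e).
    by rewrite (take_nth a0) // mem_rcons inE.
  have hat : a \notin take j e.
    have : uniq (take j e ++ drop j e) by rewrite cat_take_drop.
    by rewrite cat_uniq (drop_nth a0) //= negb_or => /and3P[_ /andP[]].
  apply: wp_if => /= hc; wrun.
    have hac : arr s aCol a != 0.
      apply/eqP => h0; move: hc; rewrite (proj1 (h1 a _)) ?h0 //; by right.
    split=> // a'; rewrite ht.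
      by move=> h; apply: h1; case: h => [|]; [left|rewrite negb_or => /andP[_]; right].
    move=> /orP[/eqP->|]; last exact: h2.
    have [e1 _] := h1 a (or_introl hac).
    by rewrite e1 lt0n hac hK; split=> // h0; rewrite h0 in hac.
  have [e1 e2] := h1 a (or_intror hat).
  have ha0 : arr s aCol a = 0 by rewrite -e1.
  apply: (@wp_seq K 0); first by rewrite addn0.
  apply: wp_conseq (@free_colour_spec _ rk _ _) (leqnn _) _ => /=.
  + by fr F.
  + exact: (free_cell hsz hae hc h4).
  move=> s2 F2 [hcK hcell] _; wrun; fr F2; rewrite /=; fr F; rewrite /= hI hX.
  rewrite (proj2 F2 aColat isT) /= in hcell.
  set c := reg s2 rC in hcK hcell *; rewrite !addn1.
  have hnoc a' : a' \in e -> arr s1 aCol a' != c.+1.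
    move=> ha'; case: (h4 c hcK) => [[_ hno]|[a2 _ [hh _]]]; last by rewrite hcell in hh.
    apply/eqP => ee; have := hno a'; rewrite mem_filter ee ha' eqxx /=.
    by move=> /(_ isT).
  have vE a1 a2 : (val (a1 : 'I_n) == val (a2 : 'I_n)) = (a1 == a2) by [].
  split.
  + move=> a' h; have ne : a' != a.
      by apply/eqP => ea; case: h; rewrite ea ?ha0 // ht eqxx.
    rewrite vE (negPf ne); apply: h1; case: h => [|]; [by left|].
    by rewrite ht negb_or => /andP[_]; right.
  + move=> a'; rewrite ht vE; case: eqP => [->|_] /=; first by rewrite hcK.
    exact: h2.
  + move=> a1 a2 i1 i2 /=; rewrite !vE; case: (eqVneq a1 a) => [->|_]; case: (eqVneq a2 a) => [->|_] //.
    * by move=> _ ee; have := hnoc a2 i2; rewrite -ee eqxx.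
    * by move=> _ ee; have := hnoc a1 i1; rewrite ee eqxx.
    * exact: h3.
  + apply: (@eq_cells (fun x => if x == a then c.+1 else arr s1 aCol x) _
       (a :: [seq a1 : 'I_n <- e | arr s1 aCol a1 != 0]) _
       (fun c' => if c' == c then a.+1 else arr s1 aColat (rk + c'))) => //.
    * move=> a'; rewrite inE !mem_filter vE; case: eqP => [->|] //=; by rewrite hae.
    * by move=> c' _; rewrite eqn_add2l.
    apply: cells_add.
    * move=> a'; rewrite mem_filter vE => /andP[_ i1]; case: eqP => // _ ee.
      by have := hnoc a' i1; rewrite ee eqxx.
    * by rewrite eqxx.
    apply: eq_cells h4 => // a'; rewrite mem_filter vE => /andP[i1 _].
    by case: eqP => // ea; rewrite ea hc in i1.
  + move=> x hx; case: eqP => ex; last exact: h5.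
    by move: hx; rewrite ex; lia.
- move=> s1 F _ [h1 h2 h3 h4 h5]; rewrite take_size in h1 h2; split=> //.
  apply: eq_cells h4 => // a; rewrite mem_filter; case: (boolP (a \in e)); last by rewrite andbF.
  by move/h2 => [/andP[h _] _]; rewrite -lt0n h.
Qed.

End Colouring.

Section Nodes.

Variables (n K g : nat) (bag : nat -> {set 'I_n}) (pi : nat -> nat).
Hypotheses (bag0 : bag 0 = set0)
  (bagK : forall i, scard (bag i) <= K)
  (pi_lt : forall i, 0 < i <= g -> pi i < i)
  (rip : forall i j (a : 'I_n), j < i <= g -> a \in bag i -> a \in bag j -> a \in bag (pi i)).

Definition coloured (m : nat) (col intro colat : nat -> nat) : Prop :=
  [/\ forall i (a : 'I_n), i <= m -> a \in bag i ->
        [/\ 0 < col a <= K, a \in bag (intro a) & intro a <= i],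
      forall i, i <= m -> coloured_bag col (enum (bag i))
    & forall i, i <= m -> cells K col (enum (bag i)) (fun c => colat (i * K + c))].

Definition uncoloured (m : nat) (col colat : nat -> nat) : Prop :=
  (forall a : 'I_n, (forall i, i <= m -> a \notin bag i) -> col a = 0) /\
  (forall x, m.+1 * K <= x -> colat x = 0).

(** An atom of the new bag that already has a colour occurs in an earlier bag, hence by [rip] in the
    parent bag. So the old colours in the new bag are pairwise distinct, and a greedy choice
    completes them. *)
Lemma colouring_spec s :
  reg s rG = g ->
  (forall i, 0 < i <= g -> set_at (arr s aIn) (arr s aBst (arr s aOrd i)) (bag i)) ->
  (forall i, i < g.+2 -> arr s aRk i = i * K) ->
  arr s aCol = (fun _ => 0) -> arr s aColat = (fun _ => 0) ->
  wp colouring (g * (K * K.+3).+1) s (fun s' =>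
    coloured g (arr s' aCol) (arr s' aIntro) (arr s' aColat)).
Proof.
move=> hg hin hrk hc0 ht0; rewrite /colouring.
apply: (@wp_for (fun m s1 => coloured m (arr s1 aCol) (arr s1 aIntro) (arr s1 aColat) /\
   uncoloured m (arr s1 aCol) (arr s1 aColat)) (K * K.+3) g) => //=.
- rewrite hc0 ht0; split; last by split.
  split=> [i a|i|i]; rewrite leqn0 => /eqP->; rewrite ?bag0 ?inE //.
  by move=> c _; left; split=> // a; rewrite mem_enum inE.
- move=> m s1 F hm hM [[h1 h2 h3] [h4 h5]].
  have hm1 : 0 < m.+1 <= g by [].
  have [e [he hw]] := hin m.+1 hm1.
  have heb a : (a \in e) = (a \in bag m.+1) by rewrite (perm_mem he) mem_enum.
  have hsz : size e <= K by rewrite (perm_size he) -cardE; apply: bagK.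
  have hu : uniq e by rewrite (perm_uniq he) enum_uniq.
  have hold (a : 'I_n) : a \in bag m.+1 -> arr s1 aCol a != 0 -> a \in bag (pi m.+1).
    move=> ha; case: (boolP [exists i : 'I_m.+1, a \in bag i]) => [/existsP[i hi] _|/existsPn hn].
      apply: rip ha hi; have := ltn_ord i; lia.
    by rewrite h4 // => i hi; have := hn (Ordinal (hi : i < m.+1)).
  have hpm : pi m.+1 <= m by have := pi_lt hm1; lia.
  have hcK (a : 'I_n) : arr s1 aCol a <= K.
    case: (boolP [exists i : 'I_m.+1, a \in bag i]) => [/existsP[i hi]|/existsPn hn].
      by have [/andP[]] := h1 i a (ltn_ord i) hi.
    by rewrite h4 // => i hi; have := hn (Ordinal (hi : i < m.+1)).
  have hinj : coloured_bag (arr s1 aCol) e.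
    move=> a a'; rewrite !heb => ha ha' hne hee.
    apply: (h2 _ hpm) => //; rewrite mem_enum; apply: hold => //; by rewrite -hee.
  have ein : arr s1 aIn = arr s aIn by fr F.
  wrun; fr F; rewrite hM !addn1.
  rewrite (word_at_head hw) hrk; last by lia.
  have hw2 : forall j a0, j < size e -> arr s aIn ((arr s aBst (arr s aOrd m.+1)).+1 + j) = nth a0 e j.
    move=> j a0 hj; have := word_at_tail hw; rewrite /word_at => ->; last by rewrite size_map.
    by rewrite (nth_map a0).
  set s2 := set_reg _ _ _.
  have {F}F : frame colouring s s2.
    apply: frame_trans F _; split=> [x|//].
    rewrite /= !inE => /norP[_] /norP[/negPf n13] /norP[/negPf n19] /norP[/negPf n25] /norP[_] /norP[/negPf n20] _.
    by rewrite n13 n19 n25 n20.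
  apply: (@wp_seq (size e) (size e * K.+1)); first by nia.
  apply: wp_conseq (@old_colours_spec n K s2 (m.+1 * K) e _ _ _ _ _ _) (leqnn _) _ => //=.
  + by move=> j a0 hj; rewrite ein; exact: hw2.
  + by move=> c _; apply: h5; lia.
  move=> s3 F3 [hc3 ho3] _.
  have ec : arr s3 aCol = arr s1 aCol by fr F3.
  have ei : arr s3 aIntro = arr s1 aIntro by fr F3.
  apply: wp_conseq (@new_colours_spec n K s3 m.+1 (m.+1 * K) e _ _ _ _ _ _ _ _ _) (leqnn _) _ => //=;
    rewrite ?ec //.
  1-3: by fr F3.
  + by move=> j a0 hj; fr F3; rewrite ein; exact: hw2.
  move=> s4 F4 [hA hB hC hD hE]; rewrite ?ec ?ei in hA hB hC hD.
  have hE' x : (x < m.+1 * K) || (m.+1 * K + K <= x) -> arr s4 aColat x = arr s1 aColat x.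
    by move=> hx; rewrite hE // ho3.
  have hkeep (a : 'I_n) i : i <= m -> a \in bag i -> arr s4 aCol a = arr s1 aCol a /\ arr s4 aIntro a = arr s1 aIntro a.
    by move=> hi ha; apply: hA; left; have [/andP[]] := h1 i a hi ha; case: (arr s1 aCol a).
  have [hnew hold'] : (forall i, i <= m.+1 -> i = m.+1 \/ i <= m) /\ (m * K + K = m.+1 * K).
    by split=> [i|]; [rewrite leq_eqVlt => /orP[/eqP|]; [left|right] | rewrite mulSn addnC].
  split; split.
  + move=> i a /hnew [->|lt] ha; last first.
      by have [-> ->] := hkeep a i lt ha; exact: h1.
    have hae : a \in e by rewrite heb.
    have [hk hi] := hB a hae; split=> //.
      case: (eqVneq (arr s1 aCol a) 0) => [/hi->//|hne].
      have [_ ->] := hA a (or_introl hne).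
      by have [_ ] := h1 _ a hpm (hold a ha hne).
    case: (eqVneq (arr s1 aCol a) 0) => [/hi->//|hne].
    have [_ ->] := hA a (or_introl hne).
    have [_ _ h] := h1 _ a hpm (hold a ha hne); lia.
  + move=> i /hnew [->|lt] a a'; rewrite !mem_enum => ha ha'.
      by apply: hC; rewrite heb.
    have [-> _] := hkeep a i lt ha; have [-> _] := hkeep a' i lt ha'.
    by apply: (h2 i lt); rewrite mem_enum.
  + move=> i /hnew [->|lt].
      by apply: eq_cells hD => // a; rewrite heb mem_enum.
    apply: eq_cells (h3 i lt) => //.
      by move=> a; rewrite mem_enum => ha; have [-> _] := hkeep a i lt ha.
    by move=> c hc; rewrite hE' //; nia.
  + move=> a ha; have hae : a \notin e by rewrite heb ha.
    have [-> _] := hA a (or_intror hae).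
    by apply: h4 => i hi; apply: ha; apply: leqW.
  + by move=> x hx; rewrite hE' ?h5 //; lia.
- by move=> s1 F _ [].
Qed.

End Nodes.

Lemma powers_spec s K :
  reg s rK = K ->
  wp powers (2 * K) s (fun s' =>
    [/\ forall c, c < K -> arr s' aP4 c = 4 ^ c, reg s' rQ = 4 ^ K & reg s' rW1 = 2 ^ K + 1]).
Proof.
move=> hK; rewrite /powers; wrun.
apply: (@wp_seq K K); first by lia.
apply: (@wp_for (fun j s1 => reg s1 rP = 4 ^ j /\ forall c, c < j -> arr s1 aP4 c = 4 ^ c) 0 K) => //=.
- move=> j s1 F hj hJ [h1 h2]; wrun; rewrite hJ h1 expnS; split; first by lia.
  move=> c; rewrite ltnS leq_eqVlt => /orP[/eqP->|lt]; first by rewrite eqxx.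
  by rewrite (ltn_eqF lt) h2.
- move=> s1 F _ [hP h4] F1; wrun.
  apply: (@wp_seq K 0); first by lia.
  apply: (@wp_for (fun j s2 => reg s2 rW1 = 2 ^ j) 0 K) => //=.
  + by fr F; rewrite /= hK.
  + by move=> j s2 F2 hj hJ h; wrun; rewrite h expnS; lia.
  + move=> s2 F2 _ h F3; wrun; fr F2; rewrite /= h; split=> //.
  + lia.
- lia.
Qed.

Lemma products_spec s W :
  reg s rW1 = W ->
  wp products (W * W.+1) s (fun s' =>
    forall a b, a < W -> b < W -> arr s' aProd (arr s' aRow a + b) = a * b).
Proof.
move=> hW; rewrite /products; wrun.
apply: (@wp_for (fun j s1 => reg s1 rX = j * W /\ forall a, a < j ->
  arr s1 aRow a = a * W /\ forall b, b < W -> arr s1 aProd (a * W + b) = a * b) W W) => //=.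
- move=> j s1 F hj hJ [h1 h2]; wrun; rewrite hJ h1.
  apply: (@wp_for (fun i s2 => [/\ reg s2 rZ = i * j, reg s2 rX = j * W + i &
     forall a b, a * W + b < j * W + i -> b < W -> arr s2 aProd (a * W + b) = a * b]) 0 W) => //=.
  + by fr F.
  + rewrite h1 addn0; split=> // a b hab hb; apply: (proj2 (h2 a _)) => //.
    by move: hab hb; nia.
  + move=> i s2 F2 hi hI [e1 e2 e3]; wrun; rewrite e1 e2 addn1 addnS mulSn addnC; split=> //.
      by fr F2; rewrite /= hJ.
    move=> a b; rewrite ltnS => hab hb; case: eqP => [e|ne]; last by apply: e3 => //; lia.
    have ea : a = j by nia.
    by move: e; rewrite ea => /addnI ->; rewrite mulnC.
  + move=> s2 F2 _ [e1 e2 e3]; split; first by rewrite e2 mulSn addnC.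
    move=> a; rewrite ltnS => ha.
    split.
      fr F2; rewrite /=; case: eqP => [->//|ne]; apply: (proj1 (h2 a _)); lia.
    by move=> b hb; apply: e3 => //; nia.
  + by rewrite muln1.
- by move=> s1 F _ [_ h] a b ha hb; have [-> ->] := h a ha.
Qed.

(** * States *)

(* A state lists the colours of the true atoms of a bag in derivation order; the bit tells whether the
   atom has already been justified by a rule. *)
Definition state : Type := seq (nat * bool).
Section States.

Implicit Types (v u : state) (c : nat).

Definition cols v : seq nat := unzip1 v.
Definition valid K v : bool := uniq (cols v) && all (fun c => c < K) (cols v).
Definition stat v c : nat := if (c, true) \in v then 2 else if (c, false) \in v then 1 else 0.
Definition del c v : state := [seq x <- v | x.1 != c].
Definition flip c v : state := [seq (x.1, (x.1 != c) && x.2) | x <- v].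
Definition key2 v : nat := sumn [seq 4 ^ x.1 + 4 ^ x.1 | x <- v].

Lemma cols_rcons v x : cols (rcons v x) = rcons (cols v) x.1.
Proof. exact: map_rcons. Qed.

Lemma valid_rcons K v c b : valid K (rcons v (c, b)) = [&& valid K v, c \notin cols v & c < K].
Proof. by rewrite /valid cols_rcons rcons_uniq all_rcons /=; do !case: (_ \in _); case: uniq; case: (c < K); rewrite ?andbF ?andbT. Qed.

Lemma mem_cols v c b : (c, b) \in v -> c \in cols v.
Proof. by move=> h; apply/mapP; exists (c, b). Qed.

Lemma stat0 v c : (stat v c == 0) = (c \notin cols v).
Proof.
rewrite /stat; apply/idP/idP.
  case: ifP => // h1; case: ifP => // h2 _; apply/negP => /mapP[[c' [] /= h] e]; subst c'.
    by rewrite h in h1.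
  by rewrite h in h2.
by move=> h; case: ifP => [/mem_cols|_]; [rewrite (negPf h)|case: ifP => [/mem_cols|] //; rewrite (negPf h)].
Qed.

Lemma stat_rcons v c c' b : c' \notin cols v ->
  stat (rcons v (c', b)) c = if c == c' then b + 1 else stat v c.
Proof.
move=> hc; rewrite /stat !mem_rcons !inE !xpair_eqE; case: eqP => [->|] //=.
have nb b' : ((c', b') \in v) = false by apply/negP => /mem_cols; rewrite (negPf hc).
by rewrite !nb; case: b.
Qed.

Lemma stat2 v c : (1 < stat v c) = ((c, true) \in v).
Proof. by rewrite /stat; case: ifP => // _; case: ifP. Qed.

Lemma uniq_bits v c b b' : uniq (cols v) -> (c, b) \in v -> (c, b') \in v -> b = b'.
Proof.
elim: v => //= x v IH /andP[hx hu]; rewrite !inE => /orP[/eqP e|h] /orP[/eqP e'|h'].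
- by move: e'; rewrite -e => -[].
- by rewrite -e /= (mem_cols h') in hx.
- by rewrite -e' /= (mem_cols h) in hx.
- exact: IH.
Qed.

Lemma stat1 v c : uniq (cols v) -> (stat v c == 1) = ((c, false) \in v).
Proof.
move=> hu; rewrite /stat; case: ifP => [h|_]; last by case: ifP.
by apply/esym/negP => h2; have := uniq_bits hu h h2.
Qed.

Lemma cols_flip c v : cols (flip c v) = cols v.
Proof. by rewrite /cols /unzip1 /flip -map_comp. Qed.

Lemma cols_del c v : cols (del c v) = [seq x <- cols v | x != c].
Proof. by rewrite /cols /del /unzip1 filter_map. Qed.

Lemma flip_id c v : (c, true) \notin v -> flip c v = v.
Proof.
elim: v => //= [[c' b] v IH]; rewrite inE negb_or => /andP[h1 /IH ->] /=.
by case: eqP => [e|] //=; rewrite e; case: b h1; rewrite // e eqxx.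
Qed.

Lemma del_id c v : c \notin cols v -> del c v = v.
Proof. by move=> h; apply/all_filterP/allP => x hx; apply: contraNneq h => <-; apply: map_f. Qed.

Lemma flip_rcons c v c' b : flip c (rcons v (c', b)) = rcons (flip c v) (c', (c' != c) && b).
Proof. by rewrite /flip map_rcons. Qed.

Lemma del_rcons c v c' b : del c (rcons v (c', b)) = if c' != c then rcons (del c v) (c', b) else del c v.
Proof. by rewrite /del filter_rcons. Qed.

Lemma key2_rcons v c b : key2 (rcons v (c, b)) = key2 v + (4 ^ c + 4 ^ c).
Proof. by rewrite /key2 map_rcons sumn_rcons. Qed.

Lemma valid_size K v : valid K v -> size v <= K.
Proof.
move=> /andP[hu ha]; rewrite -(size_map fst v) -(size_iota 0 K).
by apply: uniq_leq_size => // c hc; rewrite mem_iota add0n (allP ha).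
Qed.

Definition free_cols K v : seq nat := [seq c <- iota 0 K | c \notin cols v].

Lemma size_free_cols K v : valid K v -> size (free_cols K v) = K - size v.
Proof.
move=> /andP[hu ha].
rewrite /free_cols size_filter.
have e : count (fun c => c \in cols v) (iota 0 K) + count (fun c => c \notin cols v) (iota 0 K) = K.
  by rewrite -[RHS](size_iota 0 K) -(count_predC (fun c => c \in cols v)).
suff h : count (fun c => c \in cols v) (iota 0 K) = size v by rewrite -{2}e h addKn.
rewrite -(size_map fst v) -size_filter; apply: perm_size; apply: uniq_perm => //.
  by apply: filter_uniq; apply: iota_uniq.
by move=> c; rewrite mem_filter mem_iota add0n; case: (boolP (c \in cols v)) => //= h; rewrite (allP ha).
Qed.

Fixpoint level K i : seq state :=
  if i is i'.+1 then
    flatten [seq [seq rcons v (c, false) | c <- free_cols K v] ++ [seq rcons v (c, true) | c <- free_cols K v]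
               | v <- level K i']
  else [:: [::]].

Lemma levelP K i v : v \in level K i -> valid K v /\ size v = i.
Proof.
elim: i v => [|i IH] v /=; first by rewrite inE => /eqP->.
move=> /flattenP[l /mapP[u hu ->]]; have [hv hs] := IH u hu.
rewrite mem_cat => /orP[] /mapP[c]; rewrite mem_filter mem_iota => /andP[h1 /andP[_ h2]] ->;
  by rewrite valid_rcons hv h1 /= -[K]add0n h2 size_rcons hs.
Qed.

Lemma mem_level K v : valid K v -> v \in level K (size v).
Proof.
elim/last_ind: v => [|v [c b] IH]; first by rewrite inE.
rewrite valid_rcons => /and3P[hv h1 h2]; rewrite size_rcons /=.
apply/flattenP; eexists; first by apply: map_f; apply: IH.
have hc : c \in free_cols K v by rewrite mem_filter mem_iota h1.
by rewrite mem_cat; apply/orP; case: b; [right|left]; apply: (map_f (fun c => rcons v (c, _))).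
Qed.

Lemma size_level K i : i <= K -> size (level K i) = 2 ^ i * K ^_ i.
Proof.
elim: i => [|i IH] hi //=.
rewrite size_flatten /shape -map_comp ffactnSr expnSr.
have -> : [seq (size \o (fun v => [seq rcons v (c, false) | c <- free_cols K v] ++
    [seq rcons v (c, true) | c <- free_cols K v])) v | v <- level K i] = [seq 2 * (K - i) | v <- level K i].
  apply/eq_in_map => v /levelP[hv hs] /=.
  by rewrite size_cat !size_map size_free_cols // hs mul2n addnn.
rewrite sumnE big_map big_const_seq count_predT iter_addn_0 IH; last exact: ltnW.
by rewrite mulnC -!mulnA; congr (_ * _); rewrite mulnCA.
Qed.

Definition state_bound K : nat := 2 * (2 ^ K * K`!).

(** Up to [i = K] each level is at least twice as large as the one before, because the factor gained
    is [2 * (K - i)] with [i < K]; so the sum is at most twice its last term. *)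
Lemma sum_levels K : sumn [seq size (level K i) | i <- iota 0 K.+1] <= state_bound K.
Proof.
suff h m : m <= K -> sumn [seq size (level K i) | i <- iota 0 m.+1] <= 2 * (2 ^ m * K ^_ m).
  by rewrite (leq_trans (h K _)) // /state_bound ffactnn.
elim: m => [|m IH] hm //.
have e1 : sumn [seq size (level K i) | i <- iota m.+1 1] = size (level K m.+1) by exact: addn0.
rewrite -addn1 iotaD map_cat sumn_cat add0n e1 size_level //.
have := IH (ltnW hm); rewrite ffactnSr expnS; nia.
Qed.

Lemma uniq_states_bound K (Q : seq state) : uniq Q -> all (valid K) Q -> size Q <= state_bound K.
Proof.
move=> hu ha; apply: leq_trans (sum_levels K).
have -> : sumn [seq size (level K i) | i <- iota 0 K.+1] = size (flatten [seq level K i | i <- iota 0 K.+1]).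
  by rewrite size_flatten /shape -map_comp.
apply: uniq_leq_size => // v hv; apply/flattenP; exists (level K (size v)).
  by apply: map_f; rewrite mem_iota add0n ltnS; apply: valid_size; apply: (allP ha).
by apply: mem_level; apply: (allP ha).
Qed.

End States.

Definition node_id (Q : seq state) (j : nat) (v : state) : Prop :=
  j < size Q /\ nth [::] Q j = v.

Lemma node_id_rcons Q j v w : node_id Q j v -> node_id (rcons Q w) j v.
Proof. by move=> [h1 h2]; split; rewrite ?size_rcons ?nth_rcons ?h1 // ltnW. Qed.

Lemma node_id_inj Q j j' v : uniq Q -> node_id Q j v -> node_id Q j' v -> j = j'.
Proof. by move=> hu [h1 e1] [h2 e2]; apply/eqP; rewrite -(nth_uniq [::] h1 h2 hu) e1 e2. Qed.

(** * The trie of all states *)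

Section Trie.

Variable K : nat.

Record trie_nodes (Q : seq state) (s : store) : Prop := TrieNodes {
  trie_row : forall j, j < size Q -> arr s aRv j = j * K;
  trie_stat : forall j v c, node_id Q j v -> c < K -> arr s aStat (j * K + c) = stat v c;
  trie_key : forall j v, node_id Q j v -> arr s aKey j = key2 v;
  trie_last : forall j v c b, node_id Q j (rcons v (c, b)) ->
    [/\ arr s aVc j = c, arr s aVb j = b, arr s aPar j < j & node_id Q (arr s aPar j) v]
}.

Lemma add_child_spec s Q h v c (b : bool) :
  trie_nodes Q s -> node_id Q h v -> c < K -> c \notin cols v ->
  (forall j x, node_id Q j (rcons v (c, x)) -> x <> b) ->
  reg s rK = K -> reg s rI = h -> reg s rC = c -> reg s rY = h * K -> reg s rX = h * K + c ->
  reg s rTail = size Q -> reg s rL = size Q * K -> arr s aP4 c = 4 ^ c ->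
  wp (add_child b) K s (fun s' =>
    [/\ trie_nodes (rcons Q (rcons v (c, b))) s',
        reg s' rTail = (size Q).+1, reg s' rL = (size Q).+1 * K &
        forall x, arr s' aCh x = if x == h * K + c + (h * K + c) + b then size Q else arr s aCh x]).
Proof.
move=> [h1 h2 h3 h4] hv hc hcv hnew hK hI hC hY hX hT hL hP; rewrite /add_child; wrun.
rewrite hT hL hI hC hX hP.
apply: (@wp_seq K 0); first by rewrite addn0.
apply: (@wp_for (fun e s1 => forall x, arr s1 aStat x =
    if size Q * K <= x < size Q * K + e then stat v (x - size Q * K) else arr s aStat x) 0 K) => //=.
- by move=> x; rewrite addn0; case: andP => // -[]; lia.
- move=> e s1 F he hE hI1; wrun; fr F; rewrite /= hY hE hL => x.
  case: eqP => [->|ne].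
    rewrite leq_addr ltn_add2l ltnSn /= addKn hI1.
    case: ifP => [/andP[hh _]|_]; last exact: h2.
    by case: hv => hv _; nia.
  rewrite hI1; congr (if _ then _ else _); congr (_ && _); lia.
- move=> s1 F _ hS F2; wrun; fr F; rewrite /= hT hL hC hK (addn1 (size Q)); split=> //; last by rewrite mulSn addnC.
  have hn j u : node_id (rcons Q (rcons v (c, b))) j u -> (j == size Q) = false -> node_id Q j u.
    by move=> [g1 g2] /eqP g3; rewrite size_rcons in g1; rewrite nth_rcons in g2;
       have g4 : j < size Q by [slia]; rewrite g4 in g2.
  have hlast j u : node_id (rcons Q (rcons v (c, b))) j u -> j = size Q -> u = rcons v (c, b).
    by move=> [g1 g2] g3; rewrite nth_rcons g3 ltnn eqxx in g2.
  have nev : (h == size Q) = false by case: hv => hv _; rewrite ltn_eqF.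
  split.
  + move=> j; rewrite size_rcons ltnS leq_eqVlt /=; fr F; rewrite /= => /orP[/eqP->|lt]; rewrite ?eqxx //.
    by rewrite (ltn_eqF lt) h1.
  + move=> j u e hj he /=; case: (eqVneq j (size Q)) => [ej|/negPf nj].
      rewrite (hlast _ _ hj ej) stat_rcons // ej eqn_add2l.
      by case: eqP => // _; rewrite hS leq_addr ltn_add2l he addKn.
    have hjQ := hn _ _ hj nj; have ltj : j < size Q by case: hjQ.
    have -> : (j * K + e == size Q * K + c) = false by apply/eqP; nia.
    rewrite hS; have -> : (size Q * K <= j * K + e < size Q * K + K) = false by apply/negP; nia.
    exact: h2.
  + move=> j u hj /=; fr F; rewrite /=; case: (eqVneq j (size Q)) => [ej|/negPf nj].
      by rewrite (hlast _ _ hj ej) key2_rcons (h3 _ _ hv).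
    exact: h3 (hn _ _ hj nj).
  + move=> j u c' b' hj /=; fr F; rewrite /=; case: (eqVneq j (size Q)) => [ej|/negPf nj].
      move: (hlast _ _ hj ej) => /rcons_inj [-> -> ->]; split=> //.
        by rewrite ej; case: hv.
      exact: node_id_rcons.
    have [g1 g2 g3 g4] := h4 _ _ _ _ (hn _ _ hj nj); split=> //; exact: node_id_rcons.
- by rewrite muln1.
Qed.

Definition children_before (Q : seq state) (ch : nat -> nat) (h c : nat) : Prop :=
  forall j v c' (b : bool), node_id Q j v -> c' < K -> c' \notin cols v ->
    (j < h) || ((j == h) && (c' < c)) ->
    node_id Q (ch (j * K + c' + (j * K + c') + b)) (rcons v (c', b)).

(** [(h, c)] is the position reached by the breadth-first generation: state [h] is being extended
    and [c] is the next colour to try. [queue_parents] says that every state in the queue was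
    created at an earlier position, so the children created at [(h, c)] are new and [uniq]
    persists. *)
Record queue_ok (Q : seq state) (h c : nat) : Prop := QueueOk {
  queue_uniq : uniq Q;
  queue_valid : all (valid K) Q;
  queue_root : node_id Q 0 [::];
  queue_parents : forall j v x, node_id Q j (rcons v x) ->
    exists2 i, node_id Q i v & (i < h) || ((i == h) && (x.1 < c))
}.

Definition trie_inv (h c : nat) (s : store) : Prop :=
  exists Q, [/\ queue_ok Q h c, trie_nodes Q s, children_before Q (arr s aCh) h c,
    reg s rTail = size Q & reg s rL = size Q * K].

Lemma trie_inv_tail h c s : trie_inv h c s -> 0 < reg s rTail <= state_bound K.
Proof.
by move=> [Q [[hu ha [h0 _] _] _ _ -> _]]; rewrite uniq_states_bound // (leq_ltn_trans _ h0).
Qed.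

Lemma trie_step h c s :
  trie_inv h c s -> h < reg s rTail -> c < K ->
  reg s rK = K -> reg s rI = h -> reg s rC = c -> reg s rY = h * K -> reg s rX = h * K + c ->
  arr s aP4 c = 4 ^ c ->
  wp (If (Get aStat (Reg rX)) Skip (Seq (add_child 0) (add_child 1))) (K + K) s
    (fun s' => trie_inv h c.+1 s' /\ reg s rTail <= reg s' rTail).
Proof.
move=> [Q [[hu ha h0 hp] hn hch hT hL]] hlt hc hK hI hC hY hX hP.
rewrite hT in hlt; pose v := nth [::] Q h; have hv : node_id Q h v by [].
apply: wp_if => /=; rewrite hX (trie_stat hn hv hc); [move=> hcv|move/eqP=> hcv];
  rewrite stat0 ?negbK in hcv.
  apply: wp_skip; split=> //; exists Q; split=> //.
    split=> // j u x /hp [i hi hx]; exists i => //.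
    by case/orP: hx => [->//|/andP[-> /ltnW hx]]; rewrite ltnS hx orbT.
  move=> j u c' b hj hc' hcu; case: (ltnP j h) => hjh.
    by move=> _; apply: hch => //; rewrite hjh.
  move=> /= /andP[/eqP ejh]; rewrite ltnS leq_eqVlt => /orP[/eqP ec|lt].
    by move: hcu; case: hj => _ <-; rewrite ejh ec hcv.
  by apply: hch => //; rewrite ejh eqxx lt orbT.
have hvalid b : valid K (rcons v (c, b)).
  by rewrite valid_rcons hcv hc !andbT; apply: (allP ha); apply: mem_nth.
have hnew j x : ~ node_id Q j (rcons v (c, x)).
  move=> /hp [i hi hx]; rewrite (node_id_inj hu hi hv) ltnn eqxx /= in hx.
  by rewrite ltnn in hx.
apply: (@wp_seq K K) => //.
apply: wp_conseq (@add_child_spec s Q h v c false hn hv hc hcv _ hK hI hC hY hX hT hL hP) (leqnn _) _.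
  by move=> j x /hnew.
move=> s1 F1 [n1 t1 l1 c1] _.
set Q1 := rcons Q (rcons v (c, false)) in n1.
have sz1 : size Q1 = (size Q).+1 by rewrite size_rcons.
have hv1 : node_id Q1 h v by apply: node_id_rcons.
have hid1 : node_id Q1 (size Q) (rcons v (c, false)).
  by split; rewrite ?sz1 // nth_rcons ltnn eqxx.
have inQ j u : node_id Q j u -> u \in Q by case=> g1 <-; apply: mem_nth.
have inQ' u : u \in Q -> exists j, node_id Q j u.
  by move=> /(nthP [::]) [j g1 g2]; exists j.
have hu1 : uniq Q1.
  by rewrite rcons_uniq hu andbT; apply/negP => /inQ' [j /hnew].
have c1' x : arr s1 aCh x = if x == h * K + c + (h * K + c) then size Q else arr s aCh x.
  by rewrite c1 addn0.
apply: wp_conseq (@add_child_spec s1 Q1 h v c true n1 hv1 hc hcv _ _ _ _ _ _ _ _ _) (leqnn _) _; rewrite ?sz1 //.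
  move=> j x [_ g2] ex; rewrite ex /Q1 nth_rcons in g2; case: ltnP g2 => g3.
    by move=> g2; have /hnew := conj g3 g2.
  by case: eqP => [_ /rcons_inj []|_ /esym/eqP] //; rewrite -size_eq0 size_rcons.
1-6: by fr F1.
move=> s2 F2 [n2 t2 l2 c2].
set Q2 := rcons Q1 (rcons v (c, true)) in n2.
split; last by rewrite t2 hT -addn2 leq_addr.
exists Q2; rewrite size_rcons sz1; split=> //.
- split.
  + rewrite rcons_uniq hu1 andbT mem_rcons inE negb_or; apply/andP; split.
      by apply/eqP => /rcons_inj [].
    by apply/negP => /inQ' [j /hnew].
  + by rewrite !all_rcons !hvalid ha.
  + by do 2!apply: node_id_rcons.
  + move=> j u x [g1 g2]; move: g1 g2; rewrite size_rcons sz1 ltnS leq_eqVlt => /orP[/eqP->|].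
      rewrite nth_rcons sz1 ltnn eqxx => /rcons_inj [<- <-].
      by exists h; [do 2!apply: node_id_rcons | rewrite ltnSn eqxx orbT].
    rewrite ltnS leq_eqVlt => /orP[/eqP->|g1].
      rewrite nth_rcons sz1 ltnSn nth_rcons ltnn eqxx => /rcons_inj [<- <-].
      by exists h; [do 2!apply: node_id_rcons | rewrite ltnSn eqxx orbT].
    rewrite nth_rcons sz1 (leqW g1) nth_rcons g1 => g2.
    have [i hi hx] := hp _ _ _ (conj g1 g2); exists i; first by do 2!apply: node_id_rcons.
    by case/orP: hx => [->//|/andP[-> /ltnW hx]]; rewrite ltnS hx orbT.
- move=> j u c' b hj hc' hcu hcond; rewrite c2 c1'.
  have hju : j <= h by lia.
  have hjQ : node_id Q j u.
    case: hj => g1 g2; have g3 : j < size Q by apply: leq_ltn_trans hju hlt.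
    by move: g2; rewrite nth_rcons sz1 (leqW g3) nth_rcons g3.
  case: (boolP ((j < h) || ((j == h) && (c' < c)))) => hcond2.
    have e2 : (j * K + c' + (j * K + c') + b == h * K + c + (h * K + c) + 1) = false by apply/eqP; case: (b); nia.
    have e1 : (j * K + c' + (j * K + c') + b == h * K + c + (h * K + c)) = false by apply/eqP; case: (b); nia.
    by rewrite e1 e2; do 2!apply: node_id_rcons; apply: hch.
  have [ej ec] : j = h /\ c' = c by lia.
  have eu : u = v by case: hjQ => _ <-; rewrite ej.
  rewrite ej ec eu; case: (b); rewrite ?eqxx.
    by split; rewrite ?size_rcons ?sz1 // nth_rcons sz1 ltnn eqxx.
  rewrite addn0 eqxx; case: eqP => [|_]; first by lia.
  by apply: node_id_rcons.
Qed.

Lemma trie_inv_next h s : trie_inv h K s -> trie_inv h.+1 0 s.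
Proof.
move=> [Q [[hu ha hr hp] hn hch hT hL]]; exists Q; split=> //.
  split=> // j v x /hp [i hi hx]; exists i => //.
  by rewrite ltn0 andbF orbF ltnS leq_eqVlt orbC; case/orP: hx => [->//|/andP[-> _]]; rewrite orbT.
move=> j v c b hj hc hcv; rewrite ltn0 andbF orbF ltnS leq_eqVlt => hjh.
by apply: hch => //; rewrite hc andbT orbC.
Qed.

Definition full_trie (Q : seq state) (s : store) : Prop :=
  [/\ uniq Q, forall v, (v \in Q) = valid K v, node_id Q 0 [::], trie_nodes Q s &
      forall j v c (b : bool), node_id Q j v -> c < K -> c \notin cols v ->
        node_id Q (arr s aCh (j * K + c + (j * K + c) + b)) (rcons v (c, b))].

Lemma trie_spec s :
  reg s rK = K -> (forall c, c < K -> arr s aP4 c = 4 ^ c) ->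
  (forall a, a \in [:: aStat; aRv; aKey] -> arr s a = (fun _ => 0)) ->
  wp trie (state_bound K * (K * (K + K).+1).+1) s (fun s' =>
    exists Q, full_trie Q s' /\ reg s' rM = size Q).
Proof.
move=> hK hP h0; rewrite /trie; wrun; rewrite hK.
apply: (@wp_seq (state_bound K * (K * (K + K).+1).+1) 0); first by rewrite addn0.
(* The queue consists of distinct valid states, so its head moves at most [state_bound K] times. *)
apply: (@wp_while (fun k s1 => k = state_bound K - reg s1 rI /\ trie_inv (reg s1 rI) 0 s1 /\ reg s1 rI <= reg s1 rTail)
   (K * (K + K).+1) (state_bound K)) => /=.
- rewrite subn0; split=> //; split=> //; exists [:: [::]]; split=> //=; last by rewrite mul1n.
  + split=> //.
    by case=> [|j] v x [] //= _; case: (v).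
  + split=> //=.
    * by case=> // _; rewrite h0.
    * by case=> [|j] v c [] // _ /= <- _; rewrite h0.
    * by case=> [|j] v [] // _ /= <-; rewrite h0.
    * by case=> [|j] v c b [] //= _; case: (v).
  + by case=> [|j] v c b [] //; rewrite andbF.
- move=> k s1 F [-> [hI hle]] hne; wrun.
  set h := reg s1 rI in hI hle hne *.
  have hlt : h < reg s1 rTail by move: hne; rewrite -/h; lia.
  have hrow : arr s1 aRv h = h * K.
    by case: hI => Q [_ hn _ hT _]; apply: (trie_row hn); rewrite -hT.
  rewrite hrow.
  apply: (@wp_seq (K * (K + K).+1) 0); first by rewrite addn0.
  apply: (@wp_for (fun c s2 => trie_inv h c s2 /\ reg s1 rTail <= reg s2 rTail) (K + K) K) => //=.
  + by fr F; rewrite /= hK.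
  + split=> //; case: hI => Q [g1 g2 g3 g4 g5]; exists Q; split=> //=.
    by case: g2 => g2 g21 g22 g23; split.
  + move=> c s2 F2 hc hC [hI2 hle2]; wrun; fr F2; rewrite /= hC.
    apply: wp_conseq (@trie_step h c (set_reg s2 rX (h * K + c)) _ _ _ _ _ _ _ _ _) (leqnn _) _ => //=.
    * by case: hI2 => Q [g1 g2 g3 g4 g5]; exists Q; split=> //=; case: g2 => g2 g21 g22 g23; split.
    * exact: leq_trans hle2.
    * by fr F2; rewrite /=; fr F; rewrite /= hK.
    * by fr F2.
    * by fr F2.
    * by fr F2; rewrite /=; fr F; rewrite /= hP.
    move=> s3 F3 [hI3 hle3]; split; last by apply: leq_trans hle3; exact: hle2.
      by case: hI3 => Q [g1 g2 g3 g4 g5]; exists Q; split=> //=; case: g2 => g2 g21 g22 g23; split.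
  + move=> s2 F2 _ [hI2 hle2] _; wrun; fr F2; rewrite /= -/h addn1.
    have hT := trie_inv_tail hI2.
    exists (state_bound K - h.+1); first by lia.
    split=> //; split; last by lia.
    case: (trie_inv_next hI2) => Q [g1 g2 g3 g4 g5]; exists Q; split=> //=.
    by case: g2 => g2 g21 g22 g23; split.
- move=> k s1 F [_ [hI hle]] h1 F1; wrun.
  case: hI hle => Q [[hu ha hr hp] hn hch hT hL] hle; exists Q; split; last by rewrite /= hT.
  have hh : reg s1 rI = size Q by rewrite -hT; lia.
  have hn' : trie_nodes Q (set_reg s1 rM (reg s1 rTail)) by case: hn => g2 g21 g22 g23; split.
  have hch' j v c (b : bool) : node_id Q j v -> c < K -> c \notin cols v ->
      node_id Q (arr s1 aCh (j * K + c + (j * K + c) + b)) (rcons v (c, b)).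
    by move=> hj hc hcv; apply: hch => //; rewrite hh; case: hj => ->.
  split=> // v; apply/idP/idP; first exact: (allP ha).
  (* Completeness: dropping the last entry of a valid state leaves a valid state, and by now all
     children of every queued state have been created. *)
  elim/last_ind: v => [_|v [c b] IH]; first by case: hr => h2 <-; apply: mem_nth.
  rewrite valid_rcons => /and3P[/IH /(nthP [::]) [j g1 g2] hcv hc].
  by have [g3 <-] := hch' j v c b (conj g1 g2) hc hcv; apply: mem_nth.
- by [].
Qed.

Definition trie_maps_ok (Q : seq state) (s : store) (w : nat) : Prop :=
  forall j v c, j < w -> node_id Q j v -> c < K ->
    node_id Q (arr s aDel (j * K + c)) (del c v) /\ node_id Q (arr s aFlip (j * K + c)) (flip c v).

Lemma full_trie_frame Q c s s' : frame c s s' ->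
  all (fun a => a \notin warrs c) [:: aRv; aStat; aKey; aVc; aVb; aPar; aCh] ->
  full_trie Q s -> full_trie Q s'.
Proof.
move=> [_ Fa] /allP hc [h1 h2 h3 [g1 g2 g3 g4] h5]; split=> //.
  by split; move=> *; rewrite !Fa ?hc //; [apply: g1|apply: g2|apply: g3|apply: g4].
by move=> *; rewrite Fa ?hc //; apply: h5.
Qed.

Lemma full_trie_valid Q s j v : full_trie Q s -> node_id Q j v -> valid K v.
Proof. by case=> _ hv _ _ _ [h1 <-]; rewrite -hv mem_nth. Qed.

Lemma trie_maps_spec s Q :
  full_trie Q s -> reg s rM = size Q -> reg s rK = K ->
  arr s aDel = (fun _ => 0) -> arr s aFlip = (fun _ => 0) ->
  wp trie_maps (size Q * K.+1) s (fun s' => trie_maps_ok Q s' (size Q)).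
Proof.
move=> hfull hM hK hd hf; rewrite /trie_maps.
have [hu hval hroot [g1 g2 g3 g4] hch] := hfull.
apply: (@wp_for (fun w s1 => trie_maps_ok Q s1 w /\ (w = 0 -> forall c, arr s1 aDel c = 0 /\ arr s1 aFlip c = 0)) K (size Q)) => //=.
- by split=> [j v c|_ c]; rewrite ?ltn0 // hd hf.
- move=> w s1 F hw hW [hI hz]; apply: wp_if => /=; rewrite hW => hw0; last first.
    apply: wp_skip => /=; split=> // j v c; rewrite hw0 => hj; move: (hj); rewrite ltnS leqn0 => /eqP ej.
    have ev u : node_id Q j u -> u = [::] by rewrite ej => -[_ <-]; case: hroot.
    by move=> /ev-> hc; rewrite ej /=; have [-> ->] := hz hw0 (0 * K + c).
  wrun; fr F.
  set v := nth [::] Q w; have hv : node_id Q w v by [].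
  case/lastP ev : v hv => [|u [y b]] hv.
    by move: hw0; rewrite (node_id_inj hu hv hroot).
  have [ey eb hpw hu'] := g4 _ _ _ _ hv; rewrite hW ey eb.
  set p := arr s aPar w in hpw hu' *.
  have := full_trie_valid hfull hv; rewrite valid_rcons => /and3P[hvu hyu hyK].
  apply: (@wp_for (fun c s2 => trie_maps_ok Q s2 w /\
     forall e, e < c -> node_id Q (arr s2 aDel (w * K + e)) (del e (rcons u (y, b))) /\
        node_id Q (arr s2 aFlip (w * K + e)) (flip e (rcons u (y, b)))) 0 K) => //=.
  + by fr F; rewrite /= hK.
  + move=> c s2 F2 hc hC [hI2 hJ2]; wrun; fr F2; rewrite /=; fr F; rewrite hW hC !g1 //; last by case: hu'.
    have other j e : j < w -> e < K -> (j * K + e == w * K + c) = false by move=> *; apply/eqP; nia.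
    have [hdu hfu] := hI2 _ _ _ hpw hu' hc.
    have fin d f s3 : (forall x, arr s3 aDel x = if x == w * K + c then d else arr s2 aDel x) ->
        (forall x, arr s3 aFlip x = if x == w * K + c then f else arr s2 aFlip x) ->
        node_id Q d (del c (rcons u (y, b))) -> node_id Q f (flip c (rcons u (y, b))) ->
        trie_maps_ok Q s3 w /\ forall e, e < c.+1 -> node_id Q (arr s3 aDel (w * K + e)) (del e (rcons u (y, b))) /\
        node_id Q (arr s3 aFlip (w * K + e)) (flip e (rcons u (y, b))).
      move=> k1 k2 k3 k4; split; first by move=> j v' e hj hv' he; rewrite k1 k2 other //; apply: hI2.
      move=> e; rewrite ltnS leq_eqVlt k1 k2 eqn_add2l => /orP[/eqP->|lt]; first by rewrite eqxx.
      by rewrite (ltn_eqF lt); apply: hJ2.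
    apply: wp_if => /= hcy; wrun; fr F2; rewrite /=; fr F; rewrite /=.
      have {}hcy : c != y by move: hcy; fr F2; rewrite /= hC; apply: contraNneq => ->; rewrite !subnn.
      rewrite !g1; [| by case: hfu | by case: hdu].
      have e1 : node_id Q (arr s aCh (arr s2 aDel (p * K + c) * K + y + (arr s2 aDel (p * K + c) * K + y) + b))
           (del c (rcons u (y, b))).
        rewrite del_rcons eq_sym hcy; apply: hch => //.
        by rewrite cols_del mem_filter negb_and hyu orbT.
      have e2 : node_id Q (arr s aCh (arr s2 aFlip (p * K + c) * K + y + (arr s2 aFlip (p * K + c) * K + y) + b))
           (flip c (rcons u (y, b))).
        by rewrite flip_rcons eq_sym hcy; apply: hch => //; rewrite cols_flip.
      exact: (fin _ _ _ _ _ e1 e2).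
    have {}hcy : c = y by move: hcy; fr F2; rewrite /= hC; lia.
    rewrite !g1; last by case: hu'.
    have e3 : node_id Q (arr s aCh (p * K + y + (p * K + y))) (flip c (rcons u (y, b))).
      rewrite flip_rcons hcy eqxx /= flip_id; last by apply: contra hyu => /mem_cols.
      by have := hch _ _ _ false hu' hyK hyu; rewrite addn0.
    have e4 : node_id Q p (del c (rcons u (y, b))) by rewrite del_rcons hcy eqxx /= del_id.
    exact: (fin _ _ _ _ _ e4 e3).
  + move=> s2 F2 _ [hI2 hJ2]; split=> // j v' c; rewrite ltnS leq_eqVlt => /orP[/eqP->|lt]; last exact: hI2.
    by move=> [_ <-] hc; rewrite -/v ev; apply: hJ2.
  + by rewrite muln1.
- by move=> s1 F _ [].
Qed.

End Trie.

(** * Rules and initial tables *)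

Lemma table_rows_spec s N M q :
  reg s rG2 = N -> reg s rM = M -> reg s rQ = q ->
  wp table_rows N s (fun s' => forall i, i < N -> arr s' aTb i = i * M /\ arr s' aFb i = i * q).
Proof.
move=> hN hM hq; rewrite /table_rows; wrun.
apply: (@wp_for (fun j s1 => [/\ reg s1 rX = j * M, reg s1 rZ = j * q &
  forall i, i < j -> arr s1 aTb i = i * M /\ arr s1 aFb i = i * q]) 0 N) => //=.
- move=> j s1 F hj hJ [hx hz hi]; wrun; fr F; rewrite /= hx hz hM hq !mulSn [M + _]addnC [q + _]addnC; split=> //.
  move=> i; rewrite ltnS leq_eqVlt hJ => /orP[/eqP->|lt]; first by rewrite eqxx.
  by rewrite (ltn_eqF lt); apply: hi.
- by move=> s1 F _ [].
- by rewrite muln1.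
Qed.

(** The digits are the values of [label]. A head atom must be false (0) or the atom being derived
    (3), and only a head atom may have digit 3; positive body atoms must come earlier (2), negative
    ones must be false. Without a digit 3 the same test says that the rule is violated, so one table
    serves both purposes. *)
Definition digit_ok (h p q : bool) (d : nat) : bool :=
  [&& if h then (d == 0) || (2 < d) else d <= 2, p ==> (d == 2) & q ==> (d == 0)].

Definition digit (c key : nat) : nat := (key %/ 4 ^ c) %% 4.

(** Division by repeated subtraction: each call lowers the bound on the remainder by one multiple of
    [p], so three calls bring it from below [4 * p] to below [p] and leave the digit in [rD]. *)
Lemma next_digit_spec s p m z0 :
  reg s rP = p -> reg s rD * p + reg s rZ = z0 -> reg s rZ < m.+2 * p ->
  wp next_digit 0 s (fun s' => reg s' rD * p + reg s' rZ = z0 /\ reg s' rZ < m.+1 * p).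
Proof.
move=> hp hz hm; rewrite /next_digit.
by apply: wp_if => /=; rewrite hp => h; wrun; rewrite ?hp; split; nia.
Qed.

Lemma check_digit_spec s c d :
  reg s rC = c -> reg s rD = d ->
  wp check_digit 0 s (fun s' => reg s' rOk =
    if digit_ok (arr s aHd c != 0) (arr s aPs c != 0) (arr s aNg c != 0) d then reg s rOk else 0).
Proof.
move=> hc hd; rewrite /check_digit /digit_ok.
apply: wp_seq0; apply: (@wp_conseq _ 0 _ _ (fun s1 => reg s1 rOk =
  if (if arr s aHd c != 0 then (d == 0) || (2 < d) else d <= 2) then reg s rOk else 0)) => //.
  apply: wp_if => /=; rewrite hc => -> /=; apply: wp_if => /=; rewrite hd => h1.
  - apply: wp_if => /=; rewrite hd => h2; wrun.
    + by have -> : (d == 0) || (2 < d) = true by lia.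
    + by have -> : (d == 0) || (2 < d) = false by lia.
  - by wrun; rewrite h1.
  - by wrun; have -> : (d <= 2) = false by lia.
  - by wrun; have -> : (d <= 2) = true by lia.
move=> s1 F1 h1; apply: wp_seq0; apply: (@wp_conseq _ 0 _ _ (fun s2 => reg s2 rOk =
  if (arr s aPs c != 0) ==> (d == 2) then reg s1 rOk else 0)) => //.
  apply: wp_if => /=; fr F1; rewrite hc => ->; last by wrun.
  apply: wp_if => /=; fr F1; rewrite hd => h2; wrun.
    by have -> : (d == 2) = false by lia.
  by have -> : (d == 2) = true by lia.
move=> s2 F2 h2.
apply: wp_if => /=; fr F2; fr F1; rewrite hc => ->; last first.
  by wrun; rewrite h2 h1 /= andbT; case: (_ ==> (d == 2)); rewrite ?andbT ?andbF.
apply: wp_if => /=; fr F2; fr F1; rewrite hd => h3; wrun.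
  by rewrite (negPf h3) !andbF.
by rewrite h2 h1 h3 /=; case: (arr s aPs c != 0); case: (arr s aHd c != 0).
Qed.

Lemma digit_modn c key : (key %% 4 ^ c.+1) %/ 4 ^ c = digit c key.
Proof.
rewrite /digit {2}(divn_eq key (4 ^ c.+1)) expnS mulnA divnMDl ?expn_gt0 // modnMDl.
by rewrite [RHS]modn_small // ltn_divLR ?expn_gt0 // ltn_mod muln_gt0 expn_gt0.
Qed.

Section Rules.

Variables (n K : nat).
Implicit Types (X : {set 'I_n}) (r : rule 'I_n).

Definition fires (h p q : nat -> bool) (key : nat) : bool :=
  all (fun c => digit_ok (h c) (p c) (q c) (digit c key)) (iota 0 K).

Lemma check_key_spec s key :
  reg s rK = K -> reg s rY = key -> (forall c, c < K -> arr s aP4 c = 4 ^ c) -> key < 4 ^ K ->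
  wp check_key K s (fun s' => reg s' rOk =
    fires (fun c => arr s aHd c != 0) (fun c => arr s aPs c != 0) (fun c => arr s aNg c != 0) key).
Proof.
move=> hK hY hP hkey; rewrite /check_key; wrun.
pose ok c := digit_ok (arr s aHd c != 0) (arr s aPs c != 0) (arr s aNg c != 0) (digit c key).
apply: (@wp_for (fun e s1 => reg s1 rZ = key %% 4 ^ (K - e) /\ reg s1 rOk = all ok (iota (K - e) e)) 0 K) => //=.
- by rewrite subn0 modn_small ?hY.
- move=> e s1 F he hE [hz hok]; wrun; fr F; rewrite /= hK hE subn1 -subnS.
  have hc : K - e.+1 < K by lia.
  have hs : K - e = (K - e.+1).+1 by lia.
  set c := K - e.+1 in hc hs *; rewrite hP // in hz hok *.
  apply: wp_seq0; apply: wp_conseq (@next_digit_spec _ (4 ^ c) 2 (key %% 4 ^ c.+1) _ _ _) (leqnn _) _ => //=.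
  + by rewrite hz hs.
  + by rewrite hz hs -expnS ltn_mod expn_gt0.
  move=> s2 F2 [e2 l2]; apply: wp_seq0.
  apply: wp_conseq (@next_digit_spec _ (4 ^ c) 1 (key %% 4 ^ c.+1) _ _ _) (leqnn _) _ => //=; first by fr F2.
  move=> s3 F3 [e3 l3]; apply: wp_seq0.
  apply: wp_conseq (@next_digit_spec _ (4 ^ c) 0 (key %% 4 ^ c.+1) _ _ _) (leqnn _) _ => //=; first by fr F3; fr F2.
  move=> s4 F4 [e4 l4]; rewrite mul1n in l4.
  have hd : reg s4 rD = digit c key.
    by rewrite -digit_modn -e4 divnMDl ?expn_gt0 // divn_small // addn0.
  apply: wp_conseq (@check_digit_spec _ c (digit c key) _ hd) (leqnn _) _ => //=.
    by fr F4; fr F3; fr F2.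
  move=> s5 F5 h5; split.
    fr F5; have -> : reg s4 rZ = (key %% 4 ^ c.+1) %% 4 ^ c by rewrite -e4 modnMDl modn_small.
    by rewrite modn_dvdm // expnS dvdn_mull.
  rewrite h5; fr F4; fr F3; fr F2; rewrite /=; fr F; rewrite /= -/(ok c) hok hs.
  by case: (ok c).
- by move=> s1 F _ [_ ->]; rewrite subnn.
- by rewrite muln1.
Qed.

Definition has_col (col : nat -> nat) X c : bool := [exists a in X, col a == c.+1].

Lemma read_set_spec s a p X (mx : nat) :
  a \in [:: aHd; aPs; aNg] -> reg s rPtr = p -> set_at (arr s aIn) p X -> reg s rX = mx -> scard X <= K ->
  (forall x, x \in X -> 0 < arr s aCol x) ->
  wp (read_set a) K s (fun s' =>
    [/\ forall c, arr s' a c = if has_col (arr s aCol) X c then 1 else arr s a c,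
        reg s' rX = maxn mx (\max_(x in X) arr s aIntro x) & reg s' rPtr = p + (scard X).+1]).
Proof.
move=> hwa hp hset hX hcard hcol; rewrite /read_set; wrun.
have [e [he hw]] := hset.
have hsz : size e = scard X by rewrite (perm_size he) -cardE.
have hn0 : arr s aIn p = size e by rewrite (set_at_card hset).
have hee x : (x \in e) = (x \in X) by rewrite (perm_mem he) mem_enum.
have hin j x0 : j < size e -> arr s aIn (p.+1 + j) = nth x0 e j.
  by move=> hj; have := word_at_tail hw; rewrite /word_at => ->; rewrite ?size_map // (nth_map x0).
rewrite hp hn0 addn1.
apply: (@wp_seq K 0); first by rewrite addn0.
have ha x : x \notin [:: aHd; aPs; aNg] -> (x == a) = false.
  by move=> hx; apply: contraNF hx => /eqP->.
apply: (@wp_for (fun j s1 =>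
  [/\ forall x, x \notin [:: aHd; aPs; aNg] -> arr s1 x = arr s x,
      forall c, arr s1 a c = if has (fun x : 'I_n => arr s aCol x == c.+1) (take j e) then 1 else arr s a c
    & reg s1 rX = maxn mx (\max_(x <- take j e) arr s aIntro x)]) 0 (size e)) => //=.
- rewrite take0 big_nil maxn0; split=> //.
- move=> j s1 F hj hJ [hA hC hM]; wrun; fr F; rewrite /= hJ !hA //.
  have x0 : 'I_n by case: (e) hj => [|x0 l].
  rewrite (hin _ x0) //; set x := nth x0 e j.
  have hcx : 0 < arr s aCol x by apply: hcol; rewrite -hee; apply: mem_nth.
  have stepC c : (if c == arr s aCol x - 1 then 1 else arr s1 a c) =
     if has (fun x : 'I_n => arr s aCol x == c.+1) (take j.+1 e) then 1 else arr s a c.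
    rewrite (take_nth x0) // has_rcons -/x hC.
    have -> : (c == arr s aCol x - 1) = (arr s aCol x == c.+1) by apply/eqP/eqP; lia.
    by case: eqP.
  have stepM m : m = maxn (reg s1 rX) (arr s aIntro x) -> m = maxn mx (\max_(x <- take j.+1 e) arr s aIntro x).
    by move->; rewrite hM (take_nth x0) // -cats1 big_cat big_seq1 maxnA.
  have stepA y : y \notin [:: aHd; aPs; aNg] ->
      (fun j0 => if (y == a) && (j0 == arr s aCol x - 1) then 1 else arr s1 y j0) = arr s y.
    by move=> hy; rewrite (ha _ hy) /= hA.
  apply: wp_if => /=; rewrite ?(ha aIntro isT) /= ?(hA aIntro isT) => hm; wrun; rewrite ?(ha aIntro isT) /= ?(hA aIntro isT); split=> //.
  + by move=> c; rewrite eqxx /= stepC.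
  + by apply: stepM; lia.
  + by move=> c; rewrite eqxx /= stepC.
  + by apply: stepM; lia.
- move=> s1 F _ [hA hC hM] F1; wrun; fr F; rewrite /= hsz addSn addnS; split=> //.
    move=> c; rewrite hC take_size; congr (if _ then _ else _).
    apply/hasP/existsP => [[x h1 h2]|[x /andP[h1 h2]]]; exists x; rewrite ?hee // -?hee ?h1 //.
  rewrite hM take_size; congr maxn.
  by rewrite (perm_big _ he) big_enum.
- by rewrite muln1 hsz.
Qed.

Lemma clear_rule_spec s :
  reg s rK = K ->
  wp clear_rule K s (fun s' => forall c, c < K -> [/\ arr s' aHd c = 0, arr s' aPs c = 0 & arr s' aNg c = 0]).
Proof.
move=> hK; rewrite /clear_rule.
apply: (@wp_for (fun j s' => forall c, c < j -> [/\ arr s' aHd c = 0, arr s' aPs c = 0 & arr s' aNg c = 0]) 0 K) => //=.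
- move=> j s1 F hj hJ hI; wrun; rewrite hJ => c; rewrite ltnS leq_eqVlt => /orP[/eqP->|lt]; first by rewrite eqxx.
  by rewrite (ltn_eqF lt); apply: hI.
- by rewrite muln1.
Qed.

End Rules.

Section Fire.

Variables (n K : nat) (rs : seq (rule 'I_n)).
Implicit Types (r : rule 'I_n) (col intro : nat -> nat).

(** The one bag to which the rule is attached; that it contains all atoms of the rule is
    [home_bag]. *)
Definition home intro r : nat :=
  maxn (maxn (\max_(a in rhead r) intro a) (\max_(a in rpos r) intro a)) (\max_(a in rneg r) intro a).

Definition rule_fires col r (key : nat) : bool :=
  fires K (has_col col (rhead r)) (has_col col (rpos r)) (has_col col (rneg r)) key.

Lemma eq_fires (h p q h' p' q' : nat -> bool) key :
  (forall c, c < K -> [/\ h c = h' c, p c = p' c & q c = q' c]) ->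
  fires K h p q key = fires K h' p' q' key.
Proof.
move=> e; apply: eq_in_all => c; rewrite mem_iota add0n => hc.
by have [-> -> ->] := e c hc.
Qed.

Lemma rules_spec s N :
  reg s rK = K -> reg s rNr = size rs -> reg s rQ = 4 ^ K ->
  (forall j r0, j < size rs -> rule_at (arr s aIn) (rule_pos rs j) (nth r0 rs j)) ->
  (forall r, r \in rs -> [/\ scard (rhead r) <= K, scard (rpos r) <= K & scard (rneg r) <= K]) ->
  (forall r, r \in rs -> home (arr s aIntro) r < N /\ forall a, a \in rule_atoms r -> 0 < arr s aCol a) ->
  (forall c, c < K -> arr s aP4 c = 4 ^ c) ->
  (forall i, i < N -> arr s aFb i = i * 4 ^ K) ->
  arr s aFire = (fun _ => 0) ->
  wp rules (size rs * (4 * K + 4 ^ K * K.+1).+1) s (fun s' =>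
    forall i key, key < 4 ^ K ->
      (arr s' aFire (i * 4 ^ K + key) != 0) =
      has (fun r => (home (arr s aIntro) r == i) && rule_fires (arr s aCol) r key) rs).
Proof.
move=> hK hnr hQ hrs hcard hcol hP hfb h0; rewrite /rules; wrun.
apply: (@wp_for (fun j s1 => reg s1 rPtr = rule_pos rs j /\ forall i key, key < 4 ^ K ->
      (arr s1 aFire (i * 4 ^ K + key) != 0) =
      has (fun r => (home (arr s aIntro) r == i) && rule_fires (arr s aCol) r key) (take j rs))
   (4 * K + 4 ^ K * K.+1) (size rs)) => //=.
- by rewrite h0 /rule_pos !take0; split.
- move=> j s1 F hj hJ [hptr hI].
  pose r := nth (rule0 n) rs j; have hr : r \in rs by apply: mem_nth.
  have [ca cb cc] := hcard r hr.
  have [hhome hpos] := hcol r hr.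
  have [sa sb sc] : rule_at (arr s aIn) (rule_pos rs j) r by apply: hrs.
  have ein : arr s1 aIn = arr s aIn by fr F.
  have ecol : arr s1 aCol = arr s aCol by fr F.
  have eintro : arr s1 aIntro = arr s aIntro by fr F.
  apply: (@wp_seq K (3 * K + 4 ^ K * K.+1)); first by lia.
  apply: wp_conseq (@clear_rule_spec K s1 _) (leqnn _) _; first by fr F; rewrite /= hK.
  move=> s2 F2 hclear _; wrun.
  apply: (@wp_seq K (2 * K + 4 ^ K * K.+1)); first by lia.
  apply: wp_conseq (@read_set_spec n K (set_reg s2 rX 0) aHd (rule_pos rs j) (rhead r) 0 _ _ _ _ _ _) (leqnn _) _ => //=.
  + by fr F2; rewrite hptr.
  + by fr F2; rewrite ein.
  + by fr F2; rewrite ecol => x hx; apply: hpos; rewrite !inE hx.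
  move=> s3 F3 [a3 x3 p3] _.
  apply: (@wp_seq K (K + 4 ^ K * K.+1)); first by lia.
  apply: wp_conseq (@read_set_spec n K s3 aPs _ (rpos r) _ _ p3 _ x3 _ _) (leqnn _) _ => //=.
  + by fr F3; rewrite /=; fr F2; rewrite ein.
  + by fr F3; rewrite /=; fr F2; rewrite ecol => x hx; apply: hpos; rewrite !inE hx orbT.
  move=> s4 F4 [a4 x4 p4] _.
  apply: (@wp_seq K (4 ^ K * K.+1)); first by lia.
  apply: wp_conseq (@read_set_spec n K s4 aNg _ (rneg r) _ _ p4 _ x4 _ _) (leqnn _) _ => //=.
  + by fr F4; fr F3; rewrite /=; fr F2; rewrite ein.
  + by fr F4; fr F3; rewrite /=; fr F2; rewrite ecol => x hx; apply: hpos; rewrite !inE hx orbT.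
  move=> s5 F5 [a5 x5 p5] _; wrun.
  have hx : reg s5 rX = home (arr s aIntro) r.
    by rewrite x5 max0n /home; fr F4; fr F3; rewrite /=; fr F2; rewrite eintro.
  have hsets c : c < K -> [/\ (arr s5 aHd c != 0) = has_col (arr s aCol) (rhead r) c,
      (arr s5 aPs c != 0) = has_col (arr s aCol) (rpos r) c &
      (arr s5 aNg c != 0) = has_col (arr s aCol) (rneg r) c].
    move=> hc; have [z1 z2 z3] := hclear c hc; split.
    * by fr F5; fr F4; rewrite a3 /= z1; fr F2; rewrite ecol; case: (has_col _ _ _).
    * fr F5; rewrite a4; fr F3; rewrite /= z2; fr F2; rewrite ecol; by case: (has_col _ _ _).
    * rewrite a5; fr F4; fr F3; rewrite /= z3; fr F2; rewrite ecol; by case: (has_col _ _ _).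
  apply: (@wp_for (fun y s6 => forall i key, key < 4 ^ K ->
      (arr s6 aFire (i * 4 ^ K + key) != 0) =
      has (fun r => (home (arr s aIntro) r == i) && rule_fires (arr s aCol) r key) (take j rs)
      || [&& key < y, home (arr s aIntro) r == i & rule_fires (arr s aCol) r key]) K (4 ^ K)) => //=.
  + by fr F5; fr F4; fr F3; rewrite /=; fr F2; fr F; rewrite /= hQ.
  + by fr F5; fr F4; fr F3; rewrite /=; fr F2 => i key hk; rewrite orbF; apply: hI.
  + move=> y s6 F6 hy hY hI6.
    apply: (@wp_seq K 0); first by rewrite addn0.
    apply: wp_conseq (@check_key_spec K s6 y _ hY _ hy) (leqnn _) _.
    * by fr F6; rewrite /=; fr F5; fr F4; fr F3; rewrite /=; fr F2; fr F; rewrite /= hK.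
    * by fr F6; rewrite /=; fr F5; fr F4; fr F3; rewrite /=; fr F2; fr F; rewrite /=.
    move=> s7 F7 hok _.
    have hok' : reg s7 rOk = rule_fires (arr s aCol) r y.
      rewrite hok; congr nat_of_bool; fr F6; apply: eq_fires => c hc.
      exact: hsets.
    have hF : reg s7 rF = home (arr s aIntro) r * 4 ^ K.
      by fr F7; fr F6; rewrite /= hx; fr F5; fr F4; fr F3; rewrite /=; fr F2; fr F; rewrite /= hfb.
    have hY7 : reg s7 rY = y by fr F7.
    apply: wp_if => /=; rewrite hok' => hif; wrun; move=> i key hk.
      rewrite hF hY7; case: (eqVneq (i * 4 ^ K + key) (home (arr s aIntro) r * 4 ^ K + y)) => [e|/eqP ne].
        have [ei ek] := row_col_inj hk hy e.
        by rewrite ek ltnS leqnn ei eqxx; case: (rule_fires _ _ _) hif; rewrite ?orbT.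
      fr F7; rewrite hI6 // ltnS [key <= y]leq_eqVlt; congr (_ || _).
      case: (eqVneq key y) => [ek|] //=; rewrite ek ltnn /=.
      by apply/esym/negbTE; rewrite negb_and; apply/orP; left; apply/eqP => ei; apply: ne; rewrite ei ek.
    fr F7; rewrite hI6 // ltnS [key <= y]leq_eqVlt; congr (_ || _).
    case: (eqVneq key y) => [ek|] //=; rewrite ek ltnn /=.
    by case: (rule_fires _ _ _) hif; rewrite ?andbF.
  + move=> s6 F6 _ hI6; split.
      fr F6; rewrite /= p5 /rule_pos (take_nth (rule0 n)) // map_rcons sumn_rcons /rule_len -/r; lia.
    move=> i key hk; rewrite hI6 // hk /= (take_nth (rule0 n)) // has_rcons -/r orbC; congr (_ || _).
- by move=> s1 F _ [_ h]; rewrite take_size in h.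
Qed.

End Fire.

Definition key1 (w : state) : nat := sumn [seq 4 ^ x.1 | x <- w].

(* The key labels the colours of u by 2, the colour c by 3 and the colours of w by 1. *)
Definition entry_ok (fire usable : nat -> bool) (u : state) (c : nat) (b : bool) (w : state) : bool :=
  usable c && (b ==> fire (key2 u + (4 ^ c + (4 ^ c + (4 ^ c + key1 w))))).

(** Bits are claims: a set bit must be backed by a rule attached to this bag, whereas a clear bit
    asserts nothing. The second clause also forces every colour of [v] to be carried by an atom of
    the bag. *)
Definition init_ok (fire usable : nat -> bool) (v : state) : Prop :=
  ~~ fire (key2 v) /\ forall u c b w, v = u ++ (c, b) :: w -> entry_ok fire usable u c b w.

Section Init.

Variables (K : nat) (Q : seq state).

Lemma init_state_spec s j v a b :
  full_trie K Q s -> (forall c, c < K -> arr s aP4 c = 4 ^ c) ->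
  reg s rV = j -> node_id Q j v -> reg s rF = a -> reg s rB = b ->
  wp init_state K s (fun s' => reg s' rOk <= 1 /\
    (reg s' rOk != 0 <->
      init_ok (fun key => arr s aFire (a + key) != 0) (fun c => arr s aColat (b + c) != 0) v)).
Proof.
move=> hfull hP hV hv hF hB; rewrite /init_state; wrun.
have [hu hval hroot [g1 g2 g3 g4] hch] := hfull.
pose fire key := arr s aFire (a + key) != 0; pose usable c := arr s aColat (b + c) != 0.
apply: wp_seq0; apply: (@wp_conseq _ 0 _ _ (fun s1 => reg s1 rOk = ~~ fire (key2 v))) => //.
  by apply: wp_if => /=; rewrite hF hV (g3 _ _ hv) => h; wrun; rewrite /fire ?h.
move=> s1 F1 h1; wrun.
(* [u] is the part of the state still to be visited and [w] the suffix already checked. *)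
pose J u s2 := exists w, [/\ v = u ++ w, reg s2 rA = key1 w, reg s2 rOk <= 1 &
  reg s2 rOk != 0 <-> ~~ fire (key2 v) /\ forall u' c x w', v = u' ++ (c, x) :: w' -> size u <= size u' ->
     entry_ok fire usable u' c x w'].
apply: (@wp_while (fun k s2 => exists u, [/\ k = size u, node_id Q (reg s2 rX) u & J u s2]) 0 (size v)) => /=.
- exists v; split=> //; first by fr F1; rewrite /= hV.
  exists [::]; rewrite cats0; split=> //=; first by rewrite h1; case: (fire _).
  rewrite h1; case: (fire (key2 v)) => /=; split=> //; last first.
    by move=> _; split=> // u' c x w' e; rewrite e size_cat /= addnS ltnNge leq_addr.
  by case.
- move=> k s2 F [u [-> hX [w [ev hA hle hok]]]] hne.
  case/lastP eu : u hX ev hok => [|u2 [c x]] hX ev hok.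
    by rewrite (node_id_inj hu hX hroot) in hne.
  have [ec ex hlt hu2] := g4 _ _ _ _ hX.
  have hcK : c < K by have := full_trie_valid hfull hX; rewrite valid_rcons => /and3P[].
  have ecol : arr s2 aColat = arr s aColat by fr F; rewrite /=; fr F1.
  have efire : arr s2 aFire = arr s aFire by fr F; rewrite /=; fr F1.
  have eB : reg s2 rB = b by fr F; rewrite /=; fr F1.
  have eF : reg s2 rF = a by fr F; rewrite /=; fr F1.
  have evc : arr s2 aVc (reg s2 rX) = c by fr F; rewrite /=; fr F1; rewrite ec.
  have evb : arr s2 aVb (reg s2 rX) = x by fr F; rewrite /=; fr F1; rewrite ex.
  have epar : arr s2 aPar (reg s2 rX) = arr s aPar (reg s2 rX) by fr F; rewrite /=; fr F1.
  have ekey : arr s2 aKey = arr s aKey by fr F; rewrite /=; fr F1.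
  have ep4 : arr s2 aP4 c = 4 ^ c by fr F; rewrite /=; fr F1; rewrite hP.
  wrun; rewrite evc ep4 epar.
  set s3 := set_reg _ rP _.
  apply: wp_seq0; apply: (@wp_conseq _ 0 _ _ (fun s4 => reg s4 rOk = if usable c then reg s3 rOk else 0)) => //.
    by apply: wp_if => /=; rewrite eB ecol => h; wrun; rewrite /usable ?h //= (negPf _) //; apply/negPf.
  move=> s4 F4 h4; apply: wp_seq0.
  apply: (@wp_conseq _ 0 _ _ (fun s5 => reg s5 rOk = if entry_ok fire usable u2 c x w then reg s3 rOk else 0)) => //.
    rewrite /entry_ok; apply: wp_if => /=; fr F4; rewrite /s3 /= evb => hx; last first.
      by wrun; rewrite h4; case: (x) hx => //; rewrite andbT.
    have -> : x = true by case: (x) hx.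
    by apply: wp_if => /=; fr F4; rewrite /s3 /= eF efire ekey (g3 _ _ hu2) hA => h; wrun;
      rewrite ?h4 /fire /= ?h //= ?andbT ?andbF //; case: (usable c).
  move=> s5 F5 h5; wrun.
  exists (size u2); first by rewrite size_rcons.
  exists u2; split=> //; first by fr F5; fr F4; rewrite /s3 /=.
  exists ((c, x) :: w); split=> /=.
  + by rewrite ev cat_rcons.
  + by fr F5; fr F4; rewrite /s3 /= hA /key1 /= addnC.
  + by rewrite h5; case: ifP.
  have -> : (reg s5 rOk != 0) = entry_ok fire usable u2 c x w && (reg s2 rOk != 0).
    by rewrite h5; case: ifP.
  split.
    move=> /andP[he /hok [k1 k2]]; split=> // u' c' x' w' e.
    rewrite leq_eqVlt => /orP[/eqP es|lt]; last by apply: k2 e _; rewrite size_rcons.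
    have : u2 ++ (c, x) :: w = u' ++ (c', x') :: w' by rewrite -e ev cat_rcons.
    by move/eqP; rewrite eqseq_cat // => /andP[/eqP<- /eqP[<- <- <-]].
  move=> [k1 k2]; apply/andP; split.
    by apply: (k2 u2 c x w) => //; rewrite ev cat_rcons.
  by apply/hok; split=> // u' c' x' w' e le; apply: k2 e _; rewrite size_rcons in le; apply: ltnW.
- move=> k s2 F [u [_ hX [w [ev _ hle hok]]]] h0; split=> //.
  have eu : u = [::] by case: hX => _ <-; rewrite h0; case: hroot.
  apply: (iff_trans hok); split=> -[k1 k2]; split=> // u' c x w' e; first by apply: k2 e _; rewrite eu.
  by move=> _; apply: k2 e.
- by rewrite muln1; apply: valid_size; apply: full_trie_valid hfull hv.
Qed.

Lemma init_tables_spec s g N :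
  full_trie K Q s -> (forall c, c < K -> arr s aP4 c = 4 ^ c) ->
  reg s rM = size Q -> reg s rG1 = N -> N <= g ->
  (forall i, i < g -> arr s aTb i = i * size Q /\ arr s aFb i = i * 4 ^ K) ->
  (forall i, i < g -> arr s aRk i = i * K) ->
  wp init_tables (N * (size Q * K.+1).+1) s (fun s' =>
    forall i j v, i < N -> node_id Q j v ->
      arr s' aT (i * size Q + j) <= 1 /\
      (arr s' aT (i * size Q + j) != 0 <->
       init_ok (fun key => arr s aFire (i * 4 ^ K + key) != 0) (fun c => arr s aColat (i * K + c) != 0) v)).
Proof.
move=> hfull hP hM hG hNg htb hrk; rewrite /init_tables.
pose R i v x := x <= 1 /\ (x != 0 <->
  init_ok (fun key => arr s aFire (i * 4 ^ K + key) != 0) (fun c => arr s aColat (i * K + c) != 0) v).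
apply: (@wp_for (fun i s1 => forall i' j v, i' < i -> node_id Q j v -> R i' v (arr s1 aT (i' * size Q + j)))
  (size Q * K.+1) N) => //=.
- move=> i s1 F hi hI hR; wrun; rewrite hI; fr F.
  have [|-> ->] := htb i; first by lia.
  rewrite hrk; last by lia.
  apply: (@wp_for (fun j s2 => forall i' j' v, i' < i \/ i' = i /\ j' < j -> node_id Q j' v -> R i' v (arr s2 aT (i' * size Q + j')))
    K (size Q)) => //=.
  + by fr F; rewrite /= hM.
  + by move=> i' j' v [|[]] // hi' hj'; apply: hR.
  + move=> j s2 F2 hj hJ hR2.
    apply: (@wp_seq K 0); first by rewrite addn0.
    pose v := nth [::] Q j; have hv : node_id Q j v by [].
    apply: wp_conseq (@init_state_spec s2 j v (i * 4 ^ K) (i * K) _ _ hJ hv _ _) (leqnn _) _.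
    * apply: full_trie_frame F2 _ _ => //.
      have : full_trie K Q s1 by apply: full_trie_frame F _ _.
      by case=> m1 m2 m3 [m4 m5 m6 m7] m8; split.
    * by fr F2; rewrite /=; fr F.
    * by fr F2.
    * by fr F2.
    move=> s3 F3 hok _; wrun => i' j' v' hcond hv'.
    have eT : reg s3 rT = i * size Q by fr F3; fr F2.
    have eJ : reg s3 rV = j by fr F3.
    rewrite eT eJ.
    have efr : arr s2 aFire = arr s aFire by fr F2; rewrite /=; fr F.
    have ect : arr s2 aColat = arr s aColat by fr F2; rewrite /=; fr F.
    rewrite efr ect in hok.
    case: eqP => [e|ne].
      have [ei ej] := row_col_inj (proj1 hv') hj e.
      by rewrite ei (_ : v' = v) //; case: hv' => _ <-; rewrite ej.
    fr F3; apply: hR2 => //; case: hcond => [|[ei]]; first by left.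
    rewrite ltnS leq_eqVlt => /orP[/eqP ej|]; last by right.
    by case: ne; rewrite ei ej.
  + move=> s2 F2 _ h i' j' v; rewrite ltnS leq_eqVlt => /orP[/eqP->|lt] hj'; apply: h => //; [right; split=> //|by left].
    by case: hj'.
Qed.

End Init.

(** * Joining tables *)

Section UnionProduct.

Implicit Types (v u w : state) (A B F : state -> nat).

Definition mk (cs : seq nat) (p : nat -> bool) : state := [seq (c, p c) | c <- cs].
Definition tr v c : bool := (c, true) \in v.
Definition join u w : state := mk (cols u) (fun c => tr u c || tr w c).

Lemma cols_mk cs p : cols (mk cs p) = cs.
Proof. by rewrite /cols /unzip1 -map_comp map_id. Qed.

Lemma tr_mk cs p c : tr (mk cs p) c = (c \in cs) && p c.
Proof.
apply/mapP/andP => [[c' h [-> <-]]|[h1 h2]]; first by [].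
by exists c => //; rewrite h2.
Qed.

Lemma implyb_trans (a b c : bool) : a ==> b -> b ==> c -> a ==> c.
Proof. by case: a; case: b. Qed.

Lemma tr_cols v c : tr v c -> c \in cols v.
Proof. exact: mem_cols. Qed.

Lemma mk_tr v : uniq (cols v) -> mk (cols v) (tr v) = v.
Proof.
move=> hu; rewrite /mk /cols /unzip1 -map_comp -[RHS]map_id; apply/eq_in_map => -[c b] hx /=.
congr (_, _); rewrite /tr; case: b hx => hx; first by rewrite hx.
by apply/negP => h; have := uniq_bits hu h hx.
Qed.

Lemma state_ext u v : uniq (cols v) -> cols u = cols v -> (forall c, tr u c = tr v c) -> u = v.
Proof.
move=> hu hc ht; rewrite -(mk_tr hu) -(@mk_tr u) ?hc // /mk.
by apply/eq_map => c; rewrite ht.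
Qed.

Lemma tr_flip c v c' : tr (flip c v) c' = (c' != c) && tr v c'.
Proof.
apply/mapP/andP => [[[d b] h /= [-> e]]|[h1 h2]].
  by move/esym/andP: e => [-> hb]; rewrite /tr; move: h; rewrite hb.
by exists (c', true) => //=; rewrite h1.
Qed.

(** These states, obtained from [v] by clearing bits of colours less than [j], are the index set of
    the partial zeta sum after [j] passes ([zeta_sumE]). *)
Fixpoint below (j : nat) v : seq state :=
  if j is j'.+1 then below j' v ++ (if tr v j' then below j' (flip j' v) else [::]) else [:: v].

Lemma mem_below j v u : uniq (cols v) ->
  (u \in below j v) = [&& cols u == cols v, all (fun c => tr u c ==> tr v c) (cols v)
                        & all (fun c => (j <= c) ==> (tr v c ==> tr u c)) (cols v)].
Proof.
elim: j v => [|j IH] v hu /=.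
  rewrite inE; apply/eqP/and3P => [->|[/eqP h1 /allP h2 /allP h3]].
    by split=> //; apply/allP => c _; rewrite implybb ?implybT.
  apply: state_ext => // c; case: (boolP (c \in cols v)) => hc.
    by apply/idP/idP; apply/implyP; [apply: h2 | apply: (h3 c hc)].
  by apply/idP/idP => /tr_cols; rewrite ?h1 (negPf hc).
rewrite mem_cat IH //; case: (boolP (tr v j)) => hj; last first.
  rewrite in_nil orbF; congr [&& _, _ & _]; apply: eq_in_all => c hc.
  by rewrite leq_eqVlt; case: (eqVneq j c) => [<-|] //=; rewrite (negPf hj) implybT.
rewrite IH ?cols_flip // -andb_orr; case: (eqVneq (cols u) (cols v)) => //= hcu.
apply/orP/andP => [[/andP[h1 /allP h2]|/andP[/allP h1 /allP h2]]|[/allP h1 /allP h2]].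
- split=> //; apply/allP => c hc; apply/implyP => lt; apply: (implyP (h2 c hc)); exact: ltnW.
- split; apply/allP => c hc.
    by apply: implyb_trans (h1 c hc) _; rewrite tr_flip; apply/implyP => /andP[].
  apply/implyP => lt; have := implyP (h2 c hc) (ltnW lt).
  by rewrite tr_flip neq_ltn lt orbT.
case: (boolP (tr u j)) => huj; [left|right]; apply/andP; split; apply/allP => c hc.
- exact: h1.
- by apply/implyP; rewrite leq_eqVlt => /orP[/eqP<-|lt]; [rewrite huj implybT | apply: (implyP (h2 c hc))].
- rewrite tr_flip; case: eqP => [->|_] /=; last exact: h1.
  by rewrite (negPf huj).
- apply/implyP; rewrite tr_flip leq_eqVlt => /orP[/eqP<-|lt]; first by rewrite eqxx.
  by apply/implyP => /andP[_]; apply/implyP; apply: (implyP (h2 c hc)).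
Qed.

Lemma belowP K v u : valid K v ->
  (u \in below K v) = (cols u == cols v) && all (fun c => tr u c ==> tr v c) (cols v).
Proof.
move=> /andP[hu ha]; rewrite mem_below //; congr (_ && _).
rewrite -[RHS]andbT; congr (_ && _); apply/allP => c /(allP ha) lt.
by rewrite leqNgt lt.
Qed.

Lemma uniq_below j v : uniq (cols v) -> uniq (below j v).
Proof.
elim: j v => [|j IH] v hu //=; rewrite cat_uniq IH //=.
case: ifP => hj; last by [].
rewrite IH ?cols_flip // andbT; apply/hasPn => u; rewrite !mem_below ?cols_flip //.
move=> /and3P[_ /allP h1 _]; apply/negP => /and3P[_ _ /allP h2].
have hc := tr_cols hj.
have := h2 j hc; rewrite leqnn hj /= => huj.
by have := h1 j hc; rewrite huj tr_flip eqxx.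
Qed.

Lemma size_below j v : size (below j v) <= 2 ^ j.
Proof.
elim: j v => [|j IH] v //=; rewrite size_cat expnS mul2n -addnn leq_add //.
by case: ifP.
Qed.

Definition zstep (c : nat) A v : nat := A v + (if tr v c then A (flip c v) else 0).
Definition mstep (c : nat) F v : nat := F v - (if tr v c then F (flip c v) else 0).

Fixpoint zeta_sum (j : nat) A : state -> nat :=
  if j is j'.+1 then zstep j' (zeta_sum j' A) else A.

Lemma zeta_sumE j A v : zeta_sum j A v = \sum_(u <- below j v) A u.
Proof.
elim: j v => [|j IH] v /=; first by rewrite big_seq1.
by rewrite /zstep big_cat IH /=; case: ifP => _; rewrite ?IH ?big_nil.
Qed.

Lemma zeta_bound j A v : (forall u, A u <= 1) -> zeta_sum j A v <= 2 ^ j.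
Proof.
move=> h; rewrite zeta_sumE; apply: leq_trans (size_below j v).
by rewrite -sum1_size; apply: leq_sum.
Qed.

(** The entry subtracted belongs to [flip c v], whose bit at [c] is clear; [zstep c] left it
    unchanged, so exactly the summand added before is removed. *)
Lemma mstep_zstep c A v : mstep c (zstep c A) v = A v.
Proof.
rewrite /mstep /zstep; case: ifP => h; last by rewrite addn0 subn0.
by rewrite tr_flip eqxx addn0 addnK.
Qed.

(* Union product of two families of justified sets: the justified set of v is split, with overlap,
   between A and B. *)
Definition uprod K A B v : nat :=
  \sum_(p <- [seq (u, w) | u <- below K v, w <- below K v] | join p.1 p.2 == v) A p.1 * B p.2.

Lemma join_below K v u w : valid K v -> u \in below K v -> w \in below K v -> join u w \in below K v.
Proof.
move=> hv; rewrite !belowP // => /andP[/eqP hu /allP h1] /andP[_ /allP h2].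
rewrite cols_mk hu eqxx /=; apply/allP => c hc; rewrite tr_mk hu hc /=.
by apply/implyP => /orP[] h; [apply: (implyP (h1 c hc))|apply: (implyP (h2 c hc))].
Qed.

Lemma uniq_pairs (L : seq state) : uniq L -> uniq [seq (u, w) | u <- L, w <- L].
Proof. by move=> h; apply: allpairs_uniq => // -[a b] [c d] _ _ [-> ->]. Qed.

(** Expanding the product gives a sum over all pairs of states below [v]. Each pair has exactly one
    join, which again lies below [v], so grouping the pairs by their join yields the left side. *)
Lemma zeta_uprod K A B v : valid K v ->
  zeta_sum K (uprod K A B) v = zeta_sum K A v * zeta_sum K B v.
Proof.
move=> hv; have hu : uniq (cols v) by case/andP: hv.
rewrite !zeta_sumE big_distrlr /=.
pose L := [seq (u, w) | u <- below K v, w <- below K v].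
(* Pairs with join [w] may be drawn from below [v] instead of below [w], since both components lie
   below their join. *)
transitivity (\sum_(w <- below K v) \sum_(p <- L | join p.1 p.2 == w) A p.1 * B p.2).
  apply: eq_big_seq => w hw; rewrite /uprod -big_filter -[RHS]big_filter.
  have [/eqP hcw hlw] : cols w == cols v /\ all (fun c => tr w c ==> tr v c) (cols v).
    by move: hw; rewrite belowP // => /andP[].
  have hvw : valid K w by rewrite /valid hcw.
  have huw : uniq (cols w) by rewrite hcw.
  apply: perm_big; apply: uniq_perm.
  - by apply/filter_uniq/uniq_pairs/uniq_below.
  - by apply/filter_uniq/uniq_pairs/uniq_below.
  move=> [u1 u2]; rewrite !mem_filter /=; case: eqP => //= hj.
  have sub x : (x == u1) || (x == u2) -> cols u1 = cols v -> cols u2 = cols v ->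
      (x \in below K w) = (x \in below K v).
    move=> hx e1 e2; rewrite !belowP // hcw; congr (_ && _).
    apply/idP/idP => /allP h; apply/allP => c hc.
      by apply: implyb_trans (h c hc) _; apply: (allP hlw).
    apply/implyP => hxc; rewrite -hj tr_mk e1 hc /=.
    by case/orP: hx => /eqP<-; rewrite hxc ?orbT.
  apply/allpairsP/allpairsP => -[[x y] /= [hx hy [e1 e2]]]; subst x y; exists (u1, u2); split=> //=;
    move: hx hy; rewrite !belowP // ?hcw => /andP[/eqP c1 k1] /andP[/eqP c2 k2].
  - by have := sub u1; rewrite eqxx !belowP // hcw c1 eqxx /= => <-.
  - by have := sub u2; rewrite eqxx orbT !belowP // hcw c2 eqxx /= => <-.
  - by have := sub u1; rewrite eqxx !belowP // hcw c1 eqxx /= => ->.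
  - by have := sub u2; rewrite eqxx orbT !belowP // hcw c2 eqxx /= => ->.
rewrite (exchange_big_dep predT) //=.
rewrite (eq_big_seq (fun p => A p.1 * B p.2)); last first.
  move=> [u1 u2] /allpairsP[[x y] /= [hx hy [-> ->]]].
  have hj := join_below hv hx hy.
  rewrite (eq_bigl (fun w => w == join x y)); last by move=> w; rewrite eq_sym.
  by rewrite -big_filter filter_pred1_uniq ?uniq_below // big_seq1.
by rewrite big_allpairs.
Qed.

Lemma uprod_neq0 K A B v : valid K v ->
  uprod K A B v != 0 <-> exists u w, [/\ cols u = cols v, cols w = cols v, join u w = v, A u != 0 & B w != 0].
Proof.
move=> hv; rewrite /uprod; split.
  rewrite -lt0n lt0n sum_nat_seq_neq0 => /hasP[[u w]] /allpairsP[[x y] /= [hx hy [-> ->]]].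
  rewrite muln_eq0 negb_or => /and3P[/eqP hj h1 h2].
  by move: hx hy; rewrite !belowP // => /andP[/eqP e1 _] /andP[/eqP e2 _]; exists x, y.
move=> [u [w [e1 e2 hj h1 h2]]]; rewrite sum_nat_seq_neq0; apply/hasP; exists (u, w) => /=.
  apply/allpairsP; exists (u, w); split=> //=; rewrite belowP // ?e1 ?e2 eqxx /=; apply/allP => c hc;
    by apply/implyP => ht; rewrite -hj tr_mk e1 hc ht ?orbT.
by rewrite hj eqxx muln_eq0 negb_or h1 h2.
Qed.

End UnionProduct.

(** * In-place transforms and products of stored tables *)

Section Joins.

Variables (K : nat) (Q : seq state).
Implicit Types (v u w : state) (A B F : state -> nat).

Definition table (base : nat) F (s : store) : Prop :=
  forall j v, node_id Q j v -> arr s aT (base + j) = F v.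

Definition outside (base : nat) (s s' : store) : Prop :=
  forall x, (x < base) || (base + size Q <= x) -> arr s' aT x = arr s aT x.

Definition state_tables (s : store) : Prop :=
  [/\ full_trie K Q s, trie_maps_ok K Q s (size Q), reg s rM = size Q & reg s rK = K].

Lemma state_tables_frame c s s' : frame c s s' ->
  all (fun a => a \notin warrs c) [:: aRv; aStat; aKey; aVc; aVb; aPar; aCh; aDel; aFlip] ->
  all (fun x => x \notin wregs c) [:: rM; rK] ->
  state_tables s -> state_tables s'.
Proof.
move=> F ha hr [h1 h2 h3 h4]; have [Fr Fa] := F; split.
- apply: full_trie_frame F _ h1.
  by move: ha; rewrite (all_cat _ [:: aRv; aStat; aKey; aVc; aVb; aPar; aCh] [:: aDel; aFlip]) => /andP[].
- by move=> j v c' hj hv hc; rewrite !Fa ?(allP ha) //; apply: h2.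
- by rewrite Fr // (allP hr).
- by rewrite Fr // (allP hr).
Qed.

Lemma state_tables_upd s s' :
  (forall a, a \in [:: aRv; aStat; aKey; aVc; aVb; aPar; aCh; aDel; aFlip] -> arr s' a = arr s a) ->
  reg s' rM = reg s rM -> reg s' rK = reg s rK -> state_tables s -> state_tables s'.
Proof.
move=> ha hM hK [[g1 g2 g3 [k1 k2 k3 k4] g5] h2 h3 h4]; split; rewrite ?hM ?hK //.
  split=> //; last by move=> *; rewrite ha //; apply: g5.
  by split; move=> *; rewrite !ha //; [apply: k1|apply: k2|apply: k3|apply: k4].
by move=> *; rewrite !ha //; apply: h2.
Qed.

Lemma node_valid s j v : state_tables s -> node_id Q j v -> valid K v.
Proof. by case=> h _ _ _; apply: full_trie_valid h. Qed.

(** Common form of the inner loops of [zeta] and [moebius], convertible to both. Working in place is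
    sound: the entry read besides the current one has bit [c] clear, and such entries do not change
    during the pass. *)
Definition pass (op : expr -> expr -> expr) (r : nat) : cmd :=
  For rV rM
    (Seq (Assign rX (Plus (Get aRv (Reg rV)) (Reg rC)))
       (If (Minus (Get aStat (Reg rX)) (Const 1))
          (Put aT (Plus (Reg r) (Reg rV))
             (op (Get aT (Plus (Reg r) (Reg rV))) (Get aT (Plus (Reg r) (Get aFlip (Reg rX)))))) Skip)).

Lemma pass_spec op f r s c base F :
  (forall s e1 e2, eval s (op e1 e2) = f (eval s e1) (eval s e2)) ->
  r \notin [:: rV; rX] -> state_tables s -> reg s rC = c -> c < K -> reg s r = base -> table base F s ->
  wp (pass op r) (size Q) s (fun s' =>
    table base (fun v => if tr v c then f (F v) (F (flip c v)) else F v) s' /\ outside base s s').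
Proof.
move=> hop hr hst hC hc hB hF.
have [hfull hmaps hM hK] := hst.
have [hu hval hroot [g1 g2 g3 g4] hch] := hfull.
pose G v := if tr v c then f (F v) (F (flip c v)) else F v.
apply: (@wp_for (fun j s1 => (forall i v, node_id Q i v -> arr s1 aT (base + i) = if i < j then G v else F v) /\
   outside base s s1) 0 (size Q)) => //=.
- move=> j s1 Fr hj hJ [hI hO]; wrun; fr Fr.
  pose v := nth [::] Q j; have hv : node_id Q j v by [].
  have eBase : reg s1 r = base.
    by rewrite (proj1 Fr) ?hB //= ?inE; move: hr; rewrite !inE !negb_or => /andP[-> ->].
  have eX y : (if r == rX then y else reg s1 r) = base.
    by move: hr; rewrite !inE !negb_or eBase => /andP[_ /negPf->].
  rewrite hJ hC g1 //.
  apply: wp_if => /=; fr Fr; rewrite (g2 _ _ _ hv hc) => hif.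
    have ht : tr v c by rewrite /tr -stat2; lia.
    wrun; rewrite hop /= eX hJ; fr Fr.
    have [_ hfl] := hmaps _ _ _ hj hv hc.
    rewrite (hI _ _ hv) ltnn (hI _ _ hfl).
    have -> : (if arr s aFlip (j * K + c) < j then G (flip c v) else F (flip c v)) = F (flip c v).
      by rewrite /G tr_flip eqxx; case: ifP.
    split.
      move=> i u hi; rewrite eqn_add2l; case: (eqVneq i j) => [ei|ne].
        have -> : u = v by case: hi => _ <-; rewrite ei.
        by rewrite ei ltnSn /G ht.
      by rewrite (hI _ _ hi) ltnS [i <= j]leq_eqVlt (negPf ne).
    move=> x hx /=; case: eqP => [ex|_]; last exact: hO.
    by move: hx; rewrite ex; slia.
  have ht : tr v c = false by apply/negP; rewrite /tr -stat2; lia.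
  wrun; split=> // i u hi; rewrite ltnS [i <= j]leq_eqVlt; case: (eqVneq i j) => [ei|ne]; last exact: hI.
  have -> : u = v by case: hi => _ <-; rewrite ei.
  by rewrite ei (hI _ _ hv) ltnn /G ht.
- move=> s1 Fr _ [h1 h2]; split=> // i v hi; rewrite (h1 _ _ hi); by case: hi => ->.
- by rewrite muln1.
Qed.

Lemma zeta_spec r s base A :
  r \notin [:: rV; rX; rC] -> state_tables s -> reg s r = base -> table base A s ->
  wp (zeta r) (K * (size Q).+1) s (fun s' => table base (zeta_sum K A) s' /\ outside base s s').
Proof.
move=> hr hst hB hA.
have hr2 : r \notin [:: rV; rX] by move: hr; rewrite !inE !negb_or => /and3P[-> -> _].
apply: (@wp_for (fun j s1 => table base (zeta_sum j A) s1 /\ outside base s s1) (size Q) K) => //=.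
- by case: hst.
- move=> j s1 Fr hj hJ [hI hO].
  have eBase : reg s1 r = base.
    rewrite (proj1 Fr) ?hB //= ?inE; move: hr; rewrite !inE !negb_or => /and3P[-> -> ->] //.
  apply: wp_conseq (@pass_spec Plus addn r s1 j base (zeta_sum j A) _ hr2 _ hJ hj eBase hI) (leqnn _) _ => //.
    exact: state_tables_frame Fr _ _ hst.
  move=> s2 F2 [h1 h2]; split.
    move=> i v hi /=; rewrite (h1 _ _ hi) /zstep; case: ifP => // _; by rewrite addn0.
  by move=> x hx /=; rewrite h2 // hO.
Qed.

(** The zeta passes are undone in reverse order of colours, so that each pass meets the outermost
    [zstep] of the remaining partial transform. *)
Lemma moebius_spec r s base A :
  r \notin [:: rV; rX; rC; rE] -> state_tables s -> reg s r = base -> table base (zeta_sum K A) s ->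
  wp (moebius r) (K * (size Q).+1) s (fun s' => table base A s' /\ outside base s s').
Proof.
move=> hr hst hB hA.
have hr2 : r \notin [:: rV; rX] by move: hr; rewrite !inE !negb_or => /and4P[-> -> _].
apply: (@wp_for (fun j s1 => table base (zeta_sum (K - j) A) s1 /\ outside base s s1) (size Q) K) => //=.
- by case: hst.
- by rewrite subn0; split.
- move=> j s1 Fr hj hJ [hI hO].
  have eBase : reg s1 r = base.
    rewrite (proj1 Fr) ?hB //= ?inE; move: hr; rewrite !inE !negb_or => /and4P[-> -> -> ->] //.
  have eK : reg s1 rK = K by fr Fr; case: hst.
  wrun; rewrite eK hJ subn1 -subnS.
  have hs : K - j = (K - j.+1).+1 by lia.
  set s2 := set_reg _ _ _.
  have st2 : state_tables s2.
    by apply: (@state_tables_upd s1) => //; apply: state_tables_frame Fr _ _ hst.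
  have eB2 : reg s2 r = base.
    by rewrite /s2 /=; move: hr; rewrite !inE !negb_or => /and4P[_ _ /negPf-> _].
  apply: wp_conseq (@pass_spec Minus subn r s2 (K - j.+1) base (zeta_sum (K - j) A) _ hr2 st2 _ _ eB2 hI) (leqnn _) _ => //.
    lia.
  move=> s3 F3 [h1 h2]; split.
    move=> i v hi /=; rewrite (h1 _ _ hi) hs -[RHS](mstep_zstep (K - j.+1)) /mstep /=.
    by case: ifP => // _; rewrite subn0.
  by move=> x hx /=; rewrite h2 // hO.
- by move=> s1 Fr _; rewrite subnn.
Qed.

Lemma multiply_spec s bt bb A B W :
  state_tables s -> reg s rT = bt -> reg s rB = bb -> bt + size Q <= bb ->
  table bt A s -> table bb B s ->
  (forall a b, a < W -> b < W -> arr s aProd (arr s aRow a + b) = a * b) ->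
  (forall v, A v < W) -> (forall v, B v < W) ->
  wp multiply (size Q) s (fun s' => table bt (fun v => A v * B v) s' /\ outside bt s s').
Proof.
move=> [_ _ hM _] hT hB hdis hA hB2 hP wA wB.
apply: (@wp_for (fun j s1 => (forall i v, node_id Q i v -> arr s1 aT (bt + i) = if i < j then A v * B v else A v) /\
   outside bt s s1) 0 (size Q)) => //=.
- move=> j s1 Fr hj hJ [hI hO]; wrun; fr Fr; rewrite hT hB hJ.
  have hv : node_id Q j (nth [::] Q j) by [].
  rewrite (hI _ _ hv) ltnn hO; last by slia.
  rewrite (hB2 _ _ hv) hP //; split.
    move=> i u hi; rewrite eqn_add2l; case: (eqVneq i j) => [ei|ne].
      by rewrite ei ltnSn; case: hi => _ <-; rewrite ei.
    by rewrite (hI _ _ hi) ltnS [i <= j]leq_eqVlt (negPf ne).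
  move=> x hx /=; case: eqP => [ex|_]; last exact: hO.
  by move: hx; rewrite ex; slia.
- move=> s1 Fr _ [h1 h2]; split=> // i v hi; rewrite (h1 _ _ hi); by case: hi => ->.
- by rewrite muln1.
Qed.

Lemma normalise_spec s bt A :
  state_tables s -> reg s rT = bt -> table bt A s ->
  wp normalise (size Q) s (fun s' => table bt (fun v => (A v != 0)) s' /\ outside bt s s').
Proof.
move=> [_ _ hM _] hT hA.
apply: (@wp_for (fun j s1 => (forall i v, node_id Q i v -> arr s1 aT (bt + i) = if i < j then nat_of_bool (A v != 0) else A v) /\
   outside bt s s1) 0 (size Q)) => //=.
- move=> j s1 Fr hj hJ [hI hO].
  have hv : node_id Q j (nth [::] Q j) by [].
  apply: wp_if => /=; fr Fr; rewrite hT hJ (hI _ _ hv) ltnn => hif; wrun; fr Fr; rewrite ?hT ?hJ; split=> //.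
  + move=> i u hi; rewrite eqn_add2l; case: (eqVneq i j) => [ei|ne].
      by rewrite ei ltnSn; case: hi => _ <-; rewrite ei hif.
    by rewrite (hI _ _ hi) ltnS [i <= j]leq_eqVlt (negPf ne).
  + move=> x hx /=; case: eqP => [ex|_]; last exact: hO.
    by move: hx; rewrite ex; slia.
  + move=> i u hi; case: (eqVneq i j) => [ei|ne].
      have -> : u = nth [::] Q j by case: hi => _ <-; rewrite ei.
      by rewrite ei ltnSn (hI _ _ hv) ltnn hif.
    by rewrite (hI _ _ hi) ltnS [i <= j]leq_eqVlt (negPf ne).
- move=> s1 Fr _ [h1 h2]; split=> // i v hi; rewrite (h1 _ _ hi); by case: hi => ->.
- by rewrite muln1.
Qed.

Lemma shared_spec s ri rp :
  reg s rK = K -> arr s aRk (reg s rI) = ri -> arr s aRk (reg s rP) = rp ->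
  wp shared K s (fun s' => forall c, c < K ->
    (arr s' aSh c != 0) = (arr s aColat (ri + c) == arr s aColat (rp + c))).
Proof.
move=> hK hi hp; apply: (@wp_for (fun j s1 => forall c, c < j ->
    (arr s1 aSh c != 0) = (arr s aColat (ri + c) == arr s aColat (rp + c))) 0 K) => //=.
- move=> j s1 F hj hJ hI; wrun; fr F; rewrite hi hp hJ.
  apply: wp_if => /= hif; wrun; rewrite hJ => c; rewrite ltnS leq_eqVlt => /orP[/eqP->|lt].
  + by rewrite eqxx; apply/esym/negbTE; apply/eqP => e; move: hif; rewrite e !subnn.
  + by rewrite (ltn_eqF lt); apply: hI.
  + by rewrite eqxx (_ : arr s aColat (ri + j) = arr s aColat (rp + j)) ?eqxx //; lia.
  + by rewrite (ltn_eqF lt); apply: hI.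
- by rewrite muln1.
Qed.

End Joins.

(** * Projection to the colours shared with the parent *)

Section Projections.

Variables (K : nat) (Q : seq state).
Implicit Types (v u w : state) (A B F : state -> nat) (sh : nat -> bool).

Definition proj sh v : state := [seq x <- v | sh x.1].
Definition unshared sh (b : bool) v : bool := all (fun x => sh x.1 || (x.2 == b)) v.

Lemma statE v c (b : bool) : uniq (cols v) -> (stat v c == b.+1) = ((c, b) \in v).
Proof.
move=> hu; case: b; last exact: stat1.
by rewrite -stat2 /stat; case: ifP => // _; case: ifP.
Qed.

(** Bit [b] is stored in [aStat] as status [b + 1]; refusing this status for unshared colours
    requires the opposite bit there. *)
Lemma project_spec s j v (b : bool) sh :
  state_tables K Q s -> reg s rV = j -> node_id Q j v -> reg s rBad = b.+1 ->
  (forall c, c < K -> (arr s aSh c != 0) = sh c) ->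
  wp project K s (fun s' => node_id Q (reg s' rU) (proj sh v) /\ (reg s' rOk != 0) = unshared sh (~~ b) v).
Proof.
move=> hst hV hv hb hsh; rewrite /project; wrun.
have [hfull hmaps hM hK] := hst.
have [hu hval hroot [g1 g2 g3 g4] hch] := hfull.
have /andP[huv /allP hvK] : valid K v by apply: node_valid hst hv.
apply: (@wp_for (fun e s1 => node_id Q (reg s1 rU) [seq x <- v | (e <= x.1) || sh x.1] /\
   (reg s1 rOk != 0) = all (fun x => [|| e <= x.1, sh x.1 | x.2 == ~~ b]) v) 0 K) => //=.
- rewrite hV filter_predT; split=> //; apply/esym/allP => x //.
- move=> e s1 F he hE [hI hO]; apply: wp_if => /=; fr F; rewrite hE => hif.
    have {}hif : sh e by rewrite -hsh.
    wrun; have eP x : (e < x) || sh x = (e <= x) || sh x.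
      by rewrite [e <= x]leq_eqVlt; case: eqP => // <-; rewrite hif orbT.
    split; first by rewrite (eq_filter (a2 := fun x => (e <= x.1) || sh x.1)).
    by rewrite hO; apply: eq_all => x; rewrite !orbA eP.
  have {}hif : sh e = false by rewrite -hsh // hif.
  wrun; fr F; rewrite /= hV hE (g1 j) ?(g2 _ _ _ hv) //; last by case: hv.
  apply: wp_seq0; apply: (@wp_conseq _ 0 _ _ (fun s2 => (reg s2 rOk != 0) =
     (reg s1 rOk != 0) && ((e, b) \notin v))) => //.
    apply: wp_if => /=; fr F; rewrite /= hb -statE // => h; wrun.
      by have -> : (stat v e == b.+1) = false by [lia]; rewrite andbT.
    by have -> : (stat v e == b.+1) = true by [lia]; rewrite andbF.
  move=> s2 F2 h2; wrun; fr F2; rewrite /=; fr F; rewrite /= hE g1; last by case: hI.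
  split.
    have [hd _] := hmaps _ _ _ (proj1 hI) hI he.
    rewrite (_ : [seq x <- v | (e < x.1) || sh x.1] = del e [seq x <- v | (e <= x.1) || sh x.1]) //.
    rewrite /del -filter_predI; apply: eq_filter => x /=.
    by rewrite [e <= _]leq_eqVlt [e == _]eq_sym; case: eqP => //= ->; rewrite ltnn hif.
  rewrite h2 hO; apply/andP/allP => [[/allP h3 h4] x hx|h3].
    have := h3 x hx; rewrite leq_eqVlt; case: eqP => //= ex _.
    apply/orP; right; apply/orP; right; case: x hx ex => [c b'] /= hx ec; rewrite -ec in hx.
    by move: h4 hx; case: (b); case: (b') => // /negPf->.
  split.
    apply/allP => x hx; have := h3 x hx; by case/or3P => [/ltnW->|->|->]; rewrite ?orbT.
  by apply/negP => h4; have := h3 _ h4; rewrite /= ltnn hif; case: (b).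
- move=> s1 F _ [h1 h2]; split.
    rewrite /proj -(eq_in_filter (a1 := fun x => (K <= x.1) || sh x.1)) // => x hx.
    by rewrite leqNgt hvK //; apply: map_f.
  rewrite h2; apply: eq_in_all => x hx.
  by rewrite leqNgt hvK //; apply: map_f.
- by rewrite muln1.
Qed.

Lemma project_child_spec s ba F sh :
  state_tables K Q s -> reg s rA = ba -> table Q ba F s ->
  (forall c, c < K -> (arr s aSh c != 0) = sh c) ->
  wp project_child (size Q * K.+2) s (fun s' => forall j u, node_id Q j u ->
     arr s' aS j <= 1 /\ (arr s' aS j != 0 <-> exists v, [/\ valid K v, F v != 0, unshared sh true v & proj sh v = u])).
Proof.
move=> hst hA hF hsh; rewrite /project_child.
have [hfull hmaps hM hK] := hst.
have [hu hval hroot [g1 g2 g3 g4] hch] := hfull.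
apply: (@wp_seq (size Q) (size Q * K.+1)); first by nia.
apply: (@wp_for (fun j s1 => forall i, i < j -> arr s1 aS i = 0) 0 (size Q)) => //=.
- move=> j s1 Fr hj hJ hI; wrun; rewrite hJ => i; rewrite ltnS leq_eqVlt => /orP[/eqP->|lt].
    by rewrite eqxx.
  by rewrite (ltn_eqF lt) hI.
- move=> s1 Fr _ h0 F1; wrun.
  apply: (@wp_for (fun j s2 => forall i u, node_id Q i u -> arr s2 aS i <= 1 /\
    (arr s2 aS i != 0 <-> exists j' v, [/\ j' < j, node_id Q j' v, F v != 0, unshared sh true v & proj sh v = u])) K (size Q)) => //=.
  + by fr F1.
  + move=> i u [hi _]; rewrite h0 //; split=> //; split=> // -[j' [v [] //]].
  + move=> j s2 F2 hj hJ hI.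
    pose v := nth [::] Q j; have hv : node_id Q j v by [].
    have st2 : state_tables K Q s2.
      apply: (state_tables_frame F2) => //; apply: (@state_tables_upd _ _ s1) => //.
      exact: (state_tables_frame F1).
    have eT : arr s2 aT (reg s2 rA + reg s2 rV) = F v.
      by rewrite hJ; fr F2; rewrite /=; fr F1; rewrite hA (hF _ _ hv).
    have keep s3 : (forall i, arr s3 aS i = arr s2 aS i) -> ~~ ((F v != 0) && unshared sh true v) ->
      forall i u, node_id Q i u -> arr s3 aS i <= 1 /\
       (arr s3 aS i != 0 <-> exists j' v, [/\ j' < j.+1, node_id Q j' v, F v != 0, unshared sh true v & proj sh v = u]).
      move=> hs hn i u hi; rewrite hs; have [k1 k2] := hI i u hi; split=> //; rewrite k2; split.
        by move=> [j' [v' [m1 m2 m3 m4 m5]]]; exists j', v'; split=> //; apply: leqW.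
      move=> [j' [v' [m1 m2 m3 m4 m5]]]; exists j', v'; split=> //.
      move: m1; rewrite ltnS leq_eqVlt => /orP[/eqP ej|//].
      by move: hn; rewrite (_ : v = v') ?m3 ?m4 //; case: m2 => _ <-; rewrite ej.
    apply: wp_if => /=; rewrite eT => hif; last by wrun; apply: keep; rewrite ?hif.
    apply: (@wp_seq K 0); first by rewrite addn0.
    apply: wp_conseq (@project_spec s2 j v false sh st2 hJ hv _ _) (leqnn _) _.
    * by fr F2.
    * by move=> c hc; fr F2; rewrite /=; fr F1; apply: hsh.
    move=> s3 F3 [hU hOk] _; rewrite /= in hOk; apply: wp_if => /= hif2; last first.
      have hvu : unshared sh true v = false by rewrite -hOk hif2.
      by wrun; apply: keep => [i|]; [fr F3 | rewrite hvu andbF].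
    have hvu : unshared sh true v by rewrite -hOk.
    wrun => i u hi; fr F3; have [k1 k2] := hI i u hi.
    case: eqP => [ei|ne].
      split=> //; split=> // _; exists j, v; split=> //.
      by case: hU hi => _ <- [_ <-]; rewrite ei.
    split=> //; rewrite k2; split.
      by move=> [j' [v' [m1 m2 m3 m4 m5]]]; exists j', v'; split=> //; apply: leqW.
    move=> [j' [v' [m1 m2 m3 m4 m5]]]; exists j', v'; split=> //.
    move: m1; rewrite ltnS leq_eqVlt => /orP[/eqP ej|//].
    have ev : v' = v by case: m2 => _ <-; rewrite ej.
    by case: ne; apply: (node_id_inj hu hi); rewrite -m5 ev.
  + move=> s2 F2 _ hI j u hj; have [k1 k2] := hI j u hj; split=> //; rewrite k2; split.
      move=> [j' [v [m1 m2 m3 m4 m5]]]; exists v; split=> //; exact: node_valid hst m2.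
    move=> [v [m1 m2 m3 m4]]; exists (index v Q), v.
    have hvQ : v \in Q by rewrite hval.
    by split=> //; [rewrite index_mem | split; rewrite ?index_mem // nth_index].
- by rewrite muln1.
Qed.

Lemma extend_parent_spec s bb G sh :
  state_tables K Q s -> reg s rB = bb ->
  (forall j u, node_id Q j u -> arr s aS j = G u) ->
  (forall c, c < K -> (arr s aSh c != 0) = sh c) ->
  wp extend_parent (size Q * K.+1) s (fun s' =>
    table Q bb (fun v => if unshared sh false v then G (proj sh v) else 0) s' /\ outside Q bb s s').
Proof.
move=> hst hB hG hsh; rewrite /extend_parent; wrun.
have [hfull hmaps hM hK] := hst.
pose H v := if unshared sh false v then G (proj sh v) else 0.
apply: (@wp_for (fun j s1 => (forall i v, i < j -> node_id Q i v -> arr s1 aT (bb + i) = H v) /\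
   outside Q bb s s1) K (size Q)) => //=.
- move=> j s1 F hj hJ [hI hO].
  pose v := nth [::] Q j; have hv : node_id Q j v by [].
  have st1 : state_tables K Q s1.
    by apply: (state_tables_frame F) => //; apply: (@state_tables_upd _ _ s).
  apply: (@wp_seq K 0); first by rewrite addn0.
  apply: wp_conseq (@project_spec s1 j v true sh st1 hJ hv _ _) (leqnn _) _.
  + by fr F.
  + by move=> c hc; fr F; apply: hsh.
  move=> s2 F2 [hU hOk] _.
  have fin s3 : (forall x, arr s3 aT x = if x == bb + j then H v else arr s1 aT x) ->
     (forall i u, i < j.+1 -> node_id Q i u -> arr s3 aT (bb + i) = H u) /\ outside Q bb s s3.
    move=> h3; split.
      move=> i u hi hiu; rewrite h3 eqn_add2l; case: eqP => [ei|ne].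
        by case: hiu => _ <-; rewrite ei.
      by apply: hI => //; move: hi; rewrite ltnS leq_eqVlt => /orP[/eqP|].
    move=> x hx; rewrite h3; case: eqP => [ex|_]; last exact: hO.
    by move: hx; rewrite ex; slia.
  rewrite /= in hOk.
  apply: wp_if => /= hif; apply: wp_put; apply: fin => x /=; fr F2; rewrite /=; fr F; rewrite /= hB hJ /H.
    have -> : unshared sh false v by rewrite -hOk.
    by rewrite (hG _ _ hU).
  by have -> : unshared sh false v = false by rewrite -hOk hif.
- move=> s1 F _ [h1 h2]; split=> // i v hi; apply: h1 => //; by case: hi.
Qed.

End Projections.

(** [u] is the previous state of the parent, [x] the state of the child, and [w] a copy of the
    parent state that carries the bits received from [x]. Unshared colours have set bits in [x],
    whose unshared atoms leave the scene, and clear bits in [w], which makes the transfer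
    unambiguous. *)
Definition joined (K : nat) (sh : nat -> bool) (Tc Tp : state -> Prop) (v : state) : Prop :=
  exists u w x : state, [/\ cols u = cols v, cols w = cols v, join u w = v, Tp u & unshared sh false w] /\
    [/\ valid K x, Tc x, unshared sh true x & proj sh x = proj sh w].

Definition step_budget (K M : nat) : nat :=
  K + (M * K.+2 + (M * K.+1 + (K * M.+1 + (K * M.+1 + (M + (K * M.+1 + M)))))).

(** * One join step, and the loop over all nodes *)

Section Step.

Variables (K : nat) (Q : seq state).

Definition join_step : cmd :=
  Seq shared (Seq project_child (Seq extend_parent (Seq (zeta rB) (Seq (zeta rT)
    (Seq multiply (Seq (moebius rT) normalise)))))).

Lemma table_outside base bb F s s' : (base + size Q <= bb) || (bb + size Q <= base) ->
  outside Q bb s s' -> table Q base F s -> table Q base F s'.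
Proof. by move=> hd ho h j v hj; rewrite ho; [apply: h|case: hj => hj _; slia]. Qed.

Lemma join_step_spec s ta tp bb ri rp F A sh :
  state_tables K Q s -> reg s rA = ta -> reg s rT = tp -> reg s rB = bb ->
  ta + size Q <= bb -> tp + size Q <= bb ->
  table Q ta F s -> table Q tp A s -> (forall v, A v <= 1) ->
  arr s aRk (reg s rI) = ri -> arr s aRk (reg s rP) = rp ->
  (forall c, c < K -> (arr s aColat (ri + c) == arr s aColat (rp + c)) = sh c) ->
  (forall a b, a < 2 ^ K + 1 -> b < 2 ^ K + 1 -> arr s aProd (arr s aRow a + b) = a * b) ->
  wp join_step (step_budget K (size Q)) s (fun s' =>
    (forall j v, node_id Q j v -> arr s' aT (tp + j) <= 1 /\
      (arr s' aT (tp + j) != 0 <-> joined K sh (fun u => F u != 0) (fun u => A u != 0) v)) /\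
    (forall x, x < bb -> (x < tp) || (tp + size Q <= x) -> arr s' aT x = arr s aT x)).
Proof.
move=> hst hA hT hB dA dT tF tA A1 hri hrp hsh hprod; rewrite /join_step /step_budget.
have [hfull hmaps hM hK] := hst.
have [hu hval hroot [g1 g2 g3 g4] hch] := hfull.
apply: wp_seq (leqnn _) _; apply: wp_conseq (@shared_spec K s ri rp hK hri hrp) (leqnn _) _.
move=> s1 F1 h1 _.
have st1 : state_tables K Q s1 by apply: (state_tables_frame F1).
have sh1 c : c < K -> (arr s1 aSh c != 0) = sh c by move=> hc; rewrite h1 // hsh.
have eT1 : arr s1 aT = arr s aT by fr F1.
apply: wp_seq (leqnn _) _; apply: wp_conseq (@project_child_spec K Q s1 ta F sh st1 _ _ sh1) (leqnn _) _.
- by fr F1.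
- by move=> j v hj; rewrite eT1; apply: tF.
move=> s2 F2 h2 _.
have st2 : state_tables K Q s2 by apply: (state_tables_frame F2).
have sh2 c : c < K -> (arr s2 aSh c != 0) = sh c by move=> hc; fr F2; apply: sh1.
(* The marks in [aS] are read as a function on states, the form in which the transforms speak about
   tables. *)
pose G u := if u \in Q then arr s2 aS (index u Q) else 0.
have hG j u : node_id Q j u -> arr s2 aS j = G u.
  by move=> [m1 <-]; rewrite /G mem_nth // index_uniq.
have idx u : u \in Q -> node_id Q (index u Q) u by move=> hu'; split; rewrite ?index_mem ?nth_index.
have eT2 : arr s2 aT = arr s aT by fr F2; rewrite eT1.
apply: wp_seq (leqnn _) _; apply: wp_conseq (@extend_parent_spec K Q s2 bb G sh st2 _ hG sh2) (leqnn _) _.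
  by fr F2; fr F1.
pose B v := if unshared sh false v then G (proj sh v) else 0.
move=> s3 F3 [tB3 o3] _.
have st3 : state_tables K Q s3 by apply: (state_tables_frame F3).
have tA3 : table Q tp A s3.
  by apply: table_outside o3 _; [rewrite dT|move=> j v hj; rewrite eT2; apply: tA].
apply: wp_seq (leqnn _) _; apply: wp_conseq (@zeta_spec K Q rB s3 bb B isT st3 _ tB3) (leqnn _) _.
  by fr F3; fr F2; fr F1.
move=> s4 F4 [tB4 o4] _.
have st4 : state_tables K Q s4 by apply: (state_tables_frame F4).
have tA4 : table Q tp A s4 by apply: table_outside o4 tA3; rewrite dT.
apply: wp_seq (leqnn _) _; apply: wp_conseq (@zeta_spec K Q rT s4 tp A isT st4 _ tA4) (leqnn _) _.
  by fr F4; fr F3; fr F2; fr F1.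
move=> s5 F5 [tA5 o5] _.
have st5 : state_tables K Q s5 by apply: (state_tables_frame F5).
have tB5 : table Q bb (zeta_sum K B) s5 by apply: table_outside o5 tB4; rewrite dT orbT.
have B1 v : B v <= 1.
  rewrite /B /G; case: ifP => // _; case: ifP => // hin.
  by have [] := h2 _ _ (idx _ hin).
apply: wp_seq (leqnn _) _;
  apply: wp_conseq (@multiply_spec K Q s5 tp bb (zeta_sum K A) (zeta_sum K B) (2 ^ K + 1) st5 _ _ dT tA5 tB5 _ _ _) (leqnn _) _.
- by fr F5; fr F4; fr F3; fr F2; fr F1.
- by fr F5; fr F4; fr F3; fr F2; fr F1.
- by fr F5; fr F4; fr F3; fr F2; fr F1.
- by move=> v; rewrite addn1 ltnS zeta_bound.
- by move=> v; rewrite addn1 ltnS zeta_bound.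
move=> s6 F6 [t6 o6] _.
have st6 : state_tables K Q s6 by apply: (state_tables_frame F6).
(* The pointwise product of two zeta transforms is the zeta transform of the union product, which
   the Moebius passes then recover. *)
have t6' : table Q tp (zeta_sum K (uprod K A B)) s6.
  by move=> j v hj; rewrite (t6 _ _ hj) zeta_uprod //; apply: node_valid hst hj.
apply: wp_seq (leqnn _) _; apply: wp_conseq (@moebius_spec K Q rT s6 tp (uprod K A B) isT st6 _ t6') (leqnn _) _.
  by fr F6; fr F5; fr F4; fr F3; fr F2; fr F1.
move=> s7 F7 [t7 o7] _.
have st7 : state_tables K Q s7 by apply: (state_tables_frame F7).
apply: wp_conseq (@normalise_spec K Q s7 tp (uprod K A B) st7 _ t7) (leqnn _) _.
  by fr F7; fr F6; fr F5; fr F4; fr F3; fr F2; fr F1.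
move=> s8 F8 [t8 o8]; split; last first.
  move=> x xb xt; rewrite o8 // o7 // o6 // o5 // o4 ?xb // o3 ?xb // eT2 //.
move=> j v hj; rewrite (t8 _ _ hj); split; first exact: leq_b1.
have hv := node_valid hst hj.
have -> : (nat_of_bool (uprod K A B v != 0) != 0) = (uprod K A B v != 0) by case: (uprod _ _ _ _).
rewrite uprod_neq0 //; split.
  move=> [u [w [e1 e2 ej hAu]]]; rewrite /B; case: ifP => // hun hGw.
  have hin : proj sh w \in Q by move: hGw; rewrite /G; case: ifP.
  move: hGw; rewrite /G hin => /(proj1 (proj2 (h2 _ _ (idx _ hin)))) [x [x1 x2 x3 x4]].
  by exists u, w, x.
move=> [u [w [x [[e1 e2 ej hAu hun] [x1 x2 x3 x4]]]]]; exists u, w; split=> //.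
have hin : proj sh w \in Q.
  rewrite hval -x4; move: x1; rewrite /valid => /andP[k1 /allP k2].
  have hsub : subseq (cols (proj sh x)) (cols x) by apply: map_subseq; apply: filter_subseq.
  rewrite (subseq_uniq hsub) //=; apply/allP => c hc; apply: k2; exact: mem_subseq hsub _ hc.
by rewrite /B hun /G hin; apply/(proj2 (h2 _ _ (idx _ hin))); exists x.
Qed.

End Step.

Section Loop.

Variables (K g : nat) (Q : seq state) (pi : nat -> nat) (sh : nat -> nat -> bool).

(* The tables after the nodes g, g - 1, ..., g - z + 1 have been joined into their parents. *)
Fixpoint after_joins (T0 : nat -> state -> Prop) (z : nat) : nat -> state -> Prop :=
  if z is z'.+1 then
    let T := after_joins T0 z' in
    fun q v => if q == pi (g - z') then joined K (sh (g - z')) (T (g - z')) (T q) v else T q v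
  else T0.

Definition tables_hold (T : nat -> state -> Prop) (f : nat -> nat) : Prop :=
  forall q j v, q <= g -> node_id Q j v ->
    f (q * size Q + j) <= 1 /\ (f (q * size Q + j) != 0 <-> T q v).

Lemma joins_spec s T0 :
  state_tables K Q s -> reg s rG = g -> reg s rG1 = g + 1 ->
  (forall i, i < g.+2 -> arr s aTb i = i * size Q) ->
  (forall i, i < g.+2 -> arr s aRk i = i * K) ->
  (forall i, 0 < i <= g -> arr s aPi i = pi i /\ pi i < i) ->
  (forall i c, 0 < i <= g -> c < K -> (arr s aColat (i * K + c) == arr s aColat (pi i * K + c)) = sh i c) ->
  (forall a b, a < 2 ^ K + 1 -> b < 2 ^ K + 1 -> arr s aProd (arr s aRow a + b) = a * b) ->
  tables_hold T0 (arr s aT) ->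
  wp joins (g * (step_budget K (size Q)).+1) s (fun s' => tables_hold (after_joins T0 g) (arr s' aT)).
Proof.
move=> hst hg hg1 htb hrk hpi hsh hprod hT; rewrite /joins; wrun.
rewrite hg1 htb; last by lia.
have hst' := hst; case: hst' => hfull _ _ _; have [hu hval _ _ _] := hfull.
apply: (@wp_for (fun z s1 => tables_hold (after_joins T0 z) (arr s1 aT)) (step_budget K (size Q)) g) => //=.
- move=> z s1 F hz hZ hI; wrun; fr F; rewrite /= hg hZ.
  have hi : 0 < g - z <= g by lia.
  set i := g - z in hi *.
  have [-> hlt] := hpi i hi; rewrite !htb; [|lia|lia].
  pose val q v := if v \in Q then arr s1 aT (q * size Q + index v Q) else 0.
  have tval q : table Q (q * size Q) (val q) s1.
    by move=> j v [k1 <-]; rewrite /val mem_nth // index_uniq.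
  have idx u : u \in Q -> node_id Q (index u Q) u by move=> hu'; split; rewrite ?index_mem ?nth_index.
  set s2 := set_reg _ rT _.
  have st2 : state_tables K Q s2.
    apply: (@state_tables_upd _ _ s1) => //; apply: (state_tables_frame F) => //.
    exact: (@state_tables_upd _ _ s).
  have bnd q : q <= g -> q * size Q + size Q <= (g + 1) * size Q.
    by move=> hq; rewrite -mulSnr leq_mul2r addn1 ltnS hq orbT.
  apply: wp_conseq (@join_step_spec K Q s2 (i * size Q) (pi i * size Q) ((g + 1) * size Q) (i * K) (pi i * K)
     (val i) (val (pi i)) (sh i) st2 _ _ _ _ _ (tval i) (tval (pi i)) _ _ _ _ _) (leqnn _) _ => //=.
  + by fr F.
  + by apply: bnd; lia.
  + by apply: bnd; lia.
  + move=> v; rewrite /val; case: ifP => // hv.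
    by have [] := hI (pi i) _ _ _ (idx _ hv); first lia.
  + by fr F; rewrite /= hrk //; lia.
  + by fr F; rewrite /= hrk //; lia.
  + by move=> c hc; fr F; apply: hsh.
  + by move=> a b ha hb; fr F; apply: hprod.
  move=> s3 F3 [hnew hold] q j v hq hj.
  have jlt : j < size Q by case: hj.
  case: (eqVneq q (pi i)) => [->|hne].
    have [k1 k2] := hnew j v hj; split=> //; rewrite k2.
    have conv q' x : q' <= g -> valid K x -> (val q' x != 0 <-> after_joins T0 z q' x).
      move=> hq' hx; rewrite /val hval hx.
      by have [] := hI q' _ x hq' (idx x _); rewrite ?hval.
    have hvv : valid K v by apply: node_valid hst hj.
    have hvc u : cols u = cols v -> valid K u by rewrite /valid => ->.
    split=> -[u [w [x [[e1 e2 e3 e4 e5] [x1 x2 x3 x4]]]]]; exists u, w, x; split; split=> //.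
    * by apply/conv => //; [lia|apply: hvc].
    * by apply/conv => //; lia.
    * by apply/conv => //; [lia|apply: hvc].
    * by apply/conv => //; lia.
  have hpq : (q * size Q + j < pi i * size Q) || (pi i * size Q + size Q <= q * size Q + j).
    case: (ltnP q (pi i)) => hlt2.
      by apply/orP; left; have := leq_mul2r (size Q) q.+1 (pi i); rewrite hlt2 orbT mulSnr; lia.
    have hlt3 : pi i < q by rewrite ltn_neqAle eq_sym hne.
    by apply/orP; right; have := leq_mul2r (size Q) (pi i).+1 q; rewrite hlt3 orbT mulSnr; lia.
  rewrite hold //; last by have := bnd q hq; lia.
  exact: hI.
Qed.

End Loop.

(** * Founded orders *)

Section Founded.

Variable A : finType.
Implicit Types (P : program A) (r : rule A) (s : seq A) (I J S : {set A}) (o : option A).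

(* Status of an atom seen from x: 0 false, 1 derived after x, 2 derived before x, 3 is x. Without x,
   all atoms of s count as derived before. *)
Definition label s o (a : A) : nat :=
  if a \notin s then 0
  else if o is Some x then (if a == x then 3 else if index a s < index x s then 2 else 1) else 2.

(* With x, the rule derives x from earlier atoms; without x, it is violated. *)
Definition rule_fires_at r s o : bool :=
  [forall a, digit_ok (a \in rhead r) (a \in rpos r) (a \in rneg r) (label s o a)].

Definition founded P s : Prop :=
  [/\ uniq s, forall r, r \in P -> ~~ rule_fires_at r s None
    & forall x, x \in s -> exists2 r, r \in P & rule_fires_at r s (Some x)].

Lemma reductP P I r : r \in P -> rneg r :&: I == set0 -> (rhead r, rpos r, set0) \in reduct P I.
Proof. by move=> h1 h2; apply/imsetP; exists r; rewrite ?inE ?h1 ?h2. Qed.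

Lemma model_reductP P I J :
  reflect (forall r, r \in P -> rneg r :&: I == set0 ->
             (rhead r :&: J != set0) || (rpos r :\: J != set0))
          (model (reduct P I) J).
Proof.
apply: (iffP forallP) => [h r h1 h2|h r].
  have := h (rhead r, rpos r, set0); rewrite (reductP h1 h2) /= /sat_rule /rhead /rpos /rneg /=.
  by rewrite setU0.
apply/implyP => /imsetP[r' ]; rewrite inE => /andP[h1 h2] ->.
by rewrite /sat_rule /rhead /rpos /rneg /= setU0; apply: h.
Qed.

(** Minimality: a model [J] of the reduct inside [s] contains every atom of [s], by induction along
    the order. The rule deriving [x] has its positive body before [x], hence in [J], and [x] is its
    only head atom that can lie in [J]. *)
Lemma founded_answer_set P s : founded P s -> answer_set P [set x in s].
Proof.
move=> [hu hm hf]; apply/minsetP; split.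
  apply/model_reductP => r hr /eqP hn.
  move: (hm r hr); rewrite negb_forall => /existsP[a]; rewrite /digit_ok /label.
  case: (boolP (a \in s)) => has /=; case: (boolP (a \in rhead r)) => hh /=.
  - by move=> _; apply/orP; left; apply/set0Pn; exists a; rewrite !inE hh.
  - rewrite implybT /= => h; move/setP/(_ a): hn; rewrite !inE has andbT.
    by case: (a \in rneg r) h.
  - by rewrite implybT andbT; case: (boolP (a \in rpos r)) => // hp _; apply/orP; right; apply/set0Pn; exists a; rewrite !inE has.
  - by rewrite implybT andbT; case: (boolP (a \in rpos r)) => // hp _; apply/orP; right; apply/set0Pn; exists a; rewrite !inE has.
move=> J /model_reductP hJ hsub; apply/eqP; rewrite eqEsubset hsub /=.
apply/subsetP => x; rewrite inE.
have [k hk] := ubnP (index x s); elim: k x hk => // k IH x hk hx.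
have [r hr /forallP hfire] := hf x hx.
have hneg : rneg r :&: [set x in s] == set0.
  apply/eqP/setP => a; rewrite !inE; apply/negP => /andP[hn ha].
  have /and3P[_ _] := hfire a; rewrite hn /label ha /=.
  by case: (a == x) => //; case: (_ < _).
case/orP: (hJ r hr hneg) => /set0Pn[a]; rewrite !inE => /andP[h1 h2].
  have has : a \in s by have := subsetP hsub a h2; rewrite inE.
  have /and3P[] := hfire a; rewrite h1 /label has /=.
  by case: (eqVneq a x) => [<-|_] //=; case: ifP.
have /and3P[_] := hfire a; rewrite h2 /label /=.
case: (boolP (a \in s)) => //= has; case: (a == x) => //; case: ltnP => // lt _ _.
by case/negP: h1; apply: IH => //; apply: leq_trans lt _.
Qed.

(** Separates the target [I], on which head and negative body are evaluated, from the set [S]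
    derived so far; thus partial derivations can be compared with a fixed answer set. *)
Definition derives r I S (x : A) : bool :=
  [&& rneg r :&: I == set0, x \in rhead r, rhead r :&: I \subset [set x] & rpos r \subset S].

Lemma derives_fires r s x : x \in s ->
  derives r [set y in s] [set y in take (index x s) s] x -> rule_fires_at r s (Some x).
Proof.
move=> hx /and4P[/eqP hn hh /subsetP hsub /subsetP hp]; apply/forallP => a; rewrite /digit_ok /label.
have hneg : a \in rneg r -> a \in s = false.
  by move=> h; apply/negP => h2; move/setP/(_ a): hn; rewrite !inE h h2.
have hpos : a \in rpos r -> (a \in s) && (index a s < index x s).
  move=> /hp; rewrite inE => h; have has := mem_take h.
  by rewrite has -in_take.
apply/and3P; split.
- case: ifP => ha; last first.
    by case: (a \in s) => //=; case: (eqVneq a x) => [e|_]; [rewrite e hh in ha | case: ifP].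
  case: (boolP (a \in s)) => //= has.
  by have := hsub a; rewrite !inE ha has => /(_ isT) ->.
- apply/implyP => /hpos /andP[-> lt] /=; rewrite lt.
  by rewrite (_ : (a == x) = false) //; apply: contraTF lt => /eqP->; rewrite ltnn.
- by apply/implyP => /hneg ->.
Qed.

Definition derivation P I s : Prop :=
  uniq s /\ forall x, x \in s -> x \in I /\
    exists2 r, r \in P & derives r I [set y in take (index x s) s] x.

Lemma derivation_rcons P I s x r : derivation P I s -> x \in I -> x \notin s -> r \in P ->
  derives r I [set y in s] x -> derivation P I (rcons s x).
Proof.
move=> [hu hs] hx hxs hr hd; split; first by rewrite rcons_uniq hxs.
move=> y; rewrite mem_rcons inE => /orP[/eqP->|hy].
  split=> //; exists r => //; rewrite -cats1 index_cat (negPf hxs) /= eqxx addn0.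
  by rewrite take_size_cat.
have [h1 [r' h2 h3]] := hs y hy; split=> //; exists r' => //.
by rewrite -cats1 index_cat hy takel_cat // index_size.
Qed.

Lemma maximal_derivation P I : exists2 s, derivation P I s &
  forall x r, x \in I -> x \notin s -> r \in P -> ~~ derives r I [set y in s] x.
Proof.
suff gen k s : derivation P I s -> #|I| - size s < k -> exists2 s, derivation P I s &
    forall x r, x \in I -> x \notin s -> r \in P -> ~~ derives r I [set y in s] x.
  by apply: (gen #|I|.+1 [::]) => //; rewrite ltnS leq_subr.
elim: k s => // k IH s hs hk.
case: (boolP [exists x in I, (x \notin s) && [exists r in P, derives r I [set y in s] x]]).
  move=> /existsP[x /and3P[hx hxs /existsP[r /andP[hr hd]]]].
  apply: (IH (rcons s x)); first exact: derivation_rcons hs hx hxs hr hd.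
  rewrite size_rcons; have : size s < #|I|; last by lia.
  have [hu hm] := hs.
  have /uniq_leq_size : uniq (x :: s) by rewrite /= hxs.
  move=> /(_ (enum I)); rewrite -cardE; apply=> y; rewrite inE mem_enum => /orP[/eqP->//|/hm[]//].
move=> hn; exists s => // x r hx hxs hr; apply: contraNN hn => hd.
by apply/existsP; exists x; rewrite hx hxs /=; apply/existsP; exists r; rewrite hr.
Qed.

Lemma connect_cycle (e : rel A) a b : a != b -> connect e a b -> connect e b a ->
  exists p : seq A, [/\ cycle e p, a \in p & b \in p].
Proof.
move=> hab /connectP[p hp ep] /connectP[q hq eq].
have hpq : path e a (p ++ q) by rewrite cat_path hp -ep.
have lpq : last a (p ++ q) = a by rewrite last_cat -ep -eq.
have hb : b \in p by case: p ep {hp hpq lpq} => [/= e2|c p /= ->]; [rewrite e2 eqxx in hab | exact: mem_last].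
case/lastP ec: (p ++ q) hpq lpq => [|t c] hpq lpq.
  by case: (p) hb ec.
rewrite last_rcons in lpq; rewrite lpq in hpq ec.
exists (a :: t); split=> //; rewrite ?mem_head //.
have : b \in p ++ q by rewrite mem_cat hb.
by rewrite ec mem_rcons.
Qed.

(* A maximal derivation s inside I exhausts I.  Otherwise choose a in U = I \ s with the fewest
   ancestors in the dependency graph restricted to U.  These ancestors are strongly connected, so a
   head meets them in at most one atom, and removing them from I leaves a model of the reduct. *)
Lemma answer_set_founded P I : head_cycle_free P -> answer_set P I ->
  exists2 s, founded P s & [set x in s] = I.
Proof.
move=> hcf /minsetP[/model_reductP hmod hmin].
have [s hs hmax] := maximal_derivation P I; have [hu hm] := hs.
have hsI : [set x in s] \subset I by apply/subsetP => x; rewrite inE => /hm[].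
case: (eqVneq [set x in s] I) => [eI|neI].
  exists s => //; split=> //.
    move=> r hr; apply/negP => /forallP hf.
    have hn : rneg r :&: I == set0.
      apply/eqP/setP => a; rewrite -eI !inE; apply/negP => /andP[h1 h2].
      by have /and3P[_ _] := hf a; rewrite h1 /label h2.
    case/orP: (hmod r hr hn) => /set0Pn[a]; rewrite -eI !inE => /andP[h1 h2];
      have := hf a; rewrite /digit_ok /label ?h2 ?h1 /=.
      by [].
    by rewrite andbF.
  by move=> x hx; have [_ [r hr hd]] := hm x hx; exists r => //; apply: derives_fires; rewrite ?eI.
pose U := I :\: [set x in s].
pose e : rel A := [rel b c | [&& dep_edge P b c, b \in U & c \in U]].
pose anc a := [set b in U | connect e b a].
have [a0 ha0] : exists a, a \in U.
  by apply/set0Pn; rewrite setD_eq0; apply: contra neI => h; rewrite eqEsubset hsI.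
case: (arg_minnP (fun a => #|anc a|) ha0) => a ha' hamin.
have {ha'}ha : a \in U := ha'.
(* The ancestors of an ancestor [b] are ancestors of [a]; since [a] has the fewest, the two sets
   coincide and [a] is an ancestor of [b]. *)
have hC b : b \in anc a -> connect e a b.
  move=> hb; have hbU : b \in U by move: hb; rewrite inE => /andP[].
  have hsub : anc b \subset anc a.
    apply/subsetP => c; rewrite !inE => /andP[-> h1] /=; apply: connect_trans h1 _.
    by move: hb; rewrite inE => /andP[].
  have : anc b == anc a by rewrite eqEcard hsub hamin.
  by move/eqP/setP/(_ a); rewrite [RHS]inE [LHS]inE ha connect0.
have haa : a \in anc a by rewrite inE ha connect0.
pose J := I :\: anc a.
have hJI : J \subset I by apply: subsetDl.
suff hJ : model (reduct P I) J.
  have := hmin J hJ hJI; move/setP/(_ a); rewrite !inE connect0 andbT.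
  by move: ha; rewrite !inE => /andP[-> ->].
apply/model_reductP => r hr hn; apply/negPn/negP; rewrite negb_or !negbK => /andP[/eqP hh /eqP hp].
have hpJ b : b \in rpos r -> b \in J.
  by move=> hb; apply/negPn/negP => hbJ; move/setP/(_ b): hp; rewrite !inE hb in hbJ *; rewrite hbJ.
have hhJ b : b \in rhead r -> b \in I -> b \in anc a.
  move=> hb hbI; apply/negPn/negP => hbC; move/setP/(_ b): hh.
  by rewrite [in LHS]inE hb /J in_setD hbC hbI inE.
case/orP: (hmod r hr hn) => /set0Pn[c]; last first.
  by rewrite inE => /andP[hcI /hpJ /(subsetP hJI)]; rewrite (negPf hcI).
rewrite inE => /andP[hc hcI]; have hcC := hhJ c hc hcI.
have hcU : c \in U by move: hcC; rewrite inE => /andP[].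
have esub : subrel e (dep_edge P) by move=> x y /and3P[].
have cdep x y : connect e x y -> connect (dep_edge P) x y.
  by apply: connect_sub => u v /esub; apply: connect1.
have hone b : b \in rhead r -> b \in I -> b = c.
  move=> hb hbI; have hbC := hhJ b hb hbI; apply/eqP/negPn/negP => hbc.
  have k1 : connect e b c.
    by apply: connect_trans (hC c hcC); move: hbC; rewrite inE => /andP[].
  have k2 : connect e c b.
    by apply: connect_trans (hC b hbC); move: hcC; rewrite inE => /andP[].
  have [p [p1 p2 p3]] := connect_cycle hbc (cdep _ _ k1) (cdep _ _ k2).
  by apply: (hcf r b c p hr hb hc hbc p1); rewrite p2 p3.
have hcs : c \notin s by move: hcU; rewrite !inE => /andP[].
(* Now [c] is the only true head atom of [r], yet [r] does not derive it. So a positive body atom is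
   missing in [s]; it lies in [U] and its edge to [c] makes it an ancestor of [a], although all
   positive body atoms lie in [J]. *)
have := hmax c r hcI hcs hr; rewrite /derives hn hc /=; case/negP; apply/andP; split.
  by apply/subsetP => b; rewrite !inE => /andP[h1 h2]; rewrite (hone b h1 h2).
apply/subsetP => b hb; rewrite inE; apply/negPn/negP => hbs.
have hbJ := hpJ b hb; have hbU : b \in U by rewrite !inE hbs (subsetP hJI).
move: hbJ; rewrite in_setD inE hbU /= => /andP[/negP []]; apply: connect_trans (_ : connect e c a).
  apply: connect1; rewrite /e /= hbU hcU !andbT; apply/existsP; exists r; by rewrite hr hb.
by move: hcC; rewrite inE => /andP[].
Qed.

Lemma has_answer_setP P : head_cycle_free P ->
  has_answer_set P <-> exists s, founded P s.
Proof.
move=> hcf; split; last by move=> [s /founded_answer_set h]; apply/existsP; eexists; exact: h.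
by move=> /existsP[I /(answer_set_founded hcf) [s hs _]]; exists s.
Qed.

End Founded.

(** * Amalgamation of linear orders *)

Section Amalgamation.

Variable T : eqType.
Implicit Types (s t r : seq T).

Lemma filter_notin s t x : x \notin t -> [seq z <- t | z \in x :: s] = [seq z <- t | z \in s].
Proof.
by move=> hx; apply: eq_in_filter => z hz; rewrite inE; case: eqP => // ez; rewrite -ez hz in hx.
Qed.

Lemma filter_cons_in x s t : x \in t -> [seq z <- x :: s | z \in t] = x :: [seq z <- s | z \in t].
Proof. by move=> /= ->. Qed.

Lemma filter_cons_out x s t : x \notin t -> [seq z <- x :: s | z \in t] = [seq z <- s | z \in t].
Proof. by move=> /= /negPf->. Qed.

Definition amalgam s t r : Prop :=
  [/\ uniq r, [seq z <- r | z \in s] = s, [seq z <- r | z \in t] = t & {subset r <= s ++ t}].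

Lemma amalgam_sym s t r : amalgam s t r -> amalgam t s r.
Proof. by case=> h1 h2 h3 h4; split=> // z /h4; rewrite !mem_cat orbC. Qed.

Lemma amalgam_cons x s t r : x \notin s -> x \notin t -> amalgam s t r -> amalgam (x :: s) t (x :: r).
Proof.
move=> hs ht [h1 h2 h3 h4].
have hx : x \notin r by apply/negP => /h4; rewrite mem_cat (negPf hs) (negPf ht).
split; rewrite /= ?hx ?mem_head ?(negPf ht) //; first by rewrite filter_notin ?h2.
by move=> z; rewrite !inE mem_cat => /orP[->//|/h4]; rewrite mem_cat => ->; rewrite orbT.
Qed.

(** A merge of the two lists: a first element absent from the other list is output at once, and if
    both first elements are common to the lists, they coincide because the orders agree on common
    elements. *)
Lemma amalgamation s t :
  uniq s -> uniq t -> [seq x <- s | x \in t] = [seq x <- t | x \in s] -> exists r, amalgam s t r.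
Proof.
have filt (z : seq T) : [seq x <- z | x \in z] = z by apply/all_filterP/allP.
have [k] := ubnP (size s + size t); elim: k s t => // k IH s t hk us ut.
case: s us hk => [_ _ _|x s us hk].
  by exists t; split=> //; elim: (t).
case: t ut hk => [_ hk _|y t ut hk].
  exists (x :: s); split=> // [|z]; last by rewrite cats0.
  by elim: (x :: s).
move=> e; have [xs us'] : x \notin s /\ uniq s by apply/andP.
have [yt ut'] : y \notin t /\ uniq t by apply/andP.
case: (boolP (x \in y :: t)) => hx; last first.
  rewrite (filter_cons_out _ hx) (@filter_notin s _ x hx) in e.
  have [r hr] := IH s (y :: t) hk us' ut e.
  by exists (x :: r); apply: amalgam_cons.
case: (boolP (y \in x :: s)) => hy; last first.
  rewrite [RHS](filter_cons_out _ hy) (@filter_notin t _ y hy) in e.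
  have [|r hr] := IH (x :: s) t _ us ut' e; first by move: hk; rewrite /= addnS.
  by exists (y :: r); apply/amalgam_sym/amalgam_cons => //; apply: amalgam_sym.
rewrite (filter_cons_in _ hx) (filter_cons_in _ hy) in e; case: e => exy; rewrite -exy in yt *.
rewrite !filter_notin // => e.
have [|r [h1 h2 h3 h4]] := IH s t _ us' ut' e; first by move: hk => /=; lia.
have hxr : x \notin r by apply/negP => /h4; rewrite mem_cat (negPf xs) (negPf yt).
exists (x :: r); split; rewrite /= ?hxr ?mem_head //.
- by rewrite filter_notin ?h2.
- by rewrite filter_notin ?h3.
by move=> z; rewrite !inE mem_cat inE => /orP[->//|/h4]; rewrite mem_cat => /orP[->|->]; rewrite ?orbT.
Qed.

Lemma index_filter (a : pred T) s x y : a x -> a y -> 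
  (index x [seq z <- s | a z] < index y [seq z <- s | a z]) = (index x s < index y s).
Proof.
move=> ax ay; elim: s => //= z s IH.
case: (boolP (a z)) => az /=.
  by case: (eqVneq z x) => _; case: (eqVneq z y).
have -> : (z == x) = false by apply: contraNF az => /eqP->.
have -> : (z == y) = false by apply: contraNF az => /eqP->.
by rewrite ltnS.
Qed.

End Amalgamation.

(** * Eliminating the nodes from the leaves to the root *)

Section Elimination.

Variables (C : eqType) (K g : nat) (pi : nat -> nat) (at_ : nat -> nat -> option C).
Hypotheses (pi_lt : forall i, 0 < i <= g -> pi i < i)
  (rip_at : forall i j c, j < i <= g -> at_ i c -> at_ i c = at_ j c -> at_ (pi i) c = at_ i c).
Implicit Types (v u w x : state) (T : nat -> state -> Prop).

(** A colour carried by no atom in either bag counts as shared. This is harmless, as states of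
    [sane] tables contain no such colour. *)
Definition sh (i c : nat) : bool := at_ i c == at_ (pi i) c.

(* The bags 0, ..., n have compatible states in T, and each true atom is justified somewhere. *)
Definition table_family (n : nat) T : Prop :=
  exists v : nat -> state,
    [/\ forall q, q <= n -> T q (v q),
        forall q, 0 < q <= n -> cols (proj (sh q) (v q)) = cols (proj (sh q) (v (pi q)))
      & forall q c, q <= n -> c \in cols (v q) ->
          exists2 q', q' <= n & at_ q' c = at_ q c /\ tr (v q') c].

Definition sane T : Prop := forall q v, q <= g -> T q v -> valid K v /\ forall c, c \in cols v -> at_ q c.

Lemma cols_proj f v : cols (proj f v) = [seq c <- cols v | f c].
Proof. by rewrite /cols /proj /unzip1 filter_map. Qed.

Lemma tr_proj f v c : tr (proj f v) c = f c && tr v c.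
Proof. by rewrite /tr mem_filter. Qed.

Lemma valid_uniq v : valid K v -> uniq (cols v).
Proof. by case/andP. Qed.

Definition join_into T i : nat -> state -> Prop :=
  fun q v => if q == pi i then joined K (sh i) (T i) (T q) v else T q v.

Lemma sane_join T i : sane T -> sane (join_into T i).
Proof.
move=> hT q v hq; rewrite /join_into; case: eqP => _; last exact: hT.
move=> [u [w [x [[e1 _ _ hu _] _]]]]; have [h1 h2] := hT q u hq hu.
by rewrite /valid -e1; split.
Qed.

(** Forwards, the parent takes over the justified bits of the shared colours of node [i], so a
    justification found in [i] is still available. Backwards, the state of the parent splits into
    [u], which stays there, and [x], which is given to [i]; a bit that came from [w] is found in
    [x]. All children of [i] have larger numbers and are already gone. *)
Lemma table_family_join T i : 0 < i <= g -> sane T -> table_family i T <-> table_family i.-1 (join_into T i).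
Proof.
move=> hi hT; have hp := pi_lt hi; set p := pi i in hp *.
have him : i.-1 < i by lia.
split=> [[v [h1 h2 h3]]|[v [h1 h2 h3]]].
- pose w := mk (cols (v p)) (fun c => sh i c && tr (v i) c).
  pose v' q := if q == p then join (v p) w else v q.
  have cv' q : cols (v' q) = cols (v q) by rewrite /v'; case: eqP => // ->; rewrite cols_mk.
  have [vi ai] := hT i (v i) (proj2 (andP hi)) (h1 i (leqnn i)).
  have ecols := h2 i (introT andP (conj (proj1 (andP hi)) (leqnn i))); rewrite -/p !cols_proj in ecols.
  have back c q : q < i -> c \in cols (v i) -> at_ q c = at_ i c -> sh i c.
    move=> hq hc e; suff e2 : at_ (pi i) c = at_ i c by rewrite /sh e2.
    apply: (@rip_at i q c) => //; [by rewrite hq; case/andP: hi | exact: ai].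
  have trp c : c \in cols (v i) -> sh i c -> tr (v i) c -> tr (v' p) c.
    move=> hc hs ht; rewrite /v' eqxx tr_mk.
    have hcp : c \in cols (v p).
      have : c \in [seq c <- cols (v i) | sh i c] by rewrite mem_filter hs.
      by rewrite ecols mem_filter => /andP[].
    by rewrite hcp /= tr_mk hcp hs ht orbT.
  have mono q c : tr (v q) c -> tr (v' q) c.
    move=> ht; rewrite /v'; case: eqP => // eq; rewrite tr_mk -eq ht andbT.
    by apply: tr_cols.
  exists v'; split.
  + move=> q hq; rewrite /join_into -/p; case: (eqVneq q p) => [->|ne]; last first.
      by rewrite /v' (negPf ne); apply: h1; lia.
    exists (v p), w, (v i); split; split=> //.
    * by rewrite (cv' p) cols_mk.
    * by rewrite /v' eqxx.
    * by apply: h1; lia.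
    * by apply/allP => -[c b] /mapP[c' _ [-> ->]] /=; case: (sh i c').
    * exact: h1.
    (* An unshared colour of [i] is justified in some bag up to [i]. An earlier bag holding the same
       atom would make the colour shared by running intersection, so the bit is set in [i]
       itself. *)
    * apply/allP => -[c b] hx /=; case: (boolP (sh i c)) => //= hs.
      have hc := mem_cols hx; have [q' hq' [e ht]] := h3 i c (leqnn i) hc.
      move: hq'; rewrite leq_eqVlt => /orP[/eqP eq|lt]; last by rewrite (back c q') in hs.
      by apply/eqP; rewrite eq in ht; apply: uniq_bits (valid_uniq vi) hx ht.
    * have hvp : valid K (v p) by have [] := hT p (v p) _ (h1 p _); lia.
      apply: state_ext; rewrite ?cols_proj ?cols_mk //; first by apply: filter_uniq; apply: valid_uniq.
      move=> c; rewrite !tr_proj tr_mk; case: (boolP (sh i c)) => //= hs.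
      case: (boolP (tr (v i) c)) => ht; last by rewrite andbF.
      rewrite andbT; have : c \in [seq c <- cols (v i) | sh i c] by rewrite mem_filter hs (tr_cols ht).
      by rewrite ecols mem_filter => /andP[_ ->].
  + by move=> q hq; rewrite !cols_proj !cv' -!cols_proj; apply: h2; lia.
  + move=> q c hq; rewrite cv' => hc; have [|q' hq' [e ht]] := h3 q c _ hc; first by lia.
    move: hq'; rewrite leq_eqVlt => /orP[/eqP eq|lt]; last first.
      by exists q'; [lia | split=> //; apply: mono].
    rewrite eq in e ht; have hci := tr_cols ht.
    have hs : sh i c by apply: (back c q) => //; lia.
    exists p; first by lia.
    by split; [rewrite -e; apply/esym/eqP|apply: trp].
- have := h1 p; rewrite /join_into -/p eqxx => hjp.
  have [|u [w [x [[e1 e2 e3 hu hw] [hx hTx hux epx]]]]] := hjp _; first by lia.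
  pose v' q := if q == p then u else if q == i then x else v q.
  have nip : (i == p) = false by lia.
  have cv' q : q < i -> cols (v' q) = cols (v q).
    move=> hq; rewrite /v'; case: eqP => [->//|_]; by rewrite ltn_eqF.
  have cover q c : q < i -> c \in cols (v q) -> exists2 q', q' <= i & at_ q' c = at_ q c /\ tr (v' q') c.
    move=> hq hc; have [|q' hq' [e ht]] := h3 q c _ hc; first by lia.
    have lt : q' < i by lia.
    case: (eqVneq q' p) => [eq|ne]; last first.
      by exists q'; [lia|split=> //; rewrite /v' (negPf ne) (ltn_eqF lt)].
    move: ht; rewrite eq -e3 tr_mk => /andP[hcu /orP[ht|ht]].
      by exists p; [lia|split; [rewrite -eq|rewrite /v' eqxx]].
    have hs : sh i c by have := allP hw _ ht; rewrite /= orbF.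
    have : tr (proj (sh i) w) c by rewrite tr_proj hs.
    rewrite -epx tr_proj => /andP[_ ht']; exists i => //; split; last by rewrite /v' nip eqxx.
    by rewrite -e eq; apply/eqP.
  exists v'; split.
  + move=> q hq; rewrite /v'; case: (eqVneq q p) => [->|ne] //; case: (eqVneq q i) => [->|ne2] //.
    by have := h1 q; rewrite /join_into -/p (negPf ne); apply; lia.
  + move=> q hq; case: (eqVneq q i) => [->|ne].
      have hpi : p < i by lia.
      rewrite -/p !cols_proj (cv' p hpi) -e2 {1}/v' nip eqxx -!cols_proj epx //.
    have h4 : q < i by lia.
    have h5 : pi q < i by apply: ltn_trans h4; apply: pi_lt; lia.
    by rewrite !cols_proj !cv' // -!cols_proj; apply: h2; lia.
  + move=> q c; rewrite leq_eqVlt => /orP[/eqP->|lt]; last by rewrite cv' //; apply: cover.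
    rewrite {1}/v' nip eqxx => hc; case: (boolP (sh i c)) => hs; last first.
      move: hc => /mapP[[c' b] hcb /= ec]; subst c'.
      have := allP hux _ hcb; rewrite /= (negPf hs) /= => /eqP eb; rewrite eb in hcb.
      by exists i => //; split=> //; rewrite /v' nip eqxx.
    have : c \in cols (proj (sh i) x) by rewrite cols_proj mem_filter hs.
    rewrite epx cols_proj e2 mem_filter => /andP[_ hcp].
    have [q' hq' [e ht]] := cover p c hp hcp; exists q' => //; split=> //.
    by rewrite e; apply/esym/eqP.
Qed.

(** At node 0 no colour is carried by an atom, so sanity leaves only the empty state there, for
    which the conditions on colours are void. *)
Lemma table_family_after_joins T0 : sane T0 -> (forall c, at_ 0 c = None) ->
  table_family g T0 <-> after_joins K g pi sh T0 g 0 [::].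
Proof.
move=> hT h0.
have hz z : z <= g -> sane (after_joins K g pi sh T0 z) /\
    (table_family g T0 <-> table_family (g - z) (after_joins K g pi sh T0 z)).
  elim: z => [|z IH] hz; first by rewrite subn0.
  have [s1 e1] := IH (ltnW hz).
  have hi : 0 < g - z <= g by lia.
  split; first exact: (sane_join (i := g - z) s1).
  by apply: (iff_trans e1); rewrite subnS; apply: table_family_join.
have [s1 ->] := hz g (leqnn g); rewrite subnn.
have nil v : after_joins K g pi sh T0 g 0 v -> v = [::].
  move=> h; have [_ ha] := s1 0 v (leq0n g) h; case: v ha {h} => // -[c b] v ha.
  by have := ha c; rewrite mem_head h0 => /(_ isT).
split=> [[v [h1 _ _]]|h].
  by have h := h1 0 (leqnn 0); rewrite -(nil _ h).
exists (fun _ => [::]); split=> // q; first by rewrite leqn0 => /eqP->.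
Qed.

End Elimination.

(** * Base-4 keys of labellings *)

Definition base4 (L : seq (nat * nat)) : nat := sumn [seq x.2 * 4 ^ x.1 | x <- L].

Lemma digit_block c c0 hi d lo : d < 4 -> lo < 4 ^ c0 ->
  digit c (hi * 4 ^ c0.+1 + (d * 4 ^ c0 + lo)) =
  if c < c0 then digit c lo else if c == c0 then d else digit (c - c0.+1) hi.
Proof.
move=> hd hlo; have p4 k : 0 < 4 ^ k by rewrite expn_gt0.
rewrite /digit; case: (ltngtP c c0) => hc.
- have -> : hi * 4 ^ c0.+1 + (d * 4 ^ c0 + lo) = ((hi * 4 + d) * 4 ^ (c0 - c.+1) * 4) * 4 ^ c + lo.
    have e : 4 ^ c0 = 4 ^ (c0 - c.+1) * 4 * 4 ^ c by rewrite -expnSr -expnD; congr (4 ^ _); lia.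
    rewrite expnS e; nia.
  by rewrite divnMDl // modnMDl.
- have e : 4 ^ c = 4 ^ c0.+1 * 4 ^ (c - c0.+1) by rewrite -expnD; congr (4 ^ _); lia.
  rewrite e divnMA divnMDl // [(_ + lo) %/ _]divn_small ?addn0 //.
  by rewrite expnS; nia.
- have -> : hi * 4 ^ c0.+1 + (d * 4 ^ c0 + lo) = (hi * 4 + d) * 4 ^ c + lo by rewrite hc expnS; nia.
  by rewrite divnMDl // divn_small ?hc // addn0 modnMDl modn_small.
Qed.

(** With digit 0 at [c0], the number splits into a high block, 0 and a low block, so placing [d]
    there causes no carry. *)
Lemma digit_add c0 c d N : d < 4 -> digit c0 N = 0 ->
  digit c (d * 4 ^ c0 + N) = if c == c0 then d else digit c N.
Proof.
move=> hd h0; have p4 k : 0 < 4 ^ k by rewrite expn_gt0.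
have [hi [lo [-> hlo]]] : exists hi lo, N = hi * 4 ^ c0.+1 + (0 * 4 ^ c0 + lo) /\ lo < 4 ^ c0.
  exists (N %/ 4 ^ c0.+1), (N %% 4 ^ c0); split; last by rewrite ltn_mod.
  have e1 := divn_eq N (4 ^ c0); have e2 := divn_eq (N %/ 4 ^ c0) 4.
  rewrite /digit in h0; rewrite h0 addn0 in e2.
  by rewrite mul0n add0n {1}e1 {1}e2 -divnMA -expnSr -mulnA -expnS.
have -> : d * 4 ^ c0 + (hi * 4 ^ c0.+1 + (0 * 4 ^ c0 + lo)) = hi * 4 ^ c0.+1 + (d * 4 ^ c0 + lo) by lia.
by rewrite !digit_block //; case: (ltngtP c c0).
Qed.

Lemma base4_digit L : uniq (unzip1 L) -> all (fun x => x.2 < 4) L ->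
  (forall c d, (c, d) \in L -> digit c (base4 L) = d) /\
  (forall c, c \notin unzip1 L -> digit c (base4 L) = 0).
Proof.
elim: L => [|[c0 d0] L IH] /=.
  by move=> _ _; split=> // c _; rewrite /base4 /digit /= div0n.
move=> /andP[h1 h2] /andP[h3 h4]; have [i1 i2] := IH h2 h4.
have e c : digit c (base4 ((c0, d0) :: L)) = if c == c0 then d0 else digit c (base4 L).
  by rewrite /base4 /= digit_add //; apply: i2.
split=> [c d|c]; rewrite inE e.
  rewrite xpair_eqE => /orP[/andP[-> /eqP->]//|hc]; case: eqP => [ec|_]; last exact: i1.
  by case/negP: h1; rewrite -ec; apply/mapP; exists (c, d).
by rewrite negb_or => /andP[/negPf-> /i2].
Qed.

(** Induction on [K]: positions are distinct, so at most one entry sits at the top position and adds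
    at most [3 * 4 ^ K]. *)
Lemma base4_bound K L : uniq (unzip1 L) -> all (fun x => x.2 < 4) L -> all (fun x => x.1 < K) L ->
  base4 L < 4 ^ K.
Proof.
elim: K L => [|K IH] L hu hd hk.
  by case: L hu hd hk => //= x L _ _ /andP[]; rewrite ltn0.
have hs : base4 L = base4 [seq x <- L | x.1 < K] + base4 [seq x <- L | ~~ (x.1 < K)].
  rewrite /base4 -sumn_cat -map_cat; apply: perm_sumn; apply: perm_map.
  by rewrite perm_sym; apply/permPl/perm_filterC.
have h1 : base4 [seq x <- L | x.1 < K] < 4 ^ K.
  apply: IH; first by apply: subseq_uniq hu; apply: map_subseq; apply: filter_subseq.
    by rewrite all_filter; apply: sub_all hd => x /= ->; rewrite implybT.
  by rewrite all_filter; apply/allP => x _ /=; rewrite implybb.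
have h2 : base4 [seq x <- L | ~~ (x.1 < K)] <= 3 * 4 ^ K.
  have : uniq (unzip1 [seq x <- L | ~~ (x.1 < K)]).
    by apply: subseq_uniq hu; apply: map_subseq; apply: filter_subseq.
  have : {in [seq x <- L | ~~ (x.1 < K)], forall x, x.1 = K /\ x.2 < 4}.
    move=> x; rewrite mem_filter => /andP[x1 x2]; split; last exact: (allP hd).
    by have := allP hk x x2; lia.
  case: [seq x <- L | ~~ (x.1 < K)] => [|x [|y l]] // h.
    have [e1 e2] := h x (mem_head _ _).
    by move=> _; rewrite /base4 /= addn0 e1 leq_mul2r -ltnS e2 orbT.
  have [ex _] := h x (mem_head _ _).
  have [|ey _] := h y; first by rewrite !inE eqxx orbT.
  by rewrite /= ex ey inE eqxx.
by rewrite hs expnS; lia.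
Qed.

Lemma map_inj_seq (T1 T2 : eqType) (f : T1 -> T2) (D : {pred T1}) (s t : seq T1) :
  {in D &, injective f} -> {subset s <= D} -> {subset t <= D} -> map f s = map f t -> s = t.
Proof.
move=> hf; elim: s t => [|x s IH] [|y t] //= hs ht [e1 e2]; congr (_ :: _).
  by apply: hf => //; [apply: hs|apply: ht]; rewrite mem_head.
by apply: IH => // z hz; [apply: hs|apply: ht]; rewrite inE hz orbT.
Qed.

(** * Families of bag states versus founded orders *)

Section Bags.

Variables (n g K : nat) (P : program 'I_n) (B : nat -> {set 'I_n}) (pi : nat -> nat)
  (col : nat -> nat) (hm : rule 'I_n -> nat).
Hypotheses (bag0 : B 0 = set0)
  (pi_lt : forall i, 0 < i <= g -> pi i < i)
  (rip : forall i j (a : 'I_n), j < i <= g -> a \in B i -> a \in B j -> a \in B (pi i))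
  (colK : forall q (a : 'I_n), q <= g -> a \in B q -> 0 < col a <= K)
  (col_inj : forall q (a b : 'I_n), q <= g -> a \in B q -> b \in B q -> col a = col b -> a = b)
  (hm_bag : forall r, r \in P -> hm r <= g /\ rule_atoms r \subset B (hm r)).
Implicit Types (a b : 'I_n) (r : rule 'I_n) (s : seq 'I_n) (v u w : state).

Definition at_ (q c : nat) : option 'I_n := [pick a in B q | col a == c.+1].

Lemma at_some q c a : q <= g -> at_ q c = Some a <-> a \in B q /\ col a = c.+1.
Proof.
move=> hq; rewrite /at_; case: pickP => [b /andP[hb /eqP eb]|hn].
  split=> [[<-] //|[ha ea]]; congr Some; apply: (col_inj hq) => //; by rewrite ea eb.
by split=> // -[ha ea]; have := hn a; rewrite ha ea eqxx.
Qed.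

Definition tint a : nat := (col a).-1.

Lemma at_tint q a : q <= g -> a \in B q -> at_ q (tint a) = Some a.
Proof.
move=> hq ha; apply/at_some => //; split=> //; rewrite /tint prednK //.
by have /andP[] := colK hq ha.
Qed.

Lemma tint_inj q : q <= g -> {in B q &, injective tint}.
Proof. by move=> hq a b ha hb e; have := at_tint hq ha; rewrite e (at_tint hq hb) => -[]. Qed.

Definition labels s o : seq (nat * nat) := [seq (tint a, label s o a) | a <- s].

Lemma label_lt s o a : label s o a < 4.
Proof. by rewrite /label; case: ifP => // _; case: o => // x; case: ifP => // _; case: ifP. Qed.

Lemma unzip1_labels s o : unzip1 (labels s o) = map tint s.
Proof. by rewrite /unzip1 -map_comp. Qed.

Lemma rule_fires_labels q r s o : q <= g -> rule_atoms r \subset B q -> uniq s -> {subset s <= B q} ->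
  (if o is Some x then x \in s else true) ->
  rule_fires K col r (base4 (labels s o)) = rule_fires_at r s o.
Proof.
move=> hq /subsetP hr hu hs ho.
have hut : uniq (map tint s) by rewrite map_inj_in_uniq // => a b /hs ha /hs hb; apply: tint_inj ha hb.
have [d1 d2] : (forall c d, (c, d) \in labels s o -> digit c (base4 (labels s o)) = d) /\
  (forall c, c \notin map tint s -> digit c (base4 (labels s o)) = 0).
  rewrite -(unzip1_labels s o); apply: base4_digit; rewrite ?unzip1_labels //.
  by apply/allP => x /mapP[a _ ->]; apply: label_lt.
have hcol (X : {set 'I_n}) a : X \subset B q -> a \in B q -> has_col col X (tint a) = (a \in X).
  move=> /subsetP hX ha; apply/existsP/idP => [[b /andP[hb /eqP eb]]|hh]; last first.
    by exists a; rewrite hh /tint prednK ?eqxx //; have /andP[] := colK hq ha.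
  rewrite (_ : a = b) //; apply: (tint_inj hq) => //; first exact: hX.
  by rewrite [tint b]/tint eb.
have sh : rhead r \subset B q by apply/subsetP => a h; apply: hr; rewrite !inE h.
have sp : rpos r \subset B q by apply/subsetP => a h; apply: hr; rewrite !inE h orbT.
have sn : rneg r \subset B q by apply/subsetP => a h; apply: hr; rewrite !inE h !orbT.
have dig a : a \in B q -> digit (tint a) (base4 (labels s o)) = label s o a.
  move=> ha; case: (boolP (a \in s)) => has.
    by apply: d1; apply: map_f.
  rewrite d2; first by rewrite /label has.
  by apply/negP => /mapP[b hb eb]; move: has; rewrite (tint_inj hq ha (hs _ hb) eb) hb.
apply/allP/forallP => [h a|h c].
  case: (boolP (a \in B q)) => ha.
    have := h (tint a); rewrite !hcol // dig //; apply; rewrite mem_iota add0n /=.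
    by rewrite /tint; have := colK hq ha; lia.
  have nh (X : {set 'I_n}) : X \subset B q -> (a \in X) = false.
    by move=> /subsetP hX; apply: contraNF ha; apply: hX.
  rewrite !nh // /label; have -> : a \notin s by apply: contra ha; apply: hs.
  by [].
move=> hc; case e : (at_ q c) => [a|].
  have [ha hca] := proj1 (at_some c a hq) e.
  have -> : c = tint a by rewrite /tint hca.
  by rewrite !hcol // dig.
(* A colour carried by no atom of the bag has digit 0 and lies in none of the three sets, which
   [digit_ok] accepts. *)
have nh (X : {set 'I_n}) : X \subset B q -> has_col col X c = false.
  move=> /subsetP hX; rewrite /has_col; apply/existsP => -[a /andP[ha /eqP ea]].
  by have := proj2 (at_some c a hq) (conj (hX _ ha) ea); rewrite e.
rewrite !nh // d2 //; apply/negP => /mapP[a ha ea].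
by have := at_tint hq (hs _ ha); rewrite -ea e.
Qed.

Lemma base4_cat L L' : base4 (L ++ L') = base4 L + base4 L'.
Proof. by rewrite /base4 map_cat sumn_cat. Qed.

Lemma base4_labels_none s v : cols v = map tint s -> base4 (labels s None) = key2 v.
Proof.
move=> e; rewrite /base4 /labels /key2 -map_comp.
rewrite (eq_in_map _ (fun a => 4 ^ tint a + 4 ^ tint a) _).1; last first.
  by move=> a ha /=; rewrite /label ha /=; lia.
rewrite (map_comp (fun c => 4 ^ c + 4 ^ c) tint) -e /cols /unzip1 -map_comp //.
Qed.

Lemma base4_labels_some s u c (b : bool) w : uniq s -> map tint s = cols (u ++ (c, b) :: w) ->
  exists x, [/\ x \in s, tint x = c &
    base4 (labels s (Some x)) = key2 u + (4 ^ c + (4 ^ c + (4 ^ c + key1 w)))].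
Proof.
move=> hu e; rewrite /cols /unzip1 map_cat /= in e.
have hsz : size u < size s by rewrite -(size_map tint s) e size_cat /= !size_map; lia.
have x0 : 'I_n by case: (s) hsz => [|x0 l].
pose s1 := take (size u) s; pose s2 := drop (size u).+1 s; pose x := nth x0 s (size u).
have es : s = s1 ++ x :: s2 by rewrite /s1 /s2 -drop_nth // cat_take_drop.
have sz1 : size s1 = size u by rewrite size_take hsz.
move: e hu; rewrite es map_cat /= => /eqP; rewrite eqseq_cat ?size_map // => /andP[/eqP e1 /eqP[ec e2]].
rewrite cat_uniq => /and3P[_ /= hx /andP[hx2 _]].
have {hx}[hx1 hs2] : x \notin s1 /\ {in s2, forall a, a \notin s1}.
  by move: hx; rewrite negb_or => /andP[-> /hasPn].
exists x; split=> //; first by rewrite mem_cat mem_head orbT.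
have ix : index x (s1 ++ x :: s2) = size s1 by rewrite index_cat (negPf hx1) /= eqxx addn0.
rewrite /labels map_cat base4_cat /=.
congr (_ + _).
  rewrite /base4 /key2 -map_comp.
  rewrite (eq_in_map _ (fun a => 4 ^ tint a + 4 ^ tint a) _).1; last first.
    move=> a ha /=; rewrite /label mem_cat ha /= ix index_cat ha index_mem ha.
    have -> : (a == x) = false by apply: contraNF hx1 => /eqP<-.
    by lia.
  by rewrite (map_comp (fun c => 4 ^ c + 4 ^ c) tint) e1 -map_comp.
rewrite /base4 /= -map_comp.
have -> : label (s1 ++ x :: s2) (Some x) x = 3 by rewrite /label mem_cat mem_head orbT eqxx.
rewrite (eq_in_map _ (fun a => 4 ^ tint a) _).1; last first.
  move=> a ha /=; rewrite /label mem_cat inE ha !orbT /= ix index_cat (negPf (hs2 a ha)) /=.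
  have nax : (a == x) = false by apply: contraNF hx2 => /eqP<-.
  by rewrite nax eq_sym nax ltnNge leq_addr /= mul1n.
rewrite (map_comp (fun c => 4 ^ c) tint) e2 -map_comp ec.
have -> : sumn [seq ((fun c => 4 ^ c) \o fst) i | i <- w] = key1 w by [].
by lia.
Qed.

Definition fire_table q key : bool := [exists r in P, (hm r == q) && rule_fires K col r key].
Definition initial_table q v : Prop := valid K v /\ init_ok (fire_table q) (fun c => isSome (at_ q c)) v.

Lemma cols_split v c : c \in cols v -> exists u (b : bool) w, v = u ++ (c, b) :: w.
Proof.
by move=> /mapP[[c' b] h /= ->]; case/splitPr: h => u w; exists u, b, w.
Qed.

Lemma tr_split v c : tr v c -> exists u w, v = u ++ (c, true) :: w.
Proof. by rewrite /tr => h; case/splitPr: h => u w; exists u, w. Qed.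

Lemma initial_sane : sane K g at_ initial_table.
Proof.
move=> q v hq [h1 [_ h2]]; split=> // c /cols_split [u [b [w e]]].
by have /andP[] := h2 u c b w e.
Qed.

(** Filtering preserves relative positions, so labels inside [X] do not change. An atom outside [X]
    belongs to no part of the rule and is not the derived atom; its label is at most 2, which the
    test accepts. *)
Lemma rule_fires_restrict r s o (X : {set 'I_n}) : rule_atoms r \subset X ->
  (if o is Some x then x \in X else true) ->
  rule_fires_at r s o = rule_fires_at r [seq a <- s | a \in X] o.
Proof.
move=> /subsetP hr ho; apply: eq_forallb => a; case: (boolP (a \in X)) => ha.
  congr digit_ok; rewrite /label mem_filter ha /=; case: o ho => // x hx.
  by rewrite (index_filter (a := fun z => z \in X)).
have na (Y : {set 'I_n}) : Y \subset rule_atoms r -> (a \in Y) = false.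
  by move=> /subsetP hY; apply: contraNF ha => /hY; apply: hr.
have l2 t : label t o a <= 2.
  rewrite /label; case: (a \in t) => //=; case: o ho => // x hx.
  by rewrite (_ : (a == x) = false); [case: ifP | apply: contraNF ha => /eqP->].
have sh : rhead r \subset rule_atoms r by apply/subsetP => b h; rewrite !inE h.
have sp : rpos r \subset rule_atoms r by apply/subsetP => b h; rewrite !inE h orbT.
have sn : rneg r \subset rule_atoms r by apply/subsetP => b h; rewrite !inE h !orbT.
by rewrite !na // /digit_ok !l2.
Qed.

Lemma shared_tint q a : 0 < q <= g ->
  (a \in B q -> sh pi at_ q (tint a) = (a \in B (pi q))) /\
  (a \in B (pi q) -> sh pi at_ q (tint a) = (a \in B q)).
Proof.
move=> hq; have hp := pi_lt hq; have hq1 : q <= g by case/andP: hq.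
have hp1 : pi q <= g by lia.
split=> ha; rewrite /sh (at_tint _ ha) //; apply/eqP/idP => [h|h].
- by have [] := proj1 (at_some (tint a) a hp1) (esym h).
- by rewrite at_tint.
- by have [] := proj1 (at_some (tint a) a hq1) h.
- by rewrite at_tint.
Qed.

(** Each state decodes through [at_] into an order [d q] of atoms of its bag. These orders agree
    along the edges and amalgamate into one order that induces [d q] on every bag, so each rule can
    be evaluated in its home bag. *)
Lemma initial_family_founded :
  table_family pi at_ g initial_table -> exists s, founded P s.
Proof.
move=> [v [h1 h2 h3]].
pose d q := pmap (at_ q) (cols (v q)).
have hd q : q <= g -> map tint (d q) = cols (v q) /\ {subset d q <= B q}.
  move=> hq; rewrite /d; have [_] := initial_sane hq (h1 q hq).
  elim: (cols (v q)) => //= c cs IH hc.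
  have [i1 i2] : map tint (pmap (at_ q) cs) = cs /\ {subset pmap (at_ q) cs <= B q}.
    by apply: IH => c' h'; apply: hc; rewrite inE h' orbT.
  have := hc c (mem_head _ _); case e : (at_ q c) => [a|] //= _.
  have [ha hca] := proj1 (at_some c a hq) e.
  split; first by rewrite i1 /tint hca.
  by move=> b; rewrite inE => /orP[/eqP->//|/i2].
have hdu q : q <= g -> uniq (d q).
  move=> hq; have [e _] := hd q hq; apply: (@map_uniq _ _ tint).
  by rewrite e; have [] := initial_sane hq (h1 q hq) => /andP[].
have hcons q : 0 < q <= g -> [seq a <- d q | a \in B (pi q)] = [seq a <- d (pi q) | a \in B q].
  move=> hq; have hp := pi_lt hq; have hq1 : q <= g by case/andP: hq.
  have hp1 : pi q <= g by lia.
  have [e1 s1] := hd q hq1; have [e2 s2] := hd (pi q) hp1.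
  have := h2 q hq; rewrite !cols_proj -e1 -e2 !filter_map.
  rewrite (eq_in_filter (a2 := fun a => a \in B (pi q)) (s := d q)); last first.
    by move=> a /s1 ha; apply: (proj1 (shared_tint a hq)).
  rewrite (eq_in_filter (a2 := fun a => a \in B q) (s := d (pi q))); last first.
    by move=> a /s2 ha; apply: (proj2 (shared_tint a hq)).
  apply: (map_inj_seq (tint_inj hq1)) => a; rewrite mem_filter => /andP[] //.
  by move=> _ /s1.
(* Bags are added by increasing number: by running intersection, bag [m + 1] meets the order built
   so far only inside the parent bag, where both orders agree. *)
have glob m : m <= g -> exists s, [/\ uniq s, forall q, q <= m -> [seq a <- s | a \in B q] = d q
    & forall a, a \in s -> exists2 q, q <= m & a \in B q].
  elim: m => [|m IH] hmg.
    exists [::]; split=> // q; rewrite leqn0 => /eqP->.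
    case: (d 0) (proj2 (hd 0 (leq0n _))) => //= a l h.
    by have := h a (mem_head _ _); rewrite bag0 inE.
  have [s [us hs hb]] := IH (ltnW hmg).
  have hq : 0 < m.+1 <= g by [].
  have hp := pi_lt hq; set p := pi m.+1 in hp *.
  have hpm : p <= m by [].
  have ep := hs p hpm; have ec := hcons _ hq; rewrite -/p in ec.
  have [_ sd] := hd _ hmg.
  have rp a : a \in s -> a \in B m.+1 -> a \in B p.
    move=> has ham; have [j hj hja] := hb a has; apply: rip ham hja.
    by rewrite ltnS hj.
  have ds a : a \in d m.+1 -> (a \in s) = (a \in B p).
    move=> ha; apply/idP/idP => [h|h]; first by apply: rp => //; apply: sd.
    have : a \in [seq a <- d m.+1 | a \in B p] by rewrite mem_filter h.
    by rewrite ec -ep !mem_filter => /and3P[].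
  have sdm a : a \in s -> (a \in d m.+1) = (a \in B m.+1) && (a \in B p).
    move=> has; apply/idP/andP => [h|[k1 k2]].
      by have := sd _ h; split=> //; rewrite -ds.
    have : a \in [seq a <- d p | a \in B m.+1] by rewrite mem_filter k1 -ep mem_filter k2.
    by rewrite -ec mem_filter => /andP[].
  have [|t [ut t1 t2 t3]] := amalgamation us (hdu _ hmg).
    rewrite (eq_in_filter (a2 := fun a => (a \in B m.+1) && (a \in B p))); last exact: sdm.
    by rewrite filter_predI ep (eq_in_filter ds) ec.
  have tB a : a \in t -> (a \in s) || (a \in d m.+1) by move=> /t3; rewrite mem_cat.
  exists t; split=> //.
    move=> q; rewrite leq_eqVlt => /orP[/eqP->|hqm].
      rewrite -[RHS]t2; apply: eq_in_filter => a hat.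
      case: (boolP (a \in d m.+1)) => [/sd->//|hna]; apply/negP => ham.
      have has : a \in s by have := tB a hat; rewrite (negPf hna) orbF.
      by have := sdm a has; rewrite (negPf hna) ham rp.
    rewrite -(hs q hqm) -[in RHS]t1 -filter_predI; apply: eq_in_filter => a hat /=.
    case: (boolP (a \in B q)) => //= haq; apply/esym.
    case/orP: (tB a hat) => // had; rewrite ds //.
    by apply: rip (sd _ had) haq; rewrite hqm.
  move=> a /tB /orP[/hb [q k1 k2]|/sd h]; first by exists q => //; apply: leqW.
  by exists m.+1.
have [s [us hs hb]] := glob g (leqnn g).
have fr r : r \in P -> rule_fires_at r s None = rule_fires K col r (key2 (v (hm r))).
  move=> hr; have [hq hsub] := hm_bag hr; have [e1 s1] := hd _ hq.
  rewrite (rule_fires_restrict _ hsub) // hs // -(rule_fires_labels hq hsub (hdu _ hq) s1) //.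
  by rewrite (base4_labels_none (esym e1)).
exists s; split=> //.
  move=> r hr; rewrite fr //; have [hq _] := hm_bag hr.
  have [_ [hn _]] := h1 _ hq; apply: contra hn => hf.
  by apply/existsP; exists r; rewrite hr eqxx.
move=> x hx; have [q hq hxq] := hb x hx.
have [e1 s1] := hd q hq.
have hxd : x \in d q by rewrite -hs // mem_filter hxq.
have hc : tint x \in cols (v q) by rewrite -e1 map_f.
have [q' hq' [e ht]] := h3 q _ hq hc.
have [u [w ev]] := tr_split ht; have [_ [_ hent]] := h1 q' hq'.
have [e2 s2] := hd q' hq'.
have /andP[_ /= /existsP[r /and3P[hr /eqP er hf]]] := hent _ _ _ _ ev.
have [x' [x1 x2 x3]] := @base4_labels_some (d q') u (tint x) true w (hdu _ hq') (etrans e2 (congr1 cols ev)).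
rewrite -x3 in hf; have [_ hsub] := hm_bag hr; rewrite er in hsub.
rewrite (rule_fires_labels hq' hsub (hdu _ hq') s2 (o := Some x')) // in hf.
(* The colour stands for the same atom in [q] and [q'], so the atom found in [q'] is [x]. *)
have exx : x' = x.
  have := at_tint hq' (s2 _ x1); rewrite x2 e at_tint // => -[] //.
exists r => //; rewrite (rule_fires_restrict _ hsub) ?hs // -exx //.
exact: s2.
Qed.

(** The order is restricted to each bag. The rule deriving an atom sets its bit in the home of the
    rule, and this bag contains the atom because it is a head atom of the rule. *)
Lemma founded_initial_family s :
  founded P s -> table_family pi at_ g initial_table.
Proof.
move=> [us hn hf].
pose d q := [seq a <- s | a \in B q].
pose bit q a := [exists r in P, (hm r == q) && rule_fires_at r s (Some a)].
pose v q : state := [seq (tint a, bit q a) | a <- d q].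
have ev q : map tint (d q) = cols (v q) by rewrite /v /cols /unzip1 -map_comp.
have sd q : {subset d q <= B q} by move=> a; rewrite mem_filter => /andP[].
have ud q : uniq (d q) by apply: filter_uniq.
exists v; split.
- move=> q hq; split.
    rewrite /valid -ev map_inj_in_uniq ?ud /=; last by move=> a b /sd ha /sd hb; apply: (tint_inj hq).
    apply/allP => c /mapP[a /sd ha ->]; have := colK hq ha; rewrite /tint; lia.
  split.
    apply/negP => /existsP[r /and3P[hr /eqP er hfr]]; have [_ hsub] := hm_bag hr; rewrite er in hsub.
    rewrite -(base4_labels_none (esym (ev q))) (rule_fires_labels hq hsub (ud q) (@sd q)) // in hfr.
    by have := hn r hr; rewrite (rule_fires_restrict _ hsub) // hfr.
  move=> u c b w e; have [x [x1 x2 x3]] := base4_labels_some (ud q) (etrans (ev q) (congr1 cols e)).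
  apply/andP; split; first by rewrite -x2 (at_tint hq (sd _ _ x1)).
  have : (c, b) \in v q by rewrite e mem_cat mem_head orbT.
  move=> /mapP[a ha [ec eb]]; have eax : a = x.
    by apply: (tint_inj hq); rewrite ?(sd _ _ ha) ?(sd _ _ x1) // x2 ec.
  apply/implyP; rewrite eb eax => /existsP[r /and3P[hr /eqP er hfr]].
  have [_ hsub] := hm_bag hr; rewrite er in hsub.
  apply/existsP; exists r; rewrite hr er eqxx /= -x3 (rule_fires_labels hq hsub (ud q) (@sd q) (o := Some x)) //.
  by rewrite -(rule_fires_restrict _ hsub (o := Some x)) ?(sd _ _ x1).
- move=> q hq; rewrite !cols_proj -!ev !filter_map; congr map.
  rewrite (eq_in_filter (a2 := fun a => a \in B (pi q)) (s := d q)); last first.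
    by move=> a /sd ha; apply: (proj1 (shared_tint a hq)).
  rewrite (eq_in_filter (a2 := fun a => a \in B q) (s := d (pi q))); last first.
    by move=> a /sd ha; apply: (proj2 (shared_tint a hq)).
  by rewrite /d -!filter_predI; apply: eq_filter => a /=; rewrite andbC.
- move=> q c hq; rewrite -ev => /mapP[a ha ->].
  have has : a \in s by move: ha; rewrite mem_filter => /andP[].
  have [r hr hfr] := hf a has; have [hq' /subsetP hsub] := hm_bag hr.
  (* The label of [a] seen from itself is 3, which [digit_ok] accepts only for head atoms. *)
  have hah : a \in B (hm r).
    apply: hsub; have /forallP/(_ a)/and3P[] := hfr; rewrite /label has /= eqxx.
    by case: (boolP (a \in rhead r)) => // h _ _ _; rewrite !inE h.
  exists (hm r) => //; split; first by rewrite !at_tint // sd.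
  rewrite /tr; apply/mapP; exists a; first by rewrite mem_filter hah.
  congr (_, _); apply/esym/existsP; exists r; by rewrite hr eqxx.
Qed.

Lemma at0 c : at_ 0 c = None.
Proof. by rewrite /at_; case: pickP => // a; rewrite bag0 inE. Qed.

Lemma rip_at i j c : j < i <= g -> at_ i c -> at_ i c = at_ j c -> at_ (pi i) c = at_ i c.
Proof.
move=> hij; have [h1 h2] := andP hij; have hj : j <= g by lia.
have hp : pi i <= g by have := pi_lt (i := i); lia.
case ei : (at_ i c) => [a|] // _ ej.
have [ha hc] := proj1 (at_some c a h2) ei.
have [haj _] := proj1 (at_some c a hj) (esym ej).
by apply/at_some => //; split=> //; apply: rip haj.
Qed.

Lemma joins_founded :
  after_joins K g pi (sh pi at_) initial_table g 0 [::] <-> exists s, founded P s.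
Proof.
rewrite -(table_family_after_joins pi_lt rip_at initial_sane at0).
by split=> [/initial_family_founded|[s /founded_initial_family]].
Qed.

End Bags.

(** * Growth of the running time *)

(** From [k0] on the quotient of [f] by [h] does not increase, and up to [k0] monotonicity gives
    [f k <= f k0] with [h k >= 1]. Hence [f k0] is a suitable constant. *)
Lemma bounded_ratio (f h : nat -> nat) (k0 : nat) :
  {homo f : i j / i <= j} -> (forall k, 0 < f k) -> (forall k, 0 < h k) ->
  (forall k, k0 <= k -> f k.+1 * h k <= f k * h k.+1) ->
  exists C, forall k, f k <= C * h k.
Proof.
move=> hf f0 h0 hs; exists (f k0) => k.
case: (leqP k k0) => hk; first by apply: leq_trans (hf _ _ hk) _; apply: leq_pmulr.
rewrite -(subnK (ltnW hk)); elim: (k - k0) => [|d IH]; first exact: leq_pmulr.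
rewrite addSn; have h1 := hs (d + k0) (leq_addl _ _).
rewrite -(leq_pmul2r (h0 (d + k0))); apply: leq_trans h1 _.
by rewrite -mulnA [h _ * h _]mulnC mulnA leq_mul2r IH orbT.
Qed.

(* The three leading terms of the binomial expansion, doubled. *)
Lemma binomial3 (k n : nat) :
  k ^ n * (2 * k ^ 2 + 2 * n.+2 * k + n.+2 * n.+1) <= 2 * k.+1 ^ n.+2.
Proof.
elim: n => [|n IH]; first by rewrite expn0 mul1n; nia.
have -> : 2 * k.+1 ^ n.+3 = (2 * k.+1 ^ n.+2) * k.+1 by rewrite [k.+1 ^ n.+3]expnSr mulnA.
apply: leq_trans (_ : k ^ n * (2 * k ^ 2 + 2 * n.+2 * k + n.+2 * n.+1) * k.+1 <= _); last by rewrite leq_mul2r IH orbT.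
rewrite expnSr -!mulnA leq_mul2l; apply/orP; right.
rewrite !expnS expn0; nia.
Qed.

(* (1 + 1/k)^k >= 12/5, which beats the growth of 2^k *)
Lemma succ_pow_ge k : 5 <= k -> 12 * k ^ k <= 5 * k.+1 ^ k.
Proof.
case: k => [//|[//|n]] hk; have := binomial3 n.+2 n.
have -> : n.+2 ^ n.+2 = n.+2 ^ n * n.+2 ^ 2 by rewrite -expnD addn2.
set a := n.+2 ^ n; set b := n.+3 ^ n.+2; move=> h.
have : 24 * (a * n.+2 ^ 2) <= 10 * b; last by lia.
have e : 5 * (a * (2 * n.+2 ^ 2 + 2 * n.+2 * n.+2 + n.+2 * n.+1)) <= 10 * b by lia.
apply: leq_trans e; rewrite mulnCA [5 * _]mulnCA leq_mul2l; apply/orP; right.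
rewrite !expnS expn0; nia.
Qed.

(** From 23 on, the square grows by a factor of at most 12/11, and (12/11)^2 = 144/121 is below
    6/5. *)
Lemma quartic_step x : 23 <= x -> 10 * x.+1 ^ 4 <= 12 * x ^ 4.
Proof.
move=> hx; have h2 : 11 * x.+1 ^ 2 <= 12 * x ^ 2 by rewrite !expnS !expn0; nia.
have -> : x.+1 ^ 4 = x.+1 ^ 2 * x.+1 ^ 2 by rewrite -expnD.
have -> : x ^ 4 = x ^ 2 * x ^ 2 by rewrite -expnD.
by move: (x.+1 ^ 2) (x ^ 2) h2 => a b h2; nia.
Qed.

(** Majorises the first summand of [growth k.+1] up to the factor 2: going from k to k + 1 in 2^k k!
    brings the factor 2 (k + 1), and k + 1 is at most (k + 2)^2, whence the fourth power. *)
Definition main_term k : nat := k.+2 ^ 4 * (2 ^ k * k`!).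

Lemma main_term_mono : {homo main_term : i j / i <= j}.
Proof.
move=> i j hij; rewrite /main_term; apply: leq_mul; first by rewrite leq_exp2r.
apply: leq_mul; first by rewrite leq_exp2l.
elim: j hij => [|j IH]; first by rewrite leqn0 => /eqP->.
rewrite leq_eqVlt => /orP[/eqP->//|/IH{}IH]; apply: leq_trans IH _.
by rewrite factS leq_pmull.
Qed.

(** From k to k + 1, the left side grows by at most 6/5 for the polynomial, times 2, times k + 1;
    the right side grows by at least 12/5 times k + 1 ([succ_pow_ge]). These balance since 6/5 times
    2 is 12/5. The threshold 21 comes from [quartic_step] at k + 2. *)
Lemma main_term_pow : exists C, forall k, main_term k <= C * k ^ k.
Proof.
apply: (@bounded_ratio _ (fun k => k ^ k) 21 main_term_mono).
- by move=> k; rewrite !muln_gt0 !expn_gt0 fact_gt0.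
- by case=> // k; rewrite expn_gt0.
move=> k hk; rewrite /main_term factS.
have h1 : 10 * k.+3 ^ 4 <= 12 * k.+2 ^ 4 by apply: quartic_step; lia.
have h2 : 12 * k ^ k <= 5 * k.+1 ^ k by apply: succ_pow_ge; lia.
have e1 : 2 ^ k.+1 = 2 * 2 ^ k by rewrite expnS.
have e2 : k.+1 ^ k.+1 = k.+1 * k.+1 ^ k by rewrite expnS.
rewrite e1 e2.
move: (k.+3 ^ 4) (k.+2 ^ 4) (2 ^ k) (k`!) (k ^ k) (k.+1 ^ k) h1 h2 => a b c d u v h1 h2.
have h : 2 * (a * u) <= b * v.
  have : (10 * a) * (12 * u) <= (12 * b) * (5 * v) by apply: leq_mul.
  by nia.
have -> : a * (2 * c * (k.+1 * d)) * u = (2 * (a * u)) * (c * (k.+1 * d)) by nia.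
have -> : b * (c * d) * (k.+1 * v) = (b * v) * (c * (k.+1 * d)) by nia.
by rewrite leq_mul2r h orbT.
Qed.

(** Here the comparison is between 6/5 times 2 and 3, the factor k + 1 being common to both
    sides. *)
Lemma main_term_fact : exists C, forall k, main_term k <= C * (3 ^ k * k`!).
Proof.
apply: (@bounded_ratio _ (fun k => 3 ^ k * k`!) 21 main_term_mono).
- by move=> k; rewrite !muln_gt0 !expn_gt0 fact_gt0.
- by move=> k; rewrite muln_gt0 expn_gt0 fact_gt0.
move=> k hk; rewrite /main_term factS.
have h1 : 10 * k.+3 ^ 4 <= 12 * k.+2 ^ 4 by apply: quartic_step; lia.
have e1 m : m ^ k.+1 = m * m ^ k by rewrite expnS.
rewrite !e1.
move: (k.+3 ^ 4) (k.+2 ^ 4) (2 ^ k) (k`!) (3 ^ k) h1 => a b c d u h1.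
have -> : a * (2 * c * (k.+1 * d)) * (u * d) = (2 * a) * (c * (k.+1 * d) * (u * d)) by nia.
have -> : b * (c * d) * (3 * u * (k.+1 * d)) = (3 * b) * (c * (k.+1 * d) * (u * d)) by nia.
by rewrite leq_mul2r; apply/orP; right; lia.
Qed.

Lemma exp64_pow : exists C, forall k, 64 ^ k <= C * k ^ k.
Proof.
apply: (@bounded_ratio (expn 64) (fun k => k ^ k) 64).
- by move=> i j hij; rewrite leq_exp2l.
- by move=> k; rewrite expn_gt0.
- by case=> // k; rewrite expn_gt0.
move=> k hk; have e1 : 64 ^ k.+1 = 64 ^ k * 64 by rewrite expnSr.
rewrite e1 -mulnA leq_mul2l [k.+1 ^ _]expnS; apply/orP; right.
apply: leq_mul; first by lia.
by case: k hk {e1} => // k _; rewrite leq_exp2r.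
Qed.

Lemma exp64_fact : exists C, forall k, 64 ^ k <= C * (3 ^ k * k`!).
Proof.
apply: (@bounded_ratio (expn 64) (fun k => 3 ^ k * k`!) 64).
- by move=> i j hij; rewrite leq_exp2l.
- by move=> k; rewrite expn_gt0.
- by move=> k; rewrite muln_gt0 expn_gt0 fact_gt0.
move=> k hk; rewrite factS.
have e1 m : m ^ k.+1 = m * m ^ k by rewrite expnS.
rewrite !e1; move: (64 ^ k) (3 ^ k) (k`!) => a b c.
have -> : a * (3 * b * (k.+1 * c)) = (3 * k.+1) * (a * (b * c)) by nia.
by rewrite -mulnA leq_mul2r; apply/orP; right; lia.
Qed.

(* The first summand pays for the joins, the second for testing 8^K rules per bag on 4^K keys. *)
Definition growth (K : nat) : nat := K.+1 ^ 2 * (2 ^ K * K`!) + 64 ^ K.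

Lemma growth_mono : {homo growth : i j / i <= j}.
Proof.
move=> i j hij; apply: leq_add; last by rewrite leq_exp2l.
apply: leq_mul; first by rewrite leq_exp2r.
apply: leq_mul; first by rewrite leq_exp2l.
elim: j hij => [|j IH]; first by rewrite leqn0 => /eqP->.
rewrite leq_eqVlt => /orP[/eqP->//|/IH{}IH]; apply: leq_trans IH _.
by rewrite factS leq_pmull.
Qed.

Lemma growth_succ k : growth k.+1 <= 2 * main_term k + 64 * 64 ^ k.
Proof.
rewrite /growth /main_term; have -> : 64 ^ k.+1 = 64 * 64 ^ k by rewrite expnS.
rewrite leq_add2r factS [2 ^ k.+1]expnS.
have -> : k.+2 ^ 4 = k.+2 ^ 2 * k.+2 ^ 2 by rewrite -expnD.
have h : k.+1 <= k.+2 ^ 2 by rewrite expnS expn1; nia.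
move: (k.+2 ^ 2) (2 ^ k) (k`!) h => a b c h.
have -> : a * (2 * b * (k.+1 * c)) = k.+1 * (2 * (a * b * c)) by nia.
have -> : 2 * (a * a * (b * c)) = a * (2 * (a * b * c)) by nia.
by rewrite leq_mul2r h orbT.
Qed.

Lemma growth_pow : exists C, forall k, growth k.+1 <= C * k ^ k.
Proof.
have [C1 h1] := main_term_pow; have [C2 h2] := exp64_pow.
exists (2 * C1 + 64 * C2) => k; apply: leq_trans (growth_succ k) _.
have e1 := h1 k; have e2 := h2 k; move: (main_term k) (64 ^ k) (k ^ k) e1 e2 => a b c; nia.
Qed.

Lemma growth_fact : exists C, forall k, growth k.+1 <= C * (3 ^ k * k`!).
Proof.
have [C1 h1] := main_term_fact; have [C2 h2] := exp64_fact.
exists (2 * C1 + 64 * C2) => k; apply: leq_trans (growth_succ k) _.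
have e1 := h1 k; have e2 := h2 k; move: (main_term k) (64 ^ k) (3 ^ k * k`!) e1 e2 => a b c; nia.
Qed.

Lemma INR_expn m n : INR (m ^ n) = pow (INR m) n.
Proof. by elim: n => [|n IH]; rewrite ?expn0 // expnS mult_INR IH. Qed.

(* ln 0 = 0, so that both sides are 1 for k = 0. *)
Lemma Rpower_log2 k : Rpower 2 (INR k * log2 (INR k))%Re = INR (k ^ k).
Proof.
case: k => [|k]; first by rewrite /= Rmult_0_l Rpower_O //; lra.
have hk : (0 < INR k.+1)%Re by apply: lt_0_INR; apply/ltP.
have h2 : (ln 2 <> 0)%Re by apply: Rgt_not_eq; rewrite -ln_1; apply: ln_increasing; lra.
rewrite INR_expn -Rpower_pow // /Rpower /log2; congr exp.
by field.
Qed.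

(** * Correctness of the program *)

Section NumberedBags.

Variables (n g : nat) (P : program 'I_n) (root : 'I_g) (par : 'I_g -> 'I_g) (chi : 'I_g -> {set 'I_n}).
Hypothesis td : tree_decomposition (atoms P) (primal_edge P) root par chi.
Variables (pf od pi : nat -> nat).
Hypotheses (pfE : forall t : 'I_g, pf t = par t) (num : numbering g root pf od pi).

Definition bag (i : nat) : {set 'I_n} :=
  if i is 0 then set0 else if insub (od i) is Some t then chi t else set0.

Lemma bagE i (t : 'I_g) : 0 < i -> od i = t -> bag i = chi t.
Proof. by case: i => // i _ /= e; rewrite e valK. Qed.

Lemma node_of i : 0 < i <= g -> exists t : 'I_g, od i = t /\ bag i = chi t.
Proof.
move=> hi; have [_ h _ _ _] := num; exists (Ordinal (h i hi)); split=> //.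
by apply: bagE => //; case/andP: hi.
Qed.

Lemma number_of (t : 'I_g) : exists2 i, 0 < i <= g & od i = t /\ bag i = chi t.
Proof.
have [_ _ _ h _] := num; have [i hi e] := h t (ltn_ord t).
by exists i => //; split=> //; apply: bagE => //; case/andP: hi.
Qed.

Lemma pi_lt i : 0 < i <= g -> pi i < i.
Proof.
case: i => [//|[|i]] hi; first by have [[_ ->] _ _ _ _] := num.
by have [_ _ _ _ h] := num; have [|/andP[]] := h i.+2.
Qed.

Lemma bag_bound K i : \max_(t : 'I_g) scard (chi t) = K -> scard (bag i) <= K.
Proof.
move=> hK; rewrite /bag; case: i => [|i]; first by rewrite /scard cards0.
by case: insubP => [t _ _|_]; [rewrite -hK (leq_bigmax t) | rewrite /scard cards0].
Qed.

(** Each step to the parent lowers the number, except at the root, which has number 1 and is its own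
    parent. *)
Lemma ancestor_number (s t : 'I_g) i j : 0 < i <= g -> 0 < j <= g -> od i = s -> od j = t ->
  fconnect par t s -> i <= j.
Proof.
move=> hi hj es et /iter_findex; move: (findex par t s) => k.
have [[o1 _] _ oinj _ op] := num.
elim: k t j hj et => [|k IH] t j hj et /= e.
  by rewrite (oinj i j hi hj) // es et e.
rewrite -iterS iterSr in e.
case: (ltnP 1 j) => hj1; last first.
  have ej : j = 1 by lia.
  have [hroot _] : rooted_tree root par by case: td.
  have etr : t = root by apply: val_inj; rewrite /= -et ej o1.
  by apply: (IH t j hj et); rewrite -[RHS]e etr hroot.
have [|hp _ ep] := op j; first by lia.
apply: leq_trans (_ : pi j <= j); last by lia.
apply: (IH (par t) (pi j)) => //; first by lia.
by rewrite -ep et pfE.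
Qed.

(** The bags containing [a] are connected. If the parent of [s] lacked [a], a path through such bags
    could not leave the subtree of [s]; then [t] would be a descendant of [s] and have no smaller
    number. *)
Lemma rip i j (a : 'I_n) : j < i <= g -> a \in bag i -> a \in bag j -> a \in bag (pi i).
Proof.
move=> /andP[hji hi] hai haj.
have hj : 0 < j <= g.
  by apply/andP; split; [case: (j) haj => //=; rewrite inE | lia].
have hi0 : 1 < i <= g by lia.
have hi1 : 0 < i <= g by lia.
have [s [es bs]] := node_of hi1; have [t [et bt]] := node_of hj.
have [_ _ _ _ hconn] := td.
have [[o1 _] _ oinj _ op] := num.
apply/negPn/negP => hnp.
have parNa : a \notin chi (par s).
  have [hp _ ep] := op i hi0; move: hnp; rewrite (@bagE (pi i) (par s)) //; first by case/andP: hp.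
  by rewrite -ep es pfE.
rewrite bs in hai; rewrite bt in haj.
have /connectP[p hpath ep] := hconn a s t hai haj.
suff desc x : x \in s :: p -> fconnect par x s.
  have hts : fconnect par t s by apply: desc; rewrite ep mem_last.
  by have := ancestor_number hi1 hj es et hts; lia.
have gen y q : fconnect par y s -> a \in chi y ->
    path [rel x y | [&& tree_edge par x y, a \in chi x & a \in chi y]] y q ->
    forall x', x' \in y :: q -> fconnect par x' s.
  elim: q y => [|z q IH] y hy hay /=; first by move=> _ x'; rewrite inE => /eqP->.
  move=> /andP[/and3P[hyz _ haz] hq] x'; rewrite inE => /orP[/eqP->//|].
  apply: IH hq _ => //.
  move: hyz; rewrite /tree_edge /= => /andP[_ /orP[/eqP epar|/eqP epar]]; last first.
    by apply: connect_trans hy; rewrite -epar fconnect1.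
  have hys : y != s by apply: contraNneq parNa => <-; rewrite epar.
  move: (iter_findex hy) (findex par y s) => e k.
  case ek : (findex par y s) e => [|k'] /= e; first by rewrite e eqxx in hys.
  by rewrite -e -iterS iterSr epar; apply: fconnect_iter.
exact: gen (connect0 _ _) hai hpath x.
Qed.

Section Home.

Variable intro : nat -> nat.
Hypothesis (hintro : forall i (a : 'I_n), i <= g -> a \in bag i -> a \in bag (intro a) /\ intro a <= i).

Lemma atom_bag a : a \in atoms P -> exists2 i, 0 < i <= g & a \in bag i.
Proof.
move=> ha; have [_ _ hv _ _] := td; have [t ht] := hv a ha.
by have [i hi [_ e]] := number_of t; exists i => //; rewrite e.
Qed.

Lemma rule_atom (r : rule 'I_n) (a : 'I_n) : r \in P -> a \in rule_atoms r -> a \in atoms P.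
Proof. by move=> hr ha; apply/bigcupP; exists r. Qed.

Lemma rule_pair (r : rule 'I_n) (a b : 'I_n) : r \in P -> a \in rule_atoms r -> b \in rule_atoms r ->
  exists2 i, 0 < i <= g & (a \in bag i) && (b \in bag i).
Proof.
move=> hr ha hb; case: (eqVneq a b) => [<-|ne].
  by have [i hi h] := atom_bag (rule_atom hr ha); exists i; rewrite ?h.
have [_ _ _ he _] := td.
have [|t ht] := he a b (rule_atom hr ha) (rule_atom hr hb).
  by rewrite /primal_edge /= ne; apply/existsP; exists r; rewrite hr ha hb.
by have [i hi [_ e]] := number_of t; exists i => //; rewrite e.
Qed.

Lemma home_le (r : rule 'I_n) N : (home intro r <= N) = [forall a in rule_atoms r, intro a <= N].
Proof.
rewrite /home !geq_max; apply/andP/forall_inP => [[/andP[/bigmax_leqP h1 /bigmax_leqP h2] /bigmax_leqP h3] a|h].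
  by rewrite !inE => /orP[/orP[/h1|/h2]|/h3].
split; first (apply/andP; split); apply/bigmax_leqP => a ha; apply: h; rewrite !inE ha ?orbT //.
Qed.

(* Helly property: the last of the first bags of the atoms of a rule contains all of them. *)
Lemma home_bag (r : rule 'I_n) : r \in P -> home intro r <= g /\ rule_atoms r \subset bag (home intro r).
Proof.
move=> hr.
have hg : home intro r <= g.
  rewrite home_le; apply/forall_inP => a ha; have [i hi h] := atom_bag (rule_atom hr ha).
  by have [_ h2] := hintro (proj2 (andP hi)) h; apply: leq_trans h2 _; case/andP: hi.
split=> //.
case: (set_0Vmem (rule_atoms r)) => [->|[a1 ha1]]; first exact: sub0set.
have [a ha hmax] : exists2 a, a \in rule_atoms r & forall b, b \in rule_atoms r -> intro b <= intro a.
  by case: (arg_maxnP (fun a : 'I_n => intro a) ha1) => a ha h; exists a.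
have eh : home intro r = intro a.
  apply/eqP; rewrite eqn_leq home_le; apply/andP; split; first by apply/forall_inP.
  by have := leqnn (home intro r); rewrite {1}home_le => /forall_inP; apply.
rewrite eh; apply/subsetP => b hb.
have [j hj /andP[haj hbj]] := rule_pair hr ha hb.
(* Starting from a common bag of [a] and [b], move to the parent as long as the number exceeds
   [intro a]. Both atoms survive each move, since both first bags come earlier. *)
elim/ltn_ind: j hj haj hbj => j IH hj haj hbj.
have [h1 h2] := hintro (proj2 (andP hj)) haj.
move: h2; rewrite leq_eqVlt => /orP[/eqP->//|lt].
have hp := pi_lt hj.
have hja : intro a < j <= g by rewrite lt; case/andP: hj.
have pa : a \in bag (pi j) by apply: rip haj h1.
have [k1 k2] := hintro (proj2 (andP hj)) hbj.
have hjb : intro b < j <= g.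
  by rewrite (leq_ltn_trans (hmax b hb) lt); case/andP: hj.
have pb : b \in bag (pi j) by apply: rip hbj k1.
apply: (IH (pi j)) => //.
apply/andP; split; last by case/andP: hj; lia.
by case: (pi j) pa => //=; rewrite inE.
Qed.

End Home.

(** A rule on [X] is a triple of subsets of [X], and the cube of 2^m is 8^m. *)
Lemma rules_on_set (X : {set 'I_n}) : #|[set r : rule 'I_n | rule_atoms r \subset X]| <= 8 ^ #|X|.
Proof.
have h : [set r : rule 'I_n | rule_atoms r \subset X] \subset
   setX (setX (powerset X) (powerset X)) (powerset X).
  apply/subsetP => -[[h p] q]; rewrite !inE /rule_atoms /rhead /rpos /rneg /= => hs.
  by move: hs; rewrite !subUset.
apply: leq_trans (subset_leq_card h) _; rewrite !cardsX !card_powerset.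
by rewrite -!expnMn.
Qed.

Lemma rule_node (r : rule 'I_n) : r \in P -> exists t : 'I_g, rule_atoms r \subset chi t.
Proof.
(* The least index of a bag containing an atom serves as intro. *)
pose intro (a : nat) := find (fun i => if insub a is Some b then (b : 'I_n) \in bag i else false) (iota 0 g.+1).
have hintro i (a : 'I_n) : i <= g -> a \in bag i -> a \in bag (intro a) /\ intro a <= i.
  move=> hi ha; rewrite /intro valK.
  have hh : has (fun i => a \in bag i) (iota 0 g.+1).
    by apply/hasP; exists i => //; rewrite mem_iota add0n ltnS.
  have hlt := hh; rewrite has_find size_iota in hlt.
  split; first by have := nth_find 0 hh; rewrite nth_iota // add0n.
  rewrite leqNgt; apply/negP => lt; have := before_find 0 lt.
  by rewrite nth_iota ?add0n ?ha // ltnS.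
move=> hr; have [h1 h2] := home_bag hintro hr.
case: (posnP (home intro r)) => h0.
  by exists root; move: h2; rewrite h0 => /subset_trans; apply; apply: sub0set.
by have [|t [_ e]] := @node_of (home intro r); [rewrite h0 h1 | exists t; rewrite -e].
Qed.

(** A rule spans a clique of the primal graph and therefore lies in some bag ([rule_node]). This
    bound keeps the length of the input out of the running time. *)
Lemma program_size K : \max_(t : 'I_g) scard (chi t) = K -> #|P| <= g * 8 ^ K.
Proof.
move=> hK; have h : P \subset \bigcup_(t : 'I_g) [set r : rule 'I_n | rule_atoms r \subset chi t].
  by apply/subsetP => r /rule_node [t ht]; apply/bigcupP; exists t; rewrite ?inE.
apply: leq_trans (subset_leq_card h) _.
apply: leq_trans (_ : _ <= \sum_(t : 'I_g) #|[set r : rule 'I_n | rule_atoms r \subset chi t]|) _.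
  elim/big_rec2: _ => [|t m X _ hX]; first by rewrite cards0.
  by apply: leq_trans (leq_card_setU _ _) _; rewrite leq_add2l.
rewrite -[X in X * _](card_ord g) -sum_nat_const; apply: leq_sum => t _.
apply: leq_trans (rules_on_set _) _; rewrite leq_exp2l //.
by rewrite -hK; apply: (leq_bigmax t).
Qed.

End NumberedBags.

Ltac frs := repeat
  match goal with
  | F : frame _ _ ?s |- context [reg ?s ?k] => rewrite (proj1 F k isT)
  | F : frame _ _ ?s |- context [arr ?s ?k] => rewrite (proj2 F k isT)
  end.

(** One summand for each phase of [answer_program], nested like the sequence of commands, so that
    [wp_seq] splits it literally. *)
Definition budget (nr g K : nat) : nat :=
  let M := state_bound K in
  nr + (g + (g + ((2 * g + 2) + (g.+2 + (g * (K * K.+3).+1 + (2 * K +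
   ((2 ^ K + 1) * (2 ^ K + 1).+1 + (M * (K * (K + K).+1).+1 + (M * K.+1 + (g.+2 +
    (nr * (4 * K + 4 ^ K * K.+1).+1 + ((g + 1) * (M * K.+1).+1 + g * (step_budget K M).+1)))))))))))).

Section Keys.

Variable K : nat.

(** This bound and the next keep the lookups in [aFire] inside the row of the bag, where
    [rules_spec] describes the entries. *)
Lemma key2_bound v : valid K v -> key2 v < 4 ^ K.
Proof.
move=> /andP[hu ha].
have -> : key2 v = base4 [seq (x.1, 2) | x <- v].
  by rewrite /key2 /base4 -map_comp; congr sumn; apply: eq_map => x /=; rewrite mul2n addnn.
apply: base4_bound.
- by rewrite /unzip1 -map_comp.
- by apply/allP => x /mapP[y _ ->].
- apply/allP => x /mapP[y hy ->] /=; apply: (allP ha); exact: map_f.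
Qed.

Lemma entry_key_bound u c (b : bool) w : valid K (u ++ (c, b) :: w) ->
  key2 u + (4 ^ c + (4 ^ c + (4 ^ c + key1 w))) < 4 ^ K.
Proof.
move=> /andP[hu ha].
have -> : key2 u + (4 ^ c + (4 ^ c + (4 ^ c + key1 w))) =
    base4 ([seq (x.1, 2) | x <- u] ++ (c, 3) :: [seq (x.1, 1) | x <- w]).
  rewrite base4_cat; congr (_ + _).
    by rewrite /key2 /base4 -map_comp; congr sumn; apply: eq_map => x /=; rewrite mul2n addnn.
  rewrite /base4 /= -map_comp /key1.
  have -> : [seq ((fun x : nat * nat => x.2 * 4 ^ x.1) \o (fun x : nat * bool => (x.1, 1))) i | i <- w] = [seq 4 ^ x.1 | x <- w].
    by apply: eq_map => x /=; rewrite mul1n.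
  by lia.
apply: base4_bound.
- by move: hu; rewrite /cols /unzip1 !map_cat /= -!map_comp.
- by apply/allP => x; rewrite mem_cat inE => /or3P[/mapP[y _ ->]|/eqP->|/mapP[y _ ->]].
- apply/allP => x; rewrite mem_cat inE => hx; apply: (allP ha).
  rewrite /cols /unzip1 map_cat mem_cat inE.
  case/or3P: hx => [/mapP[y hy ->]|/eqP->|/mapP[y hy ->]] /=; rewrite ?eqxx ?orbT //.
    by apply/orP; left; apply: (map_f fst hy).
  by do 2!(apply/orP; right); apply: (map_f fst hy).
Qed.

Lemma eq_init_ok (fire fire' usable usable' : nat -> bool) v : valid K v ->
  (forall key, key < 4 ^ K -> fire key = fire' key) -> (forall c, c < K -> usable c = usable' c) ->
  init_ok fire usable v -> init_ok fire' usable' v.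
Proof.
move=> hv hf hus [h1 h2]; split; first by rewrite -hf // key2_bound.
move=> u c b w e; have := h2 u c b w e; rewrite /entry_ok => /andP[k1 k2].
have hc : c < K by case/andP: hv => _ /allP; apply; rewrite e /cols /unzip1 map_cat mem_cat mem_head orbT.
by rewrite -hus // k1 /= -hf //; apply: (@entry_key_bound u c b w); rewrite -e.
Qed.

End Keys.

Section Main.

Variables (n g : nat) (P : program 'I_n) (root : 'I_g) (par : 'I_g -> 'I_g) (chi : 'I_g -> {set 'I_n}).
Hypotheses (hcf : head_cycle_free P)
  (td : tree_decomposition (atoms P) (primal_edge P) root par chi).

(** The bound on the number of rules does not concern the final store; it is delivered here because
    its proof uses the numbering of the nodes that the run computes. *)
Lemma answer_program_spec w : instance_code P root par chi w ->
  let K := \max_(t : 'I_g) scard (chi t) in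
  wp answer_program (budget #|P| g K) (init_store w)
    (fun s => output s = nat_of_bool (has_answer_set P) /\ #|P| <= g * 8 ^ K).
Proof.
move=> [wP [wT [hP hT ew]]] K.
have [rs [hperm hszP hrs]] := program_codeE hP.
pose f := nth 0 w; have hf : word_at f 0 (wP ++ wT) by rewrite -ew.
have [f0 hrules] := hrs f (word_at_catl hf).
pose D := size wP; have [fD fD1 fpar fbag] := decomposition_codeE hT (word_at_catr hf).
rewrite add0n -/D in fD fD1 fpar fbag.
have hnr : size rs = #|P| by rewrite (perm_size hperm) -cardE.
have mem_rs r : (r \in rs) = (r \in P) by rewrite (perm_mem hperm) mem_enum.
pose pf t := f (D + 2 + t).
have [[hroot hreach] _ _ _ _] := td.
have hpf t : t < g -> pf t < g by move=> ht; rewrite /pf (fpar (Ordinal ht)).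
have hreach' t : t < g -> exists k, iter k pf t = root.
  move=> ht; have := hreach (Ordinal ht) => /iter_findex; move: (findex _ _ _) => k e.
  exists k; rewrite -e -[X in iter k pf X]/(val (Ordinal ht)).
  by elim: k {e} => //= k ->; rewrite /pf fpar.
rewrite /answer_program /budget -hnr; set M := state_bound K.
set s0 := init_store w.
have z0 a : a != 0 -> arr s0 a = (fun _ => 0).
  by move=> ha; rewrite /s0 /= (negPf ha).
have e0 : arr s0 aIn = f by [].
apply: wp_seq (leqnn _) _; apply: wp_conseq (@skip_rules_spec n s0 rs f0 hrules) (leqnn _) _.
move=> s1 F1 [q1 q2] _; rewrite -hszP -/D in q2.
apply: wp_seq (leqnn _) _.
apply: wp_conseq (@read_tree_spec n g root chi s1 D q2 _ _ _) (leqnn _) _; [by frs|by frs|by move=> t; frs; apply: fbag|].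
move=> s2 F2 [[g2 g12 g22] r2 p2 k2 b2] _.
apply: wp_seq (leqnn _) _.
apply: wp_conseq (@children_spec g root pf (ltn_ord root) s2 (D + 2) g2 r2 p2 _ _) (leqnn _) _.
- by move=> t _; frs.
- by frs; rewrite z0.
move=> s3 F3 hch _.
apply: wp_seq (leqnn _) _.
apply: wp_conseq (@bfs_spec g root pf (ltn_ord root) hpf hreach' s3 _ _ hch) (leqnn _) _.
- by frs.
- by frs; rewrite z0.
move=> s4 F4 num _.
pose od := arr s4 aOrd; pose pi := arr s4 aPi.
rewrite -/od -/pi in num.
have pfE (t : 'I_g) : pf t = par t by rewrite /pf fpar.
pose B := bag chi od.
have Bp i : 0 < i <= g -> pi i < i by apply: (pi_lt num).
have BK i : scard (B i) <= K by apply: (bag_bound od i erefl).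
have Brip i j (a : 'I_n) : j < i <= g -> a \in B i -> a \in B j -> a \in B (pi i) by apply: (rip td pfE num).
apply: wp_seq (leqnn _) _.
apply: wp_conseq (@rows_spec s4 g.+2 K _ _) (leqnn _) _; [by frs; rewrite g22 addn2|by frs|].
move=> s5 F5 hrk _.
apply: wp_seq (leqnn _) _.
apply: wp_conseq (@colouring_spec n K g B pi erefl BK Bp Brip s5 _ _ hrk _ _) (leqnn _) _.
- by frs.
- move=> i hi; have [t [et bt]] := node_of chi num hi.
  have -> : arr s5 aIn = f by frs.
  have -> : arr s5 aOrd i = t by rewrite -et /od; frs.
  have -> : arr s5 aBst t = bag_pos chi (D + 2 + g) t by rewrite -b2; frs.
  by rewrite /B bt; apply: fbag.
- by frs; rewrite z0.
- by frs; rewrite z0.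
move=> s6 F6; pose col := arr s6 aCol; pose intro := arr s6 aIntro; pose colat := arr s6 aColat.
rewrite -/col -/intro -/colat => -[hcol hinj hcells] _.
have hintro i (a : 'I_n) : i <= g -> a \in B i -> a \in B (intro a) /\ intro a <= i.
  by move=> hi ha; have [] := hcol i a hi ha.
have hhome r : r \in P -> home intro r <= g /\ rule_atoms r \subset B (home intro r).
  by move=> hr; apply: (home_bag td pfE num hintro).
apply: wp_seq (leqnn _) _.
apply: wp_conseq (@powers_spec s6 K _) (leqnn _) _; first by frs.
move=> s7 F7 [hp4 hq hw1] _.
apply: wp_seq (leqnn _) _.
apply: wp_conseq (@products_spec s7 (2 ^ K + 1) hw1) (leqnn _) _.
move=> s8 F8 hprod _.
apply: wp_seq (leqnn _) _.
apply: wp_conseq (@trie_spec K s8 _ _ _) (leqnn _) _.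
- by frs.
- by move=> c hc; frs; apply: hp4.
- by move=> a; rewrite !inE => /or3P[] /eqP->; frs; rewrite z0.
move=> s9 F9 [Q [hfull hM]] _.
have hMQ : size Q <= M.
  case: hfull => hu hv _ _ _; apply: uniq_states_bound => //.
  by apply/allP => v; rewrite hv.
apply: wp_seq (leqnn _) _.
apply: wp_conseq (@trie_maps_spec K s9 Q hfull hM _ _ _) _ _.
- by frs.
- by frs; rewrite z0.
- by frs; rewrite z0.
- by rewrite leq_mul2r hMQ orbT.
move=> s10 F10 hmaps _.
apply: wp_seq (leqnn _) _.
apply: wp_conseq (@table_rows_spec s10 g.+2 (size Q) (4 ^ K) _ _ _) (leqnn _) _.
- by frs; rewrite g22 addn2.
- by frs.
- by frs.
move=> s11 F11 hrows _.
have st11 : state_tables K Q s11.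
  apply: (state_tables_frame F11) => //; split=> //.
  - exact: full_trie_frame F10 _ hfull.
  - by frs.
  - by frs.
apply: wp_seq (leqnn _) _.
apply: wp_conseq (@rules_spec n K rs s11 g.+2 _ _ _ _ _ _ _ _ _) (leqnn _) _.
- by frs.
- by frs.
- by frs.
- by frs.
- move=> r; rewrite mem_rs => hr; have [_ /subsetP hsub] := hhome r hr.
  have bnd (X : {set 'I_n}) : X \subset rule_atoms r -> scard X <= K.
    move=> /subsetP hX; apply: leq_trans (BK (home intro r)).
    by apply: subset_leq_card; apply/subsetP => a /hX; apply: hsub.
  by split; apply: bnd; apply/subsetP => a ha; rewrite !inE ha ?orbT.
- move=> r; rewrite mem_rs => hr; have [hg /subsetP hsub] := hhome r hr.
  have -> : arr s11 aIntro = intro by frs.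
  have -> : arr s11 aCol = col by frs.
  split; first by rewrite ltnS leqW.
  by move=> a /hsub ha; have [/andP[]] := hcol _ a hg ha.
- by move=> c hc; frs; apply: hp4.
- by move=> i hi; have [] := hrows i hi.
- by frs; rewrite z0.
move=> s12 F12.
have -> : arr s11 aIntro = intro by frs.
have -> : arr s11 aCol = col by frs.
move=> hfire _.
have st12 : state_tables K Q s12 by apply: (state_tables_frame F12).
have [hfull12 _ hM12 _] := st12.
apply: wp_seq (leqnn _) _.
apply: wp_conseq (@init_tables_spec K Q s12 g.+2 (g + 1) hfull12 _ hM12 _ _ _ _) _ _.
- by move=> c hc; frs; apply: hp4.
- by frs.
- by lia.
- by move=> i hi; frs; apply: hrows.
- by move=> i hi; frs; apply: hrk.
- by rewrite leq_mul2l ltnS leq_mul2r hMQ !orbT.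
have -> : arr s12 aColat = colat by frs.
move=> s13 F13 hinit _.
have st13 : state_tables K Q s13 by apply: (state_tables_frame F13).
pose T0 := initial_table K P B col (home intro).
have colatE q c : q <= g -> c < K -> colat (q * K + c) = if at_ B col q c is Some a then (a : nat).+1 else 0.
  move=> hqg hc; have hqi := hinj q hqg; have hqc := hcells q hqg c hc.
  rewrite /at_; case: pickP => [a /andP[ha /eqP ea]|hn]; case: hqc => [[h1 h2]|[a' h1 [h2 h3]]] //.
  - by have := h2 a; rewrite mem_enum ha ea eqxx => /(_ isT).
  - have ha' : a' \in B q by move: h1; rewrite mem_enum.
    have haE : a \in enum (B q) by rewrite mem_enum.
    by rewrite h2; congr (_.+1); congr nat_of_ord; apply: hqi => //; rewrite h3 ?ea.
  - have ha' : a' \in B q by move: h1; rewrite mem_enum.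
    by have := hn a'; rewrite ha' h3 eqxx.
have hT0 : tables_hold g Q T0 (arr s13 aT).
  move=> q j v hqg hj; have hqg1 : q < g + 1 by rewrite addn1.
  have [h1 h2] := hinit q j v hqg1 hj.
  split=> //; rewrite h2; have hv := node_valid st13 hj.
  have e1 key : key < 4 ^ K -> (arr s12 aFire (q * 4 ^ K + key) != 0) = fire_table K P col (home intro) q key.
    move=> hk; rewrite hfire //; apply/hasP/existsP => [[r]|[r /and3P[u1 u2 u3]]].
      by rewrite mem_rs => u1 /andP[u2 u3]; exists r; rewrite u1 u2.
    by exists r; rewrite ?mem_rs ?u2.
  have e2 c : c < K -> (colat (q * K + c) != 0) = isSome (at_ B col q c).
    by move=> hc; rewrite colatE //; case: (at_ _ _ _ _).
  split=> [h|[_ h]]; last first.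
    by apply: (eq_init_ok hv _ _ h) => [key hk|c hc]; rewrite ?e1 ?e2.
  split; first exact: hv.
  by apply: (eq_init_ok hv _ _ h) => [key hk|c hc]; rewrite ?e1 ?e2.
apply: (@wp_seq (g * (step_budget K M).+1) 0); first by rewrite addn0.
apply: wp_conseq (@joins_spec K g Q pi (sh pi (at_ B col)) s13 T0 st13 _ _ _ _ _ _ _ hT0) _ _.
- by frs.
- by frs.
- by move=> i hi; frs; have [] := hrows i hi.
- by move=> i hi; frs; apply: hrk.
- by move=> i hi; split; [rewrite /pi; frs|apply: Bp].
- move=> i c hi hc; have -> : arr s13 aColat = colat by frs.
  have hp := Bp i hi.
  rewrite !colatE //; [|lia|lia].
  by rewrite /sh; case: (at_ B col i c) => [a|]; case: (at_ B col (pi i) c) => [b|].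
- by move=> a b ha hb; frs; apply: hprod.
- rewrite leq_mul2l ltnS /step_budget; apply/orP; right.
  by rewrite !(leq_add, leq_mul, ltnS).
move=> s14 F14 hfin _; wrun; split; last first.
  by rewrite hnr; apply: (program_size td pfE num erefl).
have [hu hv hroot0 _ _] := hfull12.
have [hle hiff] := hfin 0 0 [::] (leq0n g) hroot0; rewrite mul0n addn0 in hle hiff.
have hfnd : after_joins K g pi (sh pi (at_ B col)) T0 g 0 [::] <-> has_answer_set P.
  rewrite (has_answer_setP hcf); apply: (joins_founded (hm := home intro)) => //.
  - by move=> q a hqg ha; have [] := hcol q a hqg ha.
  - move=> q a b hqg ha hb; apply: (hinj q hqg); rewrite ?mem_enum //.
    by have [/andP[h _] _ _] := hcol q a hqg ha; rewrite -lt0n.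
rewrite /output /=; case: (boolP (has_answer_set P)) => hans.
  have /hiff h : after_joins K g pi (sh pi (at_ B col)) T0 g 0 [::] by apply/hfnd.
  by move: hle h; case: (arr s14 aT 0) => [|[]].
case: (eqVneq (arr s14 aT 0) 0) => // hne; case/negP: hans.
by apply/hfnd/hiff.
Qed.

End Main.

Lemma step_budget_growth K : step_budget K (state_bound K) <= 40 * growth K.
Proof.
rewrite /step_budget /growth /state_bound expnS expn1.
have h1 : 0 < 2 ^ K * K`! by rewrite muln_gt0 expn_gt0 fact_gt0.
by move: (2 ^ K * K`!) (64 ^ K) h1 => x z h1; nia.
Qed.

Lemma budget_growth nr g K : nr <= g * 8 ^ K -> 0 < g ->
  budget nr g K <= 200 * (g * growth K).
Proof.
move=> hnr hg; rewrite /budget.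
have h2 := step_budget_growth K.
have hz : 0 < 64 ^ K by rewrite expn_gt0.
have hx : 0 < 2 ^ K * K`! by rewrite muln_gt0 expn_gt0 fact_gt0.
have hK : K.+1 <= 2 ^ K by apply: ltn_expl.
have ha : 0 < 2 ^ K by rewrite expn_gt0.
have h8 : 8 ^ K <= 64 ^ K by rewrite (_ : 64 ^ K = 8 ^ K * 8 ^ K) ?leq_pmulr ?expn_gt0 // -expnMn.
(* The base 64 is the product of 8, 4 and 2: rules per bag, keys per rule, and [2 ^ K] as a bound
   for the [K.+1] units spent on each key. *)
have hrules : nr * (4 * K + 4 ^ K * K.+1).+1 <= 6 * (g * 64 ^ K).
  have e64 : 64 ^ K = 8 ^ K * 8 ^ K by rewrite -expnMn.
  have e8 : 8 ^ K = 4 ^ K * 2 ^ K by rewrite -expnMn.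
  have h : (4 * K + 4 ^ K * K.+1).+1 <= 6 * 8 ^ K.
    have : 0 < 4 ^ K by rewrite expn_gt0.
    by rewrite e8; move: (4 ^ K) (2 ^ K) hK => b a hK hb; nia.
  apply: leq_trans (leq_mul hnr h) _; rewrite e64; move: (8 ^ K) => b; nia.
have hpow : (2 ^ K + 1) * (2 ^ K + 1).+1 <= 6 * 64 ^ K.
  have -> : 64 ^ K = 2 ^ K * 2 ^ K * 16 ^ K by rewrite -!expnMn.
  have : 0 < 16 ^ K by rewrite expn_gt0.
  by move: (2 ^ K) (16 ^ K) ha => a c hc; nia.
set y := K.+1 ^ 2 * (2 ^ K * K`!).
have hS : K.+1 * K.+1 <= y by rewrite /y expnS expn1 leq_pmulr.
have hM : state_bound K * (K * (K + K).+1).+1 <= 6 * y.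
  by rewrite /y /state_bound expnS expn1; move: (2 ^ K * K`!) hx => x hx; nia.
have hMS : state_bound K * K.+1 <= 2 * y.
  by rewrite /y /state_bound expnS expn1; move: (2 ^ K * K`!) hx => x hx; nia.
have -> : growth K = y + 64 ^ K by [].
have {}h2 : step_budget K (state_bound K) <= 40 * (y + 64 ^ K) by [].
have hg1 : g * (K * K.+3).+1 <= 3 * (g * y) by nia.
have hg2 : (g + 1) * (state_bound K * K.+1).+1 <= 2 * (2 * (g * y) + g) by nia.
have hg3 : g * (step_budget K (state_bound K)).+1 <= 40 * (g * y + g * 64 ^ K) + g by nia.
have hg4 : nr <= g * 64 ^ K by apply: leq_trans hnr _; rewrite leq_mul2l h8 orbT.
have hy : 0 < y by lia.
have hgy : y <= g * y by rewrite leq_pmull.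
have hgz : 64 ^ K <= g * 64 ^ K by rewrite leq_pmull.
have hgg : g <= g * y by rewrite leq_pmulr.
have hKy : K <= y by lia.
rewrite mulnDr.
move: (g * (K * K.+3).+1) (state_bound K * (K * (K + K).+1).+1) (state_bound K * K.+1) ((2 ^ K + 1) * (2 ^ K + 1).+1)
  (nr * _) ((g + 1) * _) (g * (step_budget _ _).+1) (g * y) (g * 64 ^ K) (64 ^ K)
  hrules hpow hg1 hg2 hg3 hg4 hgy hgz hgg hM hMS => *.
lia.
Qed.

(** The factor 201 is the 200 of [budget_growth] plus one for the successor in the time bound of
    [wp]. *)
Lemma exec_bound (n g : nat) (P : program 'I_n) (root : 'I_g) (par : 'I_g -> 'I_g)
    (chi : 'I_g -> {set 'I_n}) (w : seq nat) :
  head_cycle_free P -> tree_decomposition (atoms P) (primal_edge P) root par chi ->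
  instance_code P root par chi w ->
  exists t s, [/\ exec answer_program (init_store w) t s,
    output s = nat_of_bool (has_answer_set P) &
    t <= csize answer_program * 201 * (g * growth (width chi).+1)].
Proof.
move=> hcf td hw; have [t [i [s [hexec ht hi [ho hsz]]]]] := answer_program_spec hcf td hw.
exists t, s; split=> //; apply: leq_trans ht _.
rewrite -mulnA leq_mul2l; apply/orP; right.
have hg : 0 < g by apply: leq_trans (ltn_ord root).
move: hsz hi; set K := \max_(_ < _) _ => hsz hi.
(* Equality holds unless all bags are empty, when [K] and the width are both 0; monotonicity of
   [growth] covers this case too. *)
have hK : K <= (width chi).+1 by rewrite /width -/K leqSpred.
have h := leq_trans hi (budget_growth hsz hg).
have hgr := growth_mono hK.
have h1 : 0 < growth (width chi).+1 by rewrite /growth addn_gt0 expn_gt0 orbT.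
by move: (growth _) (growth _) h hgr h1 => a b; nia.
Qed.

Theorem theorem3 :
  exists (c : cmd) (C1 : nat) (C2 : R),
  forall (n g : nat) (P : program 'I_n)
         (root : 'I_g) (par : 'I_g -> 'I_g) (chi : 'I_g -> {set 'I_n})
         (k : nat) (w : seq nat),
    atoms_in_heads P ->
    head_cycle_free P ->
    tree_decomposition (atoms P) (primal_edge P) root par chi ->
    width chi = k ->
    instance_code P root par chi w ->
    exists (t : nat) (s : store),
      [/\ exec c (init_store w) t s,
          output s = nat_of_bool (has_answer_set P),
          t <= C1 * (3 ^ k * k`! * g)
        & (INR t <= C2 * (Rpower 2 (INR k * log2 (INR k)) * INR g))%Re].
Proof.
have [C1 h1] := growth_fact; have [C2 h2] := growth_pow.
(* The constant is made an opaque variable, so that the closed numeral [csize answer_program * 201]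
   is not evaluated in what follows. *)
have [c0 hspec] : exists c0 : nat, forall (n g : nat) (P : program 'I_n) (root : 'I_g)
    (par : 'I_g -> 'I_g) (chi : 'I_g -> {set 'I_n}) (w : seq nat),
    head_cycle_free P -> tree_decomposition (atoms P) (primal_edge P) root par chi ->
    instance_code P root par chi w ->
    exists t s, [/\ exec answer_program (init_store w) t s,
      output s = nat_of_bool (has_answer_set P) & t <= c0 * (g * growth (width chi).+1)].
  by eexists=> n g P root par chi w; apply: exec_bound.
exists answer_program, (c0 * C1), (INR (c0 * C2)) => n g P root par chi k w _ hcf td hk hw.
have [t [s [hexec ho ht]]] := hspec n g P root par chi w hcf td hw.
rewrite hk in ht; exists t, s; split=> //.
- apply: leq_trans ht _. rewrite -mulnA leq_mul2l [g * _]mulnC mulnA leq_mul2r h1 !orbT //.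
have e : INR (c0 * C2 * (k ^ k * g)) = (INR (c0 * C2) * (INR (k ^ k) * INR g))%Re by rewrite mult_INR [INR (k ^ k * g)]mult_INR.
rewrite Rpower_log2 -e; apply: le_INR; apply/leP.
by apply: leq_trans ht _; rewrite -mulnA leq_mul2l [g * _]mulnC mulnA leq_mul2r h2 !orbT.
Qed.
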